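(* Let $k\ge 1$ be an integer, let $\alpha\in(0,1/2]$, and let $\xi$ be an $\alpha$-balanced random integer. For each $n\ge 1$ let $M_1,\dots,M_k$ be $k$ independent random $n\times n$ integral matrices whose entries are iid copies of $\xi$. Let $B$ be any finite abelian group, and let $P$ be a finite set of primes including all those that divide $|B|$. Then $$\lim_{n\to\infty}\mathbf{P}\big(\mathrm{Cok}(M_1\cdots M_k)[P]\simeq B\big)=\Big(\prod_{p\in P}(p^{-1};p^{-1})_\infty^k\Big)\frac{\#\{0=G_0\le G_1\le\cdots\le G_k=B\}}{\#\mathrm{Aut}(B)},$$ where the numerator counts chains of nested subgroups of $B$ starting at the trivial subgroup $G_0=0$ and ending at $G_k=B$.
   Context: A random integer $\xi$ is $\alpha$-balanced (for a real $\alpha\in(0,1/2]$) if for every prime $p$, $\max_{r\in\mathbb{Z}/p\mathbb{Z}}\mathbf{P}(\xi\equiv r \bmod p)\le 1-\alpha$. For $M\in\mathrm{Mat}_n(\mathbb{Z})$, $\mathrm{Cok}(M):=\mathbb{Z}^n/M\mathbb{Z}^n$. For an abelian group $G$ and a prime $p$, $G[p^\infty]$ denotes the $p$-Sylow subgroup (the $p^\infty$-torsion, i.e. elements of $p$-power order), and for a finite set $P$ of primes $G[P]:=\bigoplus_{p\in P}G[p^\infty]$. The $q$-Pochhammer symbol is $(a;q)_\infty:=\prod_{i\ge 0}(1-aq^i)$. *)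

(* Defs.v *)
From HB Require Import structures.
From mathcomp Require Import all_boot all_order all_algebra all_fingroup.
From mathcomp Require Import ring_quotient.
From mathcomp Require Import finmap.
From mathcomp Require Import all_classical all_reals all_analysis.

Set Implicit Arguments.
Unset Strict Implicit.
Unset Printing Implicit Defensive.

Import Order.TTheory GRing.Theory Num.Theory.

Local Open Scope ring_scope.

Definition mx_image (n : nat) (M : 'M[int]_n) : {pred 'cV[int]_n} :=
  fun v => `[< exists u : 'cV[int]_n, v = M *m u >].

Section MxImage.
Variables (n : nat) (M : 'M[int]_n).

Fact mx_image_zmod_closed : zmod_closed (mx_image M).
Proof.
split=> [|u v /asboolP[x ->] /asboolP[y ->]]; apply/asboolP.
- by exists 0; rewrite mulmx0.
- by exists (x - y); rewrite mulmxBr.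
Qed.

HB.instance Definition _ :=
  GRing.isZmodClosed.Build 'cV[int]_n (mx_image M) mx_image_zmod_closed.
End MxImage.

Definition Cok (n : nat) (M : 'M[int]_n) : zmodType :=
  Quotient.quot (mx_image M).

(* G[p^oo], as a subset of G *)
Definition primary_part (G : zmodType) (p : nat) : {pred G} :=
  fun x => `[< exists e : nat, x *+ (p ^ e) = 0 >].
Arguments primary_part : clear implicits.

(* Members of the direct sum of the G[p^oo] for p in P; since P is finite, the
   direct sum is the group of all families (f p)_(p in P) with f p in G[p^oo]. *)
Definition primary_family (G : zmodType) (P : {fset nat}) :
    {pred {ffun P -> G}} :=
  fun f => [forall p : P, f p \in primary_part G (val p)].
Arguments primary_family : clear implicits.

Section PrimarySum.
Variables (G : zmodType) (P : {fset nat}).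

Fact primary_family_zmod_closed : zmod_closed (primary_family G P).
Proof.
split=> [|f g /forallP Hf /forallP Hg]; apply/forallP => p.
  by apply/asboolP; exists 0%N; rewrite ffunE mul0rn.
have /asboolP[a Ha] := Hf p; have /asboolP[b Hb] := Hg p.
apply/asboolP; exists (a + b)%N; rewrite !ffunE mulrnBl expnD mulrnA Ha.
by rewrite mul0rn mulnC mulrnA Hb mul0rn subr0.
Qed.

HB.instance Definition _ := GRing.isZmodClosed.Build {ffun P -> G}
  (primary_family G P) primary_family_zmod_closed.

(* G[P] *)
Record primary_sum := PrimarySum {
  primary_sum_val :> {ffun P -> G};
  _ : primary_sum_val \in primary_family G P }.

HB.instance Definition _ := [isSub for primary_sum_val].
HB.instance Definition _ := [Choice of primary_sum by <:].
HB.instance Definition _ := [SubChoice_isSubZmodule of primary_sum by <:].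
End PrimarySum.

Definition zmod_isom (U V : zmodType) : Prop :=
  exists f : {additive U -> V}, bijective f.

(* The additive group of a finZmodType is its canonical finGroupType. *)
Definition subgroup_chains (B : finZmodType) (k : nat) :
    {set {ffun 'I_k.+1 -> {group B}}} :=
  [set G : {ffun 'I_k.+1 -> {group B}} |
    [&& G ord0 == 1%G, G ord_max == [set: B]%G
      & [forall i : 'I_k, G (widen_ord (leqnSn k) i) \subset G (lift ord0 i)]]].

Definition num_aut (B : finZmodType) : nat := #|Aut [set: B]|.

Local Open Scope classical_set_scope.

HB.instance Definition _ := isPointed.Build int 0.
HB.instance Definition _ := @isMeasurable.Build default_measure_display
  int (@discrete_measurable int) (@discrete_measurable0 int)
  (@discrete_measurableC int) (@discrete_measurableU int).

HB.instance Definition _ (m n : nat) :=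
  @isMeasurable.Build default_measure_display
  'M[int]_(m, n) (@discrete_measurable _) (@discrete_measurable0 _)
  (@discrete_measurableC _) (@discrete_measurableU _).

(* For p prime, 'F_p is Z/pZ; the neutral element 0 of the maximum is harmless
   since probabilities are nonnegative. *)
Definition alpha_balanced (d : measure_display) (T : measurableType d)
    (R : realType) (Pr : probability T R) (xi : T -> int) (alpha : R) : Prop :=
  forall p : nat, prime p ->
    (\big[maxe/0]_(r : 'F_p) Pr [set w | (xi w)%:~R = r] <= (1 - alpha)%:E)%E.

Definition mutually_independent (d : measure_display) (T : measurableType d)
    (R : realType) (Pr : probability T R) (I : choiceType)
    (d' : measure_display) (E : measurableType d') (X : I -> T -> E) : Prop :=
  forall (J : {fset I}) (A : I -> set E), (forall i, measurable (A i)) ->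
    (Pr (\bigcap_(i in [set` J]) (X i @^-1` A i)) =
     \prod_(i <- J) Pr (X i @^-1` A i))%E.

Definition same_law (d1 d2 d' : measure_display) (T1 : measurableType d1)
    (T2 : measurableType d2) (E : measurableType d') (R : realType)
    (Pr1 : probability T1 R) (Pr2 : probability T2 R)
    (X : T1 -> E) (Y : T2 -> E) : Prop :=
  forall A : set E, measurable A -> Pr1 (X @^-1` A) = Pr2 (Y @^-1` A).

Definition iid_entries (d d0 : measure_display) (T : measurableType d)
    (T0 : measurableType d0) (R : realType) (Pr : probability T R)
    (Pr0 : probability T0 R) (n : nat) (M : T -> 'M[int]_n) (xi : T0 -> int) :
    Prop :=
  mutually_independent Pr (fun (ij : 'I_n * 'I_n) w => M w ij.1 ij.2) /\
  forall i j : 'I_n, same_law Pr Pr0 (fun w => M w i j) xi.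

Definition qpochhammer (R : realType) (a q : R) : R :=
  limn (fun n : nat => \prod_(0 <= i < n) (1 - a * q ^+ i)).

(* Main.v *)
(* Put [b = #|B|], [Q] the product of the primes of [P], [a = Q b] and
   [V = (Z/a)^n].  When [det M <> 0], Cok(M)[P] is isomorphic to B if and only
   if some surjection [F : V -> B] has kernel [M V], and there are then #Aut(B)
   such surjections; singular matrices have vanishing probability.  Because [b]
   kills B, [ker F = im (M N)] is equivalent to [ker F <= im M] together with
   [ker (F M) = im N], so the matrices can be exposed one at a time.  The
   analytic core is the estimate, uniform in [F1 : V -> B] with image in H,
   of the sum over the [F] with image H of P(F M = F1 and ker F <= im M), which
   tends to c = prod_p (1/p; 1/p)_oo.  Iterating it k times attaches the factor
   c^k to each chain of images 0 = G_0 <= ... <= G_k = B.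

   For the estimate, the columns of [M] are exposed one at a time.  When the
   image of [F] is generated by values of [F] taken many times, [F x] is nearly
   uniform for a random column [x] by a Doeblin argument; the other [F] are
   few, and each column event is cheaper for them by a factor 1 - alpha.  After
   n - m columns the exposed subgroup of [F^-1(im F1)] typically has corank m
   modulo every prime p | a, and the last m columns complete it with
   probability close to prod_p prod_(i <= m) (1 - p^-i). *)

Require Import Defs.
From HB Require Import structures.
From mathcomp Require Import all_boot all_order all_algebra all_fingroup cyclic.
From mathcomp Require Import generic_quotient ring_quotient finmap.
From mathcomp Require Import all_classical all_reals all_analysis.
From mathcomp Require Import finset.
From mathcomp Require Import zify ring lra.

Set Implicit Arguments.
Unset Strict Implicit.
Unset Printing Implicit Defensive.

Import Order.TTheory GRing.Theory Num.Theory.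

Local Open Scope ring_scope.

(* Makes [B * 'Z_a] a finZmodType. *)
HB.saturate prod.

(** * Random walks on finite abelian groups *)

(** The factor [Q] of [a] is used twice. It makes [a / p] kill [B] for each prime [p] dividing [a]
    (hypothesis [torBp]), so that [F^-1(im F1)] contains the [p]-torsion of [V] and has full rank
    [n] modulo [p]; and it makes [det (1 + Q Z)] prime to [a], which lets one matrix be split off a
    product. Equidistribution on a quotient is controlled only if its index stays bounded as [n]
    grows. In the early exposure the index is about [p ^ (n - j)] after [j] columns, so there one
    only bounds the chance that a column is wasted, geometrically small in the remaining corank.
    Sharp probabilities are computed for the last [m] columns, where the index is at most [|B| a^m].
    Hence [m] is fixed before [n] tends to infinity. A value counts as frequent when taken [sqrt n]
    times: few enough that the cost [z^-(C sqrt n)] of counting exceptions loses to an exponential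
    gain in [n], many enough that [n] times the mixing error vanishes. The estimate is uniform in
    [F1] because [F1 = F M] becomes the [F] of the next matrix, with no control on its law. *)

Section AdditiveSubgroups.
Variables (G : finZmodType).
Implicit Types (K : {group G}) (x y : G).

Lemma group0 K : (0 : G) \in K. Proof. exact: group1. Qed.
Lemma groupD K x y : x \in K -> y \in K -> x + y \in K.
Proof. exact: groupM. Qed.
Lemma groupN K x : (- x \in K) = (x \in K).
Proof. exact: groupV. Qed.
Lemma groupB K x y : x \in K -> y \in K -> x - y \in K.
Proof. by move=> Kx Ky; rewrite groupD ?groupN. Qed.
Lemma groupMn K x n : x \in K -> x *+ n \in K.
Proof. exact: groupX. Qed.
Lemma groupDr K x y : x \in K -> (y + x \in K) = (y \in K).
Proof. exact: groupMr. Qed.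
Lemma groupDl K x y : x \in K -> (x + y \in K) = (y \in K).
Proof. exact: groupMl. Qed.
Lemma groupBr K x y : x \in K -> (y - x \in K) = (y \in K).
Proof. by move=> Kx; rewrite groupDr ?groupN. Qed.
Lemma group_subC K x y : (x - y \in K) = (y - x \in K).
Proof. by rewrite -opprB groupN. Qed.

Lemma zmod_joinP (A B : {group G}) x :
  reflect (exists2 u, u \in A & exists2 v, v \in B & x = u + v) (x \in A <*> B)%g.
Proof.
rewrite comm_joingE;   last by apply/centC/centsP => u _ v _; exact: addrC.
by apply: (iffP mulsgP) => [[u v Au Bv ->]|[u Au [v Bv ->]]]; [exists u => //; exists v|exists u v].
Qed.

Lemma zmod_cycleP x y : reflect (exists i, y = x *+ i) (y \in <[x]>)%g.
Proof. exact: cycleP. Qed.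

End AdditiveSubgroups.

(* The law of an alpha-balanced random integer modulo [a], with
   [law_rho = 1 - alpha]. *)
Record balanced_law (R : realType) (a : nat) := BalancedLaw {
  law_mu :> 'Z_a -> R;
  law_rho : R;
  law_gt1 : (1 < a)%N;
  law_ge0 : forall r, 0 <= law_mu r;
  law_sum : \sum_r law_mu r = 1;
  law_rho_ge0 : 0 <= law_rho;
  law_rho_lt1 : law_rho < 1;
  law_bal : forall p c : nat, prime p -> (p %| a)%N ->
    \sum_(r : 'Z_a | (r == c %[mod p])%N) law_mu r <= law_rho }.

Section Walk.
Variables (R : realType) (a : nat) (mu : balanced_law R a).
Let rho := law_rho mu.
Let a_gt1 : (1 < a)%N. Proof. exact: law_gt1 mu. Qed.
Let mu_ge0 r : 0 <= mu r. Proof. exact: law_ge0. Qed.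
Let mu_sum : \sum_r mu r = 1. Proof. exact: law_sum. Qed.
Let rho_lt1 : rho < 1. Proof. exact: law_rho_lt1. Qed.

(* The expectation of [f (v + sum_i x_i g_i)] for independent [x_i] of law [mu]. *)
Fixpoint walk (G : finZmodType) (gs : seq G) (f : G -> R) (v : G) : R :=
  if gs is g :: gs' then \sum_(r : 'Z_a) mu r * walk gs' f (v + g *+ r)
  else f v.

Section Basic.
Variable G : finZmodType.
Implicit Types (gs : seq G) (f h : G -> R) (v : G) (K : {group G}).

Lemma walk_cat gs1 gs2 f v : walk (gs1 ++ gs2) f v = walk gs1 (walk gs2 f) v.
Proof. by elim: gs1 v => //= g gs1 IH v; apply: eq_bigr => r _; rewrite IH. Qed.

Lemma ler_walk_on (P : pred G) gs f h v :
  (forall x g i, P x -> g \in gs -> P (x + g *+ i)) ->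
  (forall x, P x -> f x <= h x) -> P v -> walk gs f v <= walk gs h v.
Proof.
elim: gs v => [|g gs IH] v stab fh Pv /=; first exact: fh.
apply: ler_sum => r _; rewrite ler_wpM2l// IH//.
  by move=> x g' i Px g'gs; apply: stab => //; rewrite inE g'gs orbT.
by apply: stab; rewrite ?mem_head.
Qed.

Lemma ler_walk gs f h v : (forall x, f x <= h x) -> walk gs f v <= walk gs h v.
Proof. by move=> fh; apply: (@ler_walk_on predT). Qed.

Lemma eq_walk gs f h v : f =1 h -> walk gs f v = walk gs h v.
Proof. by move=> fh; apply/le_anti; rewrite !ler_walk // => x; rewrite fh. Qed.

Lemma walk_affine gs f c d v :
  walk gs (fun x => c + d * f x) v = c + d * walk gs f v.
Proof.
elim: gs v => //= g gs IH v.
under eq_bigr => r _ do rewrite IH mulrDr mulrCA.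
by rewrite big_split /= -mulr_suml mu_sum mul1r mulr_sumr.
Qed.

Lemma walk_const gs c v : walk gs (fun=> c) v = c.
Proof.
transitivity (c + 0 * walk gs (fun=> 0) v); last by rewrite mul0r addr0.
by rewrite -walk_affine; apply: eq_walk => x; rewrite mul0r addr0.
Qed.

Lemma walkZ gs f d v : walk gs (fun x => d * f x) v = d * walk gs f v.
Proof.
rewrite -[RHS]add0r -walk_affine; by apply: eq_walk => x; rewrite add0r.
Qed.

Lemma walk_ge0 gs f v : (forall x, 0 <= f x) -> 0 <= walk gs f v.
Proof. by move=> f0; rewrite -(walk_const gs 0 v) ler_walk. Qed.

Lemma walk_perm gs gs' f v : perm_eq gs gs' -> walk gs f v = walk gs' f v.
Proof.
move=> pgs; move: f v.
apply: (catCA_perm_ind (P := fun s => forall f v, walk gs f v = walk s f v)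
  _ pgs) => // s1 s2 s3 IH f v; rewrite IH !walk_cat.
have swap1 (g : G) s h w : walk (g :: s) h w = walk (s ++ [:: g]) h w.
  elim: s w => //= g' s IHs w.
  under [RHS]eq_bigr => r _ do rewrite -IHs /= mulr_sumr.
  rewrite exchange_big /=; apply: eq_bigr => r _; rewrite mulr_sumr.
  by apply: eq_bigr => r' _; rewrite mulrCA addrAC.
rewrite -!walk_cat catA walk_cat [in RHS]catA [RHS]walk_cat.
move: (walk s3 f) => {IH} h; elim: s1 s2 v => [|g s1 IHs] s2 v; first by rewrite cats0.
transitivity (walk (g :: (s2 ++ s1)) h v); first by apply: eq_bigr => r _; congr (_ * _); apply: IHs.
have -> : s2 ++ g :: s1 = (s2 ++ [:: g]) ++ s1 by rewrite -catA.
by rewrite [RHS]walk_cat -swap1 -walk_cat.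
Qed.

Lemma walk_shift gs f v w : walk gs f (v + w) = walk gs (fun x => f (x + w)) v.
Proof.
elim: gs v => //= g gs IH v; apply: eq_bigr => r _; by rewrite -IH addrAC.
Qed.

(** Each step translates by an element of [K], so the uniform measure on [K] is stationary. This
    identifies the limiting value in [equidistribution]. *)
Lemma walk_sum gs f K : {subset gs <= K} ->
  \sum_(v in K) walk gs f v = \sum_(v in K) f v.
Proof.
elim: gs => //= g gs IH gsK; rewrite exchange_big /=.
rewrite -[RHS]mul1r -mu_sum mulr_suml; apply: eq_bigr => r _.
rewrite -IH; last by move=> x xgs; apply: gsK; rewrite inE xgs orbT.
rewrite -mulr_sumr; congr (_ * _).
have gr : g *+ r \in K by rewrite groupMn // gsK // mem_head.
rewrite (reindex_inj (addIr (- (g *+ r)))) /=.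
by apply: eq_big => [x|x _]; rewrite ?groupBr ?subrK.
Qed.

Lemma walk_periodic (Gam : {group G}) gs f :
  (forall x y, y \in Gam -> f (x + y) = f x) ->
  forall x y, y \in Gam -> walk gs f (x + y) = walk gs f x.
Proof.
by move=> fper x y yG; rewrite walk_shift; apply: eq_walk => z; rewrite fper.
Qed.

Lemma walk_map_rep (Gam : {group G}) (h : G -> G) gs f v :
  (forall x y, y \in Gam -> f (x + y) = f x) -> (forall g, h g - g \in Gam) ->
  walk (map h gs) f v = walk gs f v.
Proof.
move=> fper hrep; elim: gs v => //= g gs IH v; apply: eq_bigr => r _.
rewrite IH; congr (_ * _).
have -> : h g *+ r = g *+ r + (h g - g) *+ r by rewrite mulrnBl addrC subrK.
by rewrite addrA; apply: walk_periodic fper _ _ _; rewrite groupMn.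
Qed.

End Basic.

(** Two multipliers that both lead into [K] differ by a multiple of the order [d > 1] of [g] modulo
    [K]. A prime factor of [d] divides [a], so the admissible [r] lie in one residue class modulo
    that prime and the balance condition applies. *)
Lemma step_not_in (G : finZmodType) (K : {group G}) (g v : G) :
  g *+ a = 0 -> g \notin K ->
  \sum_(r : 'Z_a) mu r * (v + g *+ r \in K)%:R <= rho.
Proof.
move=> ga gK.
have exd : exists d, (0 < d)%N && (g *+ d \in K).
  by exists a; rewrite ga group0 ltnW.
case: (ex_minnP exd) => d /andP[d0 gd] dmin.
have ddvd m : g *+ m \in K -> (d %| m)%N.
  rewrite {1}(divn_eq m d) mulrnDr mulnC mulrnA groupDl; last by rewrite groupMn.
  move=> gm; rewrite /dvdn; case: (ltnP 0 (m %% d)) => [m0|]; last by rewrite leqn0.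
  by have := dmin (m %% d)%N; rewrite m0 /= => /(_ gm); rewrite leqNgt ltn_mod d0.
have d1 : d != 1%N by apply: contraNneq gK => d1; move: gd; rewrite d1.
have pp : prime (pdiv d) by rewrite pdiv_prime // ltn_neqAle eq_sym d1.
have pa : (pdiv d %| a)%N.
  by apply: dvdn_trans (pdiv_dvd d) _; apply: ddvd; rewrite ga group0.
case: (pickP (fun r : 'Z_a => v + g *+ r \in K)) => [r0 Kr0|none]; last first.
  by rewrite big1 ?law_rho_ge0 // => r _; rewrite none mulr0.
apply: le_trans (law_bal mu r0 pp pa).
rewrite [leRHS]big_mkcond; apply: ler_sum => r _.
case Kr: (v + g *+ r \in K); last by rewrite mulr0; case: ifP.
rewrite mulr1.
suff -> : (r == r0 %[mod pdiv d])%N by [].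
have Kd : g *+ r - g *+ r0 \in K.
  by have := groupB Kr Kr0; rewrite opprD addrACA subrr add0r.
apply/eqP; wlog le : r r0 {Kr Kr0} Kd / (r0 <= r)%N.
  by move=> H; case/orP: (leq_total r0 r) => le; [apply: H|symmetry; apply: H; rewrite // group_subC].
apply/eqP; rewrite eqn_mod_dvd //.
by apply: dvdn_trans (pdiv_dvd d) _; apply: ddvd; rewrite mulrnBr.
Qed.


Lemma mulrn_modn (G : zmodType) (g : G) d m : g *+ d = 0 -> g *+ (m %% d) = g *+ m.
Proof. by move=> gd; rewrite {2}(divn_eq m d) mulrnDr mulnC mulrnA gd mul0rn add0r. Qed.

Lemma mulrn_ZpD (G : finZmodType) (g : G) (x y : 'Z_a) :
  g *+ a = 0 -> g *+ (x + y)%R = g *+ x + g *+ y.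
Proof. by move=> ga; rewrite /= mulrn_modn ?mulrnDr // Zp_cast. Qed.

Lemma Zp_torsion (x : 'Z_a) : x *+ a = 0.
Proof. by rewrite -mulr_natr pchar_Zp // mulr0. Qed.

Lemma Zp_mulrn1 (x : 'Z_a) : (1 : 'Z_a) *+ x = x.
Proof. exact: natr_Zp. Qed.

Definition conv_pow N (r : 'Z_a) : R := walk (nseq N (1 : 'Z_a)) (fun x => (x == r)%:R) 0.

Lemma conv_powS N r : conv_pow N.+1 r = \sum_s mu s * conv_pow N (r - s).
Proof.
transitivity (\sum_s mu s * walk (nseq N (1 : 'Z_a)) (fun x => (x == r)%:R) (0 + 1 *+ s)) => //.
apply: eq_bigr => s _; congr (_ * _); rewrite walk_shift Zp_mulrn1.
by apply: eq_walk => x; rewrite eq_sym -subr_eq eq_sym.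
Qed.

Lemma conv_pow_ge0 N r : 0 <= conv_pow N r.
Proof. by apply: walk_ge0 => x. Qed.

Lemma walk_nseq (G : finZmodType) (g : G) N f v : g *+ a = 0 ->
  walk (nseq N g) f v = \sum_r conv_pow N r * f (v + g *+ r).
Proof.
move=> ga; elim: N v => [|N IH] v.
  rewrite (bigD1 0) //= big1 => [|r r0]; last by rewrite /conv_pow /= eq_sym (negPf r0) mul0r.
  have -> : conv_pow 0 0 = 1 by rewrite /conv_pow /= ?eqxx.
  by rewrite mul1r mulr0n !addr0.
under [RHS]eq_bigr => r _ do rewrite conv_powS mulr_suml.
rewrite exchange_big /=; apply: eq_bigr => s _; rewrite IH mulr_sumr.
rewrite [RHS](reindex_inj (addrI s)) /=; apply: eq_bigr => r _.
by rewrite mulrn_ZpD // addrA mulrA [s + r]addrC addrK.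
Qed.

Lemma conv_pow_sum N : \sum_r conv_pow N r = 1.
Proof.
rewrite -[RHS](walk_const (nseq N (1 : 'Z_a)) 1 0) walk_nseq ?Zp_torsion //.
by apply: eq_bigr => r _; rewrite mulr1.
Qed.

Lemma fin_lower_bound (T : finType) (c : T -> R) : (forall r, 0 < c r) ->
  exists2 eta : R, 0 < eta <= 1 & forall r, eta <= c r.
Proof.
move=> c0; exists (\big[Num.min/1]_r c r) => [|r]; last exact: bigmin_le_cond.
by rewrite bigmin_le_id andbT lt_bigmin ?ltr01.
Qed.

(* Once the support stops growing, it is stable under the differences of the
   values of mu, which generate Z/a because mu is balanced. *)
Lemma conv_pow_gt0 : exists N, forall r, 0 < conv_pow N r.
Proof.
pose T N := [set r | 0 < conv_pow N r].
have psum (F : 'Z_a -> R) : (forall r, 0 <= F r) -> 0 < \sum_r F r -> exists r, 0 < F r.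
  move=> F0; rewrite lt_neqAle eq_sym psumr_neq0 // => /andP[/hasP[r _ Fr] _].
  by exists r.
have [s0 ms0] : exists s, 0 < mu s by apply: psum => //; rewrite mu_sum ltr01.
have TS N r s : 0 < mu s -> r \in T N -> r + s \in T N.+1.
  rewrite !inE => ms cr; rewrite conv_powS (bigD1 s) //= addrK.
  by rewrite ltr_pwDl ?mulr_gt0 // sumr_ge0 // => i _; rewrite mulr_ge0 ?conv_pow_ge0.
(* A translate of [T N] lies in [T N.+1]. The cardinals are bounded by [#|'Z_a|], so they cannot
   increase strictly forever. *)
have [N leT] : exists N, (#|T N.+1| <= #|T N|)%N.
  apply: contrapT => /forallNP H.
  have gr N : (N <= #|T N|)%N.
    by elim: N => // N IH; apply: leq_ltn_trans IH _; rewrite ltnNge; apply/negP/H.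
  by have := leq_trans (gr #|'Z_a|.+1) (max_card _); rewrite ltnn.
have TE s : 0 < mu s -> T N.+1 = [set r + s | r in T N].
  move=> ms; apply/esym/eqP; rewrite eqEcard card_imset; last exact: addIr.
  by rewrite leT andbT; apply/fintype.subsetP => _ /imsetP[r Tr ->]; apply: TS.
(* The stabiliser of the support. By [TE], it contains the differences [s - s0] of values charged by
   [mu]. *)
pose St := [set t : 'Z_a | [forall r, (r + t \in T N) == (r \in T N)]].
have StP t : reflect (forall r, (r + t \in T N) = (r \in T N)) (t \in St).
  by rewrite inE; apply: (iffP forallP) => H r; apply/eqP; rewrite H.
have gSt : group_set St.
  apply/group_setP; split; first by apply/StP => r; rewrite addr0.
  by move=> x y /StP Hx /StP Hy; apply/StP => r; rewrite FinRing.zmodMgE addrA Hy Hx.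
have Sdiff s : 0 < mu s -> s - s0 \in St.
  move=> ms; apply/StP => r; have := TE _ ms; rewrite (TE _ ms0) => E.
  have inI u w : (w \in [set r + u | r in T N]) = (w - u \in T N).
    apply/imsetP/idP => [[r0 h ->]|h]; first by rewrite addrK.
    by exists (w - u); rewrite ?subrK.
  by have /(congr1 (fun A : {set 'Z_a} => r + s \in A)) := E; rewrite !inI addrK addrA.
(* If [1] were not in [St], [step_not_in] would bound by [rho] the mass of the [r] with [r - s0] in
   [St]; that mass is 1. *)
have St1 : (1 : 'Z_a) \in St.
  apply: contraT => n1.
  have := @step_not_in _ (Group gSt) 1 (- s0) (Zp_torsion 1) n1.
  rewrite (_ : \sum_r _ = 1) ?leNgt ?rho_lt1 //.
  rewrite -[RHS]mu_sum; apply: eq_bigr => r _; rewrite Zp_mulrn1 addrC.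
  have := mu_ge0 r; rewrite le0r => /orP[/eqP ->|mr]; first by rewrite mul0r.
  by have -> : (r - s0 \in Group gSt) = true by [apply: Sdiff]; rewrite mulr1.
exists N => r.
have [r1 r1T] : exists r, 0 < conv_pow N r.
  by apply: psum; [move=> ?; apply: conv_pow_ge0|rewrite conv_pow_sum ltr01].
have Str : r - r1 \in St by rewrite -(Zp_mulrn1 (r - r1)); apply: (@groupMn _ (Group gSt)).
have /StP/(_ r1) := Str; rewrite addrC subrK !inE r1T => ->; done.
Qed.

(** Steps along a single [g] involve only the group [Z/a] of multipliers, so the length and the
    lower bound depend on [mu] alone and serve every [G]. Passing from [N] to [N.+1] makes the
    length positive. *)
Let walk_spread : exists N0, (0 < N0)%N /\ exists2 eta : R, 0 < eta <= 1 &
  forall (G : finZmodType) (g : G) f v, g *+ a = 0 ->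
    (forall i, 0 <= f (v + g *+ i)) -> forall i : nat, eta * f (v + g *+ i) <= walk (nseq N0 g) f v.
Proof.
have [N cN] := conv_pow_gt0; exists N.+1; split => //.
have cN1 r : 0 < conv_pow N.+1 r.
  have [s0 _ ms0] : exists2 s, true & 0 < mu s.
    have : 0 < \sum_r mu r by rewrite mu_sum ltr01.
    rewrite lt_neqAle eq_sym psumr_neq0 // => /andP[/hasP[r' _ Fr] _].
    by exists r'.
  rewrite conv_powS (bigD1 s0) //=.
  by rewrite ltr_pwDl ?mulr_gt0 // sumr_ge0 // => i _; rewrite mulr_ge0 ?conv_pow_ge0.
have [eta eta01 etale] := fin_lower_bound cN1; exists eta => // G g f v ga f0 i.
rewrite walk_nseq // (bigD1 (inZp i : 'Z_a)) //=.
rewrite mulrn_modn; last by rewrite Zp_cast.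
rewrite -[leLHS]addr0 lerD //; first by rewrite ler_wpM2r.
by rewrite sumr_ge0 // => r _; rewrite mulr_ge0 ?conv_pow_ge0.
Qed.

Definition mix_len : nat := projT1 (cid walk_spread).
Definition mix_eta : R := projT1 (cid2 (proj2 (projT2 (cid walk_spread)))).
Local Notation N0 := mix_len.
Local Notation eta := mix_eta.

Lemma mix_len_gt0 : (0 < mix_len)%N.
Proof. exact: (proj1 (projT2 (cid walk_spread))). Qed.

Lemma mix_eta01 : 0 < mix_eta <= 1.
Proof. by rewrite /mix_eta; case: cid2. Qed.

Lemma mix_spread (G : finZmodType) (g : G) f v : g *+ a = 0 ->
  (forall i, 0 <= f (v + g *+ i)) ->
  forall i : nat, mix_eta * f (v + g *+ i) <= walk (nseq mix_len g) f v.
Proof. by rewrite /mix_eta; case: cid2 => ? ? H; apply: H. Qed.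

(* The distance to equidistribution on a group with at most [I] cosets, for a
   walk taking each of its generating steps at least [t] times. *)
Definition mix (I t : nat) : R := (1 - mix_eta ^+ I) ^+ (t %/ mix_len).

Section Equidistribution.
Variable (G : finZmodType).
Hypothesis torG : forall g : G, g *+ a = 0.
Implicit Types (K Gam : {group G}) (gs : seq G).

Definition span_over Gam gs : {group G} :=
  foldr (fun g K => (<[g]> <*> K)%G) Gam gs.

Definition block gs : seq G := flatten [seq nseq N0 g | g <- gs].

Let eta0 : 0 <= eta. Proof. by case/andP: mix_eta01 => /ltW. Qed.

(** To travel from [v] to [v + w], write [w] modulo [Gam] as a combination of the generators: each
    run of [N0] equal steps produces the required multiple with probability at least [eta]. The
    predicate [Q] confines the walk to where [f] is known to be nonnegative. *)
Lemma block_lower Gam (Q : pred G) gs f v w :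
  (forall x g i, Q x -> g \in gs -> Q (x + g *+ i)) -> (forall x, Q x -> 0 <= f x) ->
  (forall x y, y \in Gam -> f (x + y) = f x) -> Q v ->
  w \in span_over Gam gs -> eta ^+ size gs * f (v + w) <= walk (block gs) f v.
Proof.
move=> stab f0 fper; elim: gs stab v w => [|g gs IH] stab v w Qv /=.
  by move=> wG; rewrite mul1r fper.
case/zmod_joinP => _ /zmod_cycleP[i ->] [w' w'G ->].
have stab' x g' j : Q x -> g' \in gs -> Q (x + g' *+ j).
  by move=> Qx g'gs; apply: stab; rewrite // inE g'gs orbT.
have Qi j : Q (v + g *+ j) by apply: stab; rewrite ?mem_head.
rewrite /block /= walk_cat exprS -mulrA.
apply: le_trans (mix_spread (torG g) _ i); last first.
  move=> j; have := IH stab' (v + g *+ j) 0 (Qi j) (group0 _); apply: le_trans.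
  by rewrite mulr_ge0 ?exprn_ge0 // addr0 f0.
by rewrite ler_wpM2l // addrA IH.
Qed.

Definition osc_le K u f (d : R) := forall x y, x \in K -> y \in K -> f (u + x) - f (u + y) <= d.

Lemma walk_bounds K u gs f lo hi : {subset gs <= K} ->
  (forall x, x \in K -> lo <= f (u + x) <= hi) ->
  forall x, x \in K -> lo <= walk gs f (u + x) <= hi.
Proof.
move=> gsK fb x Kx.
have stab y g i : y - u \in K -> g \in gs -> y + g *+ i - u \in K.
  by move=> Ky /gsK Kg; rewrite addrAC groupD // groupMn.
have fb' y : y - u \in K -> lo <= f y <= hi.
  by move=> Ky; rewrite -(subrK u y) addrC fb.
have Qx : u + x - u \in K by rewrite addrC addKr.
apply/andP; split.
  rewrite -(walk_const gs lo (u + x)).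
  by apply: (@ler_walk_on _ (fun y => y - u \in K)) => // y /fb' /andP[].
rewrite -[leRHS](walk_const gs hi (u + x)).
by apply: (@ler_walk_on _ (fun y => y - u \in K)) => // y /fb' /andP[].
Qed.

Lemma osc_bounds K u f d : osc_le K u f d ->
  exists2 y, y \in K & forall x, x \in K -> f (u + y) <= f (u + x) <= f (u + y) + d.
Proof.
move=> osc; case: (arg_minP (fun y => f (u + y)) (group0 K)) => y Ky ymin.
by exists y => // x Kx; rewrite ymin //= -lerBlDl osc.
Qed.

Lemma osc_walk K u gs f d : {subset gs <= K} -> osc_le K u f d -> osc_le K u (walk gs f) d.
Proof.
move=> gsK /osc_bounds[z Kz fb] x y Kx Ky.
have /andP[_ h1] := walk_bounds gsK fb Kx; have /andP[h2 _] := walk_bounds gsK fb Ky.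
by rewrite lerBlDr (le_trans h1) // addrC lerD2l.
Qed.

Lemma mem_block gs x : x \in block gs -> x \in gs.
Proof. by case/flattenP => _ /mapP[g ggs ->]; rewrite mem_nseq => /andP[_ /eqP ->]. Qed.

(** The contraction in Doeblin's argument: from every point of the coset, the block reaches the
    [Gam]-class of a minimiser of [f] with probability at least [eta ^+ size gs], which lowers the
    upper bound by that fraction of [d]. *)
Lemma osc_block K Gam u gs f d : {subset gs <= K} ->
  K \subset span_over Gam gs -> (forall x y, y \in Gam -> f (x + y) = f x) ->
  osc_le K u f d -> osc_le K u (walk (block gs) f) ((1 - eta ^+ size gs) * d).
Proof.
move=> gsK Kspan fper /osc_bounds[z Kz fb] x y Kx Ky.
have bK : {subset block gs <= K} by move=> g /mem_block /gsK.
have /andP[h2 _] := walk_bounds bK fb Ky.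
pose hi := f (u + z) + d.
have fE : forall v, hi + (-1) * walk (block gs) (fun x => hi + (-1) * f x) v = walk (block gs) f v.
  by move=> v; rewrite walk_affine !mulN1r opprD addrA subrr add0r opprK.
have low : eta ^+ size gs * d <= walk (block gs) (fun x => hi + (-1) * f x) (u + x).
  have := @block_lower Gam (fun y => y - u \in K) gs (fun x => hi + (-1) * f x) (u + x) (z - x).
  rewrite (_ : u + x + (z - x) = u + z); last by rewrite addrA addrAC addrK.
  rewrite (_ : hi + -1 * f (u + z) = d); last by rewrite /hi mulN1r addrAC subrr add0r.
  apply.
  - by move=> v g i Kv /gsK Kg; rewrite addrAC groupD // groupMn.
  - move=> v Kv; rewrite mulN1r subr_ge0 -(subrK u v) addrC.
    by case/andP: (fb _ Kv).
  - by move=> v w wG; rewrite fper.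
  - by rewrite addrC addKr.
  - by apply: (fintype.subsetP Kspan); rewrite groupB.
rewrite -(fE (u + x)) mulN1r mulrBl mul1r.
by move: low h2; rewrite /hi; lra.
Qed.

Lemma osc_blocks K Gam u gs f d q : {subset gs <= K} ->
  K \subset span_over Gam gs -> (forall x y, y \in Gam -> f (x + y) = f x) ->
  osc_le K u f d ->
  osc_le K u (walk (flatten (nseq q (block gs))) f) ((1 - eta ^+ size gs) ^+ q * d).
Proof.
move=> gsK Kspan fper fosc; elim: q => [|q IH]; first by rewrite mul1r.
have E v : walk (flatten (nseq q.+1 (block gs))) f v =
  walk (block gs) (walk (flatten (nseq q (block gs))) f) v by rewrite -walk_cat.
move=> x y Kx Ky; rewrite !E exprS -mulrA; apply: (osc_block gsK Kspan) => //.
exact: walk_periodic.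
Qed.

Lemma perm_extract (T : eqType) (s1 s2 : seq T) :
  (forall x, x \in s1 -> (count_mem x s1 <= count_mem x s2)%N) ->
  exists s, perm_eq s2 (s1 ++ s).
Proof.
elim: s1 s2 => [|x s1 IH] s2 H; first by exists s2.
have xs2 : x \in s2.
  by rewrite -has_pred1 has_count; apply: leq_trans (H x (mem_head _ _)); rewrite /= eqxx.
have [y ys1|s ps] := IH (rem x s2).
  have := H y; rewrite inE ys1 orbT => /(_ isT).
  have /seq.permP -> := perm_to_rem xs2; by rewrite /= leq_add2l.
by exists s; apply: perm_trans (perm_to_rem xs2) _; rewrite perm_cons.
Qed.

Lemma count_block gs x : uniq gs -> count_mem x (block gs) = ((x \in gs) * N0)%N.
Proof.
elim: gs => //= g gs IH /andP[gn u]; rewrite /block /= count_cat count_nseq IH // inE /=.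
rewrite inE eq_sym; case: (x =P g) => [->|_] //=.
by rewrite (negPf gn) addn0.
Qed.

Lemma count_flatten_nseq (T : eqType) (s : seq T) x q :
  count_mem x (flatten (nseq q s)) = (q * count_mem x s)%N.
Proof. by elim: q => //= q IH; rewrite count_cat IH mulSn. Qed.

Definition coset_rep Gam g := odflt 0 [pick z | z - g \in Gam].

Lemma coset_repP Gam g : coset_rep Gam g - g \in Gam.
Proof.
rewrite /coset_rep; case: pickP => // /(_ g); by rewrite subrr group0.
Qed.

Lemma eq_coset_rep Gam g g' : (coset_rep Gam g == coset_rep Gam g') = (g - g' \in Gam).
Proof.
apply/eqP/idP => [E|gg'].
  have := groupB (coset_repP Gam g') (coset_repP Gam g).
  by rewrite E opprB addrC addrA subrK.
rewrite /coset_rep (@eq_pick _ _ (fun z => z - g' \in Gam)) // => z /=.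
by rewrite -(groupDr _ gg') addrA subrK.
Qed.

(* Doeblin's argument: the walk averages over cosets of Gam, and contains t %/ N0
   disjoint blocks whose transition kernel is bounded below. *)
Lemma equidistribution K Gam gs t u w : Gam \subset K -> {subset gs <= K} -> (0 < t)%N ->
  K \subset <<Gam :|: [set g | (t <= count (fun g' => (g' - g)%R \in Gam) gs)%N]>>%g ->
  u - w \in K ->
  `|walk gs (fun x => (x - w \in Gam)%:R) u - #|K : Gam|%g%:R^-1|
     <= mix #|K : Gam|%g t.
Proof.
rewrite /mix => GK gsK t0 Kgen Kuw; set I := #|K : Gam|%g; set f := fun x => _.
pose h := coset_rep Gam; pose gs' := map h gs.
have fper x y : y \in Gam -> f (x + y) = f x.
  by move=> yG; rewrite /f /= addrAC groupDr.
have hK g : g \in K -> h g \in K.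
  by move=> Kg; rewrite -(groupBr _ Kg); apply: (fintype.subsetP GK); apply: coset_repP.
have gsK' : {subset gs' <= K} by move=> _ /mapP[g /gsK Kg ->]; apply: hK.
have walkE v : walk gs f v = walk gs' f v.
  by rewrite (walk_map_rep (Gam := Gam)) // => g; apply: coset_repP.
pose reps := undup [seq z <- gs' | (t <= count_mem z gs')%N].
have repsP z : (z \in reps) = (z \in gs') && (t <= count_mem z gs')%N.
  by rewrite mem_undup mem_filter andbC.
have repsK : {subset reps <= K} by move=> z; rewrite repsP => /andP[/gsK'].
have cntE g : count_mem (h g) gs' = count (fun g' => g' - g \in Gam) gs.
  by rewrite count_map; apply: eq_count => g' /=; rewrite eq_coset_rep.
have spanG : Gam \subset span_over Gam reps.
  by elim: (reps) => //= g s IH; apply: fintype.subset_trans IH (joing_subr _ _).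
have span_mem s z : z \in s -> z \in span_over Gam s.
  elim: s => //= g s IH; rewrite inE => /orP[/eqP ->|/IH zs].
    by apply: (fintype.subsetP (joing_subl _ _)); apply: cycle_id.
  by apply: (fintype.subsetP (joing_subr _ _)).
have Kspan : K \subset span_over Gam reps.
  apply: fintype.subset_trans Kgen _; rewrite gen_subG finset.subUset spanG /=.
  apply/fintype.subsetP => g; rewrite inE -cntE => tc.
  have hgr : h g \in reps.
    rewrite repsP tc andbT -has_pred1 has_count; exact: leq_trans tc.
  have hg : h g - g \in span_over Gam reps by apply: (fintype.subsetP spanG); apply: coset_repP.
  have -> : g = h g - (h g - g) by rewrite opprB addrC subrK.
  by rewrite groupB // span_mem.
(* Distinct representatives lie in distinct cosets of [Gam], so a block uses at most [I] generators
   and contracts by [1 - eta ^+ I] or better. *)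
have szI : (size reps <= I)%N.
  have := @uniq_leq_size _ [seq rcoset Gam z | z <- reps] (enum (rcosets Gam K)).
  rewrite size_map -cardE; apply.
    rewrite map_inj_in_uniq ?undup_uniq // => z1 z2.
    rewrite !repsP => /andP[/mapP[g1 _ ->] _] /andP[/mapP[g2 _ ->] _] E.
    have /rcosetP[y yG E2] : h g1 \in (Gam :* h g2)%g by rewrite -rcosetE -E rcosetE rcoset_refl.
    apply/eqP; rewrite eq_coset_rep.
    have -> : g1 - g2 = - (h g1 - g1) + (h g1 - h g2) + (h g2 - g2).
      by rewrite opprB !addrA !subrK.
    rewrite groupD ?coset_repP // groupD ?groupN ?coset_repP //.
    by rewrite E2 FinRing.zmodMgE addrK.
  move=> _ /mapP[z zr ->]; rewrite mem_enum; apply/imsetP; exists z; [exact: repsK|].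
  by rewrite rcosetE.
have [rest prest] : exists rest, perm_eq gs' (flatten (nseq (t %/ N0) (block reps)) ++ rest).
  apply: perm_extract => z; rewrite count_flatten_nseq count_block ?undup_uniq //.
  move=> zin; case zr: (z \in reps); last by rewrite muln0.
  rewrite mul1n; apply: leq_trans (leq_trunc_div _ _) _.
  by move: zr; rewrite repsP => /andP[].
have restK : {subset rest <= K}.
  by move=> z zr; apply: gsK'; rewrite (perm_mem prest) mem_cat zr orbT.
have e01 : eta ^+ I <= eta ^+ size reps.
  by rewrite ler_wiXn2l //; case/andP: mix_eta01.
have e1 : eta ^+ size reps <= 1 by rewrite exprn_ile1 //; case/andP: mix_eta01.
have osc : osc_le K u (walk gs f) ((1 - eta ^+ I) ^+ (t %/ N0)).
  move=> x y Kx Ky; rewrite !walkE !(walk_perm _ _ prest) !walk_cat.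
  have H1 : osc_le K u f 1.
    move=> x' y' _ _; have fb z : 0 <= f z <= 1.
      by rewrite /f; case: (_ \in _); rewrite ?lexx ?ler01.
    case/andP: (fb (u + y')) => fy _; case/andP: (fb (u + x')) => _ fx.
    by rewrite lerBlDr ler_wpDr.
  have H2 := osc_walk restK H1.
  have per := @walk_periodic _ Gam rest f fper.
  apply: le_trans (osc_blocks (t %/ N0) repsK Kspan per H2 Kx Ky) _. rewrite mulr1 lerXn2r ?nnegrE ?subr_ge0 //.
  - exact: le_trans e01 e1.
  - by rewrite lerD2l lerN2.
(* By stationarity the mean of the averaged function over the coset [u + K] is [#|Gam| / #|K|]; its
   distance to any single value is at most the oscillation. *)
have avg : \sum_(x in K) walk gs f (u + x) = #|Gam|%:R.
  under eq_bigr => x _ do rewrite addrC walk_shift.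
  rewrite walk_sum // /f.
  rewrite (reindex_inj (addIr (w - u))) /=.
  rewrite -sum1_card natr_sum [RHS]big_mkcond /= [LHS]big_mkcond.
  apply: eq_bigr => x _; have -> : x + (w - u) + u - w = x by rewrite !addrA subrK addrK.
  rewrite groupDr; last by rewrite group_subC.
  have := fintype.subsetP GK x; case: (x \in Gam) => [/(_ isT) ->|_] //; by case: ifP.
have cK : #|K|%:R = #|Gam|%:R * I%:R :> R by rewrite -natrM Lagrange.
have I0 : I%:R != 0 :> R by rewrite pnatr_eq0 -lt0n indexg_gt0.
have K0 : 0 < #|K|%:R :> R by rewrite ltr0n cardG_gt0.
have key : #|K|%:R * (walk gs f u - I%:R^-1) = \sum_(x in K) (walk gs f (u + 0) - walk gs f (u + x)).
  rewrite sumrB avg addr0 sumr_const mulrBr mulr_natl; congr (_ - _).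
  by rewrite cK mulfK.
rewrite -(ler_pM2l K0) -[X in X * `|_|]gtr0_norm // -normrM key.
apply: le_trans (ler_norm_sum _ _ _) _.
rewrite mulr_natl -sumr_const; apply: ler_sum => x Kx.
by rewrite ler_norml [X in _ && X]osc ?group0 // andbT lerNl opprB osc ?group0.
Qed.

End Equidistribution.

End Walk.

(** * Expectations over independent finite draws *)

Section IteratedExpectation.
Variables (R : realType) (T : finType) (w : T -> R).

(* The expectation of [phi [:: x_1; ...; x_n]] for independent [x_i] of law [w]. *)
Fixpoint iexp n (phi : seq T -> R) : R :=
  if n is n'.+1 then \sum_x w x * iexp n' (fun s => phi (x :: s)) else phi [::].

Lemma iexp_tuple n (phi : seq T -> R) :
  \sum_(t : n.-tuple T) (\prod_(x <- t) w x) * phi t = iexp n phi.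
Proof.
elim: n phi => [|n IH] phi /=.
  rewrite (bigD1 [tuple]) //= big_nil mul1r big1 ?addr0 // => t /eqP[].
  by rewrite tuple0.
under [RHS]eq_bigr => x _ do rewrite -IH mulr_sumr.
rewrite pair_big /=.
rewrite (reindex (fun p : T * n.-tuple T => [tuple of p.1 :: p.2])) /=.
  by apply: eq_bigr => p _; rewrite big_cons mulrA.
exists (fun t : n.+1.-tuple T => (thead t, [tuple of behead t])) => [[x t] _|t _] /=.
  by congr pair; apply: val_inj.
by rewrite -tuple_eta.
Qed.

Lemma eq_iexp n phi psi : (forall s, size s = n -> phi s = psi s) -> iexp n phi = iexp n psi.
Proof.
elim: n phi psi => [|n IH] phi psi H /=; first exact: H.
by apply: eq_bigr => x _; congr (_ * _); apply: IH => s sn; apply: H; rewrite /= sn.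
Qed.

Lemma iexpZ n c phi : iexp n (fun s => c * phi s) = c * iexp n phi.
Proof.
elim: n phi => //= n IH phi; rewrite mulr_sumr; apply: eq_bigr => x _.
by rewrite IH mulrCA.
Qed.

Lemma iexp_sum (I : finType) (P : pred I) n (phi : I -> seq T -> R) :
  iexp n (fun s => \sum_(i | P i) phi i s) = \sum_(i | P i) iexp n (phi i).
Proof.
elim: n phi => //= n IH phi; rewrite exchange_big /=; apply: eq_bigr => x _.
by rewrite IH mulr_sumr.
Qed.

Lemma iexpD n phi psi : iexp n (fun s => phi s + psi s) = iexp n phi + iexp n psi.
Proof.
elim: n phi psi => //= n IH phi psi; rewrite -big_split /=; apply: eq_bigr => x _.
by rewrite IH mulrDr.
Qed.

Lemma iexp_prod (U : Type) (us : seq U) (c : U -> T -> R) :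
  iexp (size us) (fun s => \prod_(p <- zip us s) c p.1 p.2) =
  \prod_(u <- us) \sum_x w x * c u x.
Proof.
elim: us => [|u us IH] /=; first by rewrite !big_nil.
rewrite big_cons mulr_suml; apply: eq_bigr => x _.
rewrite -mulrA; congr (_ * _); rewrite -IH -iexpZ; apply: eq_iexp => s _.
by rewrite big_cons.
Qed.

Hypothesis w_ge0 : forall x, 0 <= w x.

Lemma ler_iexp n phi psi : (forall s, size s = n -> phi s <= psi s) -> iexp n phi <= iexp n psi.
Proof.
elim: n phi psi => [|n IH] phi psi H /=; first exact: H.
apply: ler_sum => x _; rewrite ler_wpM2l // IH // => s sn; apply: H; by rewrite /= sn.
Qed.

Lemma iexp_ge0 n phi : (forall s, size s = n -> 0 <= phi s) -> 0 <= iexp n phi.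
Proof.
move=> H; apply: le_trans (ler_iexp H); rewrite (_ : iexp n _ = 0) //.
rewrite -[RHS](mul0r (iexp n (fun=> 0))) -iexpZ; apply: eq_iexp => s _.
by rewrite mul0r.
Qed.

End IteratedExpectation.

(** * Random columns and homomorphisms *)

Section Columns.
Variables (R : realType) (a : nat) (mu : balanced_law R a).
Local Notation walk := (walk mu).
Local Notation rho := (law_rho mu).
Local Notation mix := (mix mu).

(* A homomorphism from [(Z/a)^n] is encoded by its values [F] on the standard
   basis. *)
Definition ev (G : finZmodType) n (F : {ffun 'I_n -> G}) (x : 'cV['Z_a]_n) : G :=
  \sum_i F i *+ x i 0.

Definition colw n (x : 'cV['Z_a]_n) : R := \prod_i mu (x i 0).

Lemma colw_ge0 n (x : 'cV['Z_a]_n) : 0 <= colw x.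
Proof. by apply: prodr_ge0 => i _; apply: law_ge0. Qed.

Lemma walk_iexp (G : finZmodType) (gs : seq G) f v :
  iexp mu (size gs) (fun xs => f (v + \sum_(p <- zip gs xs) p.1 *+ p.2)) = walk gs f v.
Proof.
elim: gs v => [|g gs IH] v /=; first by rewrite big_nil addr0.
apply: eq_bigr => r _; rewrite -IH; congr (_ * _); apply: eq_iexp => s _.
by rewrite big_cons addrA.
Qed.

(** For a random column [x], [F x] is the end point of the walk from [0] whose steps are the values
    of [F] on the basis. *)
Lemma sum_colw_walk (G : finZmodType) n (F : {ffun 'I_n -> G}) f :
  \sum_x colw x * f (ev F x) = walk [seq F i | i <- enum 'I_n] f 0.
Proof.
rewrite -walk_iexp size_map size_enum_ord -iexp_tuple.
rewrite (reindex (fun t : n.-tuple 'Z_a => \col_i tnth t i)) /=.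
  apply: eq_bigr => t _; congr (_ * f _).
    by rewrite /colw big_tuple; apply: eq_bigr => i _; rewrite mxE.
  rewrite add0r -[in RHS](map_tnth_enum t) zip_map big_map big_enum /=.
  by apply: eq_bigr => i _; rewrite mxE.
exists (fun x : 'cV['Z_a]_n => [tuple x i 0 | i < n]) => [t _|x _].
  by apply: eq_from_tnth => i; rewrite tnth_mktuple mxE.
by apply/colP => i; rewrite mxE tnth_mktuple.
Qed.

Lemma colw_sum n : \sum_(x : 'cV['Z_a]_n) colw x = 1.
Proof.
rewrite -[RHS](walk_const mu [seq [ffun=> (0 : 'Z_a)] i | i <- enum 'I_n] 1 0).
by rewrite -sum_colw_walk; apply: eq_bigr => x _; rewrite mulr1.
Qed.

Definition mxw n (M : 'M['Z_a]_n) : R := \prod_j colw (col j M).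
Definition cols n (M : 'M['Z_a]_n) : seq 'cV['Z_a]_n := [seq col j M | j <- enum 'I_n].

Lemma sum_mxw_iexp n (phi : seq 'cV['Z_a]_n -> R) :
  \sum_M mxw M * phi (cols M) = iexp (@colw n) n phi.
Proof.
rewrite -iexp_tuple (reindex (fun t : n.-tuple 'cV['Z_a]_n => \matrix_(i, j) tnth t j i 0)) /=.
  have E (t : n.-tuple 'cV['Z_a]_n) j : col j (\matrix_(i, j) tnth t j i 0) = tnth t j.
    by apply/colP => i; rewrite !mxE.
  apply: eq_bigr => t _; congr (_ * phi _).
    by rewrite /mxw big_tuple; apply: eq_bigr => i _; rewrite E.
  by rewrite /cols -[RHS](map_tnth_enum t); apply: eq_map => j; rewrite E.
exists (fun M : 'M['Z_a]_n => [tuple col j M | j < n]) => [t _|M _].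
  by apply: eq_from_tnth => i; rewrite tnth_mktuple; apply/colP => k; rewrite !mxE.
by apply/matrixP => i j; rewrite mxE tnth_mktuple mxE.
Qed.

Section Heavy.
Variable (G : finZmodType).
Hypothesis torG : forall g : G, g *+ a = 0.
Implicit Types (gs : seq G) (K : {group G}).

Definition heavy t gs : {group G} := <<[set g | (t <= count_mem g gs)%N]>>%G.

Lemma mem_heavy t gs g : (t <= count_mem g gs)%N -> g \in heavy t gs.
Proof. by move=> H; apply: mem_gen; rewrite inE. Qed.

Lemma heavy_sub t gs K : (0 < t)%N -> {subset gs <= K} -> heavy t gs \subset K.
Proof.
move=> t0 gsK; rewrite gen_subG; apply/fintype.subsetP => g; rewrite inE => tc.
by apply: gsK; rewrite -has_pred1 has_count; apply: leq_trans tc.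
Qed.

Lemma walk_outside K gs b v : {subset gs <= K} -> v - b \notin K ->
  walk gs (fun x => (x == b)%:R) v = 0.
Proof.
move=> gsK nK; apply/eqP; rewrite eq_le walk_ge0 // andbT -(addr0 v).
have [] // := andP (@walk_bounds _ _ mu _ K v gs (fun x => (x == b)%:R) 0 0 gsK _ 0 (group0 _)).
move=> x Kx; case: eqP => [E|_]; last by rewrite lexx.
by move: nK; rewrite -E opprD addrA subrr sub0r groupN Kx.
Qed.

Lemma walk_heavy t K gs b v : (0 < t)%N -> {subset gs <= K} -> K \subset heavy t gs ->
  v - b \in K ->
  `|walk gs (fun x => (x == b)%:R) v - #|K|%:R^-1| <= mix #|K| t.
Proof.
move=> t0 gsK Kh Kvb.
have := @equidistribution _ _ mu G torG K 1%G gs t v b (sub1G _) gsK t0 _ Kvb.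
rewrite indexg1 => H.
rewrite (eq_walk _ _ (h := fun x => (x - b \in 1%G)%:R)); last first.
  by move=> x; rewrite inE subr_eq0.
apply: H; apply: fintype.subset_trans Kh _; apply: genS; apply/fintype.subsetP => g.
rewrite !inE => H; apply/orP; right; rewrite (_ : count _ _ = count_mem g gs) //.
by apply: eq_count => x; rewrite inE /= subr_eq0.
Qed.

Lemma mix_ge0 I t : 0 <= mix I t.
Proof.
by case/andP: (mix_eta01 mu) => e0 e1; rewrite exprn_ge0 // subr_ge0 exprn_ile1 // ltW.
Qed.

Lemma ler_mix I J t : (I <= J)%N -> mix I t <= mix J t.
Proof.
case/andP: (mix_eta01 mu) => e0 e1 IJ.
have h (k : nat) : 0 <= 1 - mix_eta mu ^+ k by rewrite subr_ge0 exprn_ile1 // ltW.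
by rewrite lerXn2r ?nnegrE // lerD2l lerN2 ler_wiXn2l // ltW.
Qed.

(** The steps in [heavy t gs] are performed last: they equidistribute on the coset of [b], provided
    the other steps have led into it. One of the others lies outside [heavy t gs]; conditionally on
    the rest, it does so with probability at most [rho]. *)
Lemma walk_split t gs b v : (0 < t)%N -> has (fun g => g \notin heavy t gs) gs ->
  walk gs (fun x => (x == b)%:R) v <= rho * (#|heavy t gs|%:R^-1 + mix #|heavy t gs| t).
Proof.
move=> t0 hasn; set K := heavy t gs.
pose gs1 := [seq g <- gs | g \notin K]; pose gs2 := [seq g <- gs | g \in K].
have pgs : perm_eq gs (gs1 ++ gs2) by rewrite perm_sym perm_catC perm_filterC.
have gs2K : {subset gs2 <= K} by move=> g; rewrite mem_filter => /andP[].
have Kh2 : K \subset heavy t gs2.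
  rewrite gen_subG; apply/fintype.subsetP => g; rewrite inE => tc; apply: mem_heavy.
  rewrite count_filter; rewrite (leq_trans tc) //; apply: sub_count => x /= /eqP ->.
  by rewrite eqxx mem_heavy.
set C := _ + _; have C0 : 0 <= C by rewrite addr_ge0 ?invr_ge0 ?mix_ge0.
have step2 x : walk gs2 (fun x => (x == b)%:R) x <= C * (x - b \in K)%:R.
  case Kx: (x - b \in K); last by rewrite mulr0 (walk_outside gs2K) ?Kx.
  rewrite mulr1 -lerBlDl; exact: le_trans (ler_norm _) (walk_heavy t0 gs2K Kh2 Kx).
rewrite (walk_perm _ _ _ pgs) walk_cat.
apply: (@le_trans _ _ (walk gs1 (fun x => C * (x - b \in K)%:R) v)); first exact: ler_walk.
rewrite walkZ mulrC ler_wpM2r //.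
case: (hasP hasn) => g ggs gK.
have gin : g \in gs1 by rewrite mem_filter gK.
rewrite (walk_perm _ _ _ (_ : perm_eq gs1 (rem g gs1 ++ [:: g]))); last first.
  by rewrite perm_sym perm_catC perm_sym /= perm_to_rem.
rewrite walk_cat -[leRHS](walk_const mu (rem g gs1) rho v); apply: ler_walk => x /=.
apply: le_trans (@step_not_in _ _ mu G K g (x - b) (torG g) gK).
by apply: ler_sum => r _; rewrite addrAC.
Qed.

(** Weigh each coordinate by [1] if its value is in [K] and by [z] otherwise. A function with heavy
    subgroup [K] takes each value outside [K] fewer than [t] times, so it weighs at least
    [z ^+ (#|G| * t)], while the total weight of all functions is an [n]-th power. The parameter [z]
    is tuned later against [rho]. *)
Lemma card_light_heavy n t K (z : R) : (0 < t)%N -> 0 < z <= 1 ->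
  \sum_(F : {ffun 'I_n -> G} | heavy t [seq F i | i <- enum 'I_n] == K) (1 : R) <=
    z ^- (#|G| * t) * ((1 + z * #|G|%:R) * #|K|%:R) ^+ n.
Proof.
move=> t0 /andP[z0 z1]; pose c (g : G) : R := if g \in K then 1 else z.
have c0 g : 0 <= c g by rewrite /c; case: ifP => // _; apply: ltW.
have zt0 : 0 < z ^+ (#|G| * t) by rewrite exprn_gt0.
rewrite -ler_pdivrMl ?invr_gt0 // invrK.
have csum : \sum_g c g <= (1 + z * #|G|%:R) * #|K|%:R.
  apply: (@le_trans _ _ (\sum_(g : G) ((g \in K)%:R + z))).
    apply: ler_sum => g _; rewrite /c; case: ifP => _; last by rewrite add0r.
    by rewrite lerDl ltW.
  have cG : \sum_(g : G) z = z * #|G|%:R by rewrite sumr_const mulr_natr.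
  rewrite big_split /= cG -natr_sum -big_mkcond sum1_card.
  rewrite mulrDl mul1r lerD2l -[leLHS]mulr1 ler_wpM2l ?ler1n ?cardG_gt0 //.
  by rewrite mulr_ge0 // ltW.
have cs0 : 0 <= \sum_g c g by apply: sumr_ge0.
apply: (@le_trans _ _ (\sum_(F : {ffun 'I_n -> G}) \prod_i c (F i))); last first.
  rewrite -(bigA_distr_bigA (fun _ : 'I_n => c)) /= prodr_const card_ord lerXn2r ?nnegrE //.
  exact: le_trans csum.
rewrite mulr_sumr big_mkcond /=; apply: ler_sum => F _; rewrite mulr1.
case: eqP => [hK|_]; last by apply: prodr_ge0.
have -> : \prod_i c (F i) = z ^+ #|[pred i | F i \notin K]|.
  rewrite -prodr_const [RHS]big_mkcond /=; apply: eq_bigr => i _.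
  by rewrite /c inE; case: (F i \in K).
rewrite ler_wiXn2l // ?ltW //.
apply: (@leq_trans (\sum_(g in ~: K) t)); last first.
  by rewrite sum_nat_const leq_mul2r max_card orbT.
rewrite -sum1_card (partition_big F (mem (~: K))) /=; last by move=> i; rewrite !inE.
apply: leq_sum => g; rewrite inE => gK; apply: ltnW; rewrite ltnNge; apply: contra gK => tc.
rewrite -hK; apply: mem_heavy; apply: leq_trans tc _.
rewrite count_map -size_filter -sum1_size /= big_filter big_enum_cond /=.
rewrite [leqLHS]big_mkcond [leqRHS]big_mkcond /=; apply: leq_sum => i _.
by rewrite inE /=; case: (F i \notin K) => //=; case: eqP.
Qed.

(* If F is not generated by its heavy values, each column event has probability
   smaller by a factor rho than the number of such F can compensate. *)
Lemma sparse_sum_le n m t (e : seq G) (z : R) : (0 < t)%N -> 0 < z <= 1 -> n = (size e + m)%N ->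
  \sum_(F : {ffun 'I_n -> G} |
       has (fun g => g \notin heavy t [seq F i | i <- enum 'I_n]) [seq F i | i <- enum 'I_n])
     \prod_(b <- e) walk [seq F i | i <- enum 'I_n] (fun x => (x == b)%:R) 0
  <= #|{group G}|%:R * z ^- (#|G| * t) * ((1 + z * #|G|%:R) * #|G|%:R) ^+ m
     * ((1 + z * #|G|%:R) * rho * (1 + #|G|%:R * mix #|G| t)) ^+ size e.
Proof.
move=> t0 z01 nE; have z0 : 0 <= z by case/andP: z01 => /ltW.
have zG : 0 <= 1 + z * #|G|%:R by rewrite addr_ge0 // mulr_ge0.
have rho0 : 0 <= rho by apply: law_rho_ge0.
rewrite (partition_big (fun F : {ffun 'I_n -> G} => heavy t [seq F i | i <- enum 'I_n]) predT) //.
set D := (_ * _) ^+ m; set E := _ ^+ size e.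
have -> : #|{group G}|%:R * z ^- (#|G| * t) * D * E = \sum_(K : {group G}) (z ^- (#|G| * t) * (D * E)).
  by rewrite sumr_const -[RHS]mulr_natl !mulrA.
apply: ler_sum => K _; rewrite {}/D {}/E.
have Kpos : 0 < #|K|%:R :> R by rewrite ltr0n cardG_gt0.
have KG : #|K|%:R <= #|G|%:R :> R by rewrite ler_nat max_card.
pose C := (rho * (#|K|%:R^-1 + mix #|K| t)) ^+ size e.
have C0 : 0 <= C by rewrite exprn_ge0 // mulr_ge0 // addr_ge0 ?invr_ge0 ?mix_ge0 // ltW.
apply: (@le_trans _ _ (\sum_(F : {ffun 'I_n -> G} | heavy t [seq F i | i <- enum 'I_n] == K) C)).
  rewrite big_mkcondl /=; apply: ler_sum => F /eqP hK.
  case: ifP => // hasn; rewrite /C -hK.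
  elim: (e) => [|b e' IH]; first by rewrite big_nil.
  rewrite big_cons exprS ler_pM ?walk_split ?prodr_ge0 //.
  - by apply: walk_ge0.
  - by move=> ? _; apply: walk_ge0.
have -> : \sum_(F : {ffun 'I_n -> G} | heavy t [seq F i | i <- enum 'I_n] == K) C =
  (\sum_(F : {ffun 'I_n -> G} | heavy t [seq F i | i <- enum 'I_n] == K) 1) * C.
  by rewrite mulr_suml; apply: eq_bigr => F _; rewrite mul1r.
apply: le_trans (ler_wpM2r C0 (card_light_heavy n K t0 z01)) _.
rewrite -[leLHS]mulrA ler_wpM2l ?invr_ge0 ?exprn_ge0 //.
rewrite nE exprD mulrAC -exprMn mulrC.
(* The [#|K|] choices per coordinate cancel the probability [1 / #|K|] of each column event, leaving
   [rho]; the [m] coordinates without a column keep their [#|K|]. *)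
have -> : (1 + z * #|G|%:R) * #|K|%:R * (rho * (#|K|%:R^-1 + mix #|K| t)) =
   (1 + z * #|G|%:R) * rho * (1 + #|K|%:R * mix #|K| t).
  by rewrite mulrACA; congr (_ * _); rewrite mulrDr divff // gt_eqF.
have mK : mix #|K| t <= mix #|G| t by rewrite ler_mix // max_card.
apply: ler_pM.
- by rewrite exprn_ge0 // mulr_ge0.
- by rewrite exprn_ge0 // mulr_ge0 ?mulr_ge0 // addr_ge0 // mulr_ge0 ?mix_ge0.
- by rewrite lerXn2r ?nnegrE ?mulr_ge0 // ler_wpM2l.
rewrite lerXn2r ?nnegrE ?mulr_ge0 ?addr_ge0 ?mulr_ge0 ?mix_ge0 //.
by rewrite ler_wpM2l ?mulr_ge0 // lerD2l ler_pM ?mix_ge0.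
Qed.

End Heavy.
End Columns.

(** * Counting and characters in finite abelian groups *)

Section FiniteGroups.
Variables (G : finZmodType).
Implicit Types (K M U : {group G}) (g x : G).

Lemma zmod_joingE (A B : {group G}) : (A <*> B)%g = (A * B)%g.
Proof. by rewrite comm_joingE //; apply/centC/centsP => u _ v _; exact: addrC. Qed.

Lemma order_modulo K g a : g *+ a = 0 -> (0 < a)%N -> g \notin K ->
  exists2 d, (1 < d)%N & forall m, (g *+ m \in K) = (d %| m)%N.
Proof.
move=> ga a0 gK.
have exd : exists d, (0 < d)%N && (g *+ d \in K).
  by exists a; rewrite ga group0 a0.
case: (ex_minnP exd) => d /andP[d0 gd] dmin.
have d1 : d != 1%N by apply: contraNneq gK => d1; move: gd; rewrite d1.
exists d; first by rewrite ltn_neqAle eq_sym d1.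
move=> m; rewrite {1}(divn_eq m d) mulrnDr mulnC mulrnA groupDl; last by rewrite groupMn.
rewrite /dvdn; case: (ltnP 0 (m %% d)) => [m0|]; last first.
  by rewrite leqn0 => /eqP ->; rewrite group0.
rewrite eqn0Ngt m0 /=; apply/negP => gm.
by have := dmin (m %% d)%N; rewrite m0 /= => /(_ gm); rewrite leqNgt ltn_mod d0.
Qed.

Lemma card_join_cycle U x p : prime p -> x \notin U -> x *+ p \in U ->
  #|(<[x]> <*> U)%G| = (p * #|U|)%N.
Proof.
move=> pp xU pxU.
have xo : x *+ #[x]%g = 0 by rewrite -FinRing.zmodXgE expg_order.
have [d d1 dP] := order_modulo xo (order_gt0 x) xU.
have dp : d = p.
  by apply/(prime_nt_dvdP pp); rewrite ?(gtn_eqF d1) // -dP.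
pose f (q : 'I_p * G) := x *+ q.1 + q.2.
have -> : (<[x]> <*> U)%G = f @: finset.setX [set: 'I_p] U :> {set G}.
  apply/setP => y; apply/zmod_joinP/imsetP.
    case=> _ /zmod_cycleP[i ->] [v Uv ->].
    exists (Ordinal (ltn_pmod i (prime_gt0 pp)), x *+ (i %/ p * p) + v).
      by rewrite !inE /= groupDl // mulnC mulrnA groupMn.
    by rewrite /f /= addrA -mulrnDr addnC -divn_eq.
  case=> -[i v]; rewrite inE /= => /andP[_ Uv] ->.
  by exists (x *+ i); [apply/zmod_cycleP; exists i|exists v].
rewrite card_in_imset ?cardsX ?cardsT ?card_ord // => -[i u] [j v].
rewrite !inE /= => Uu Uv; rewrite /f /= => E.
have key (k l : 'I_p) (u' v' : G) : u' \in U -> v' \in U -> x *+ k + u' = x *+ l + v' -> (l <= k)%N -> k = l.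
  move=> Uu' Uv' E' le; have : x *+ (k - l) \in U.
    by rewrite mulrnBr // -(groupDr _ Uu') addrAC E' addrAC subrr add0r.
  rewrite dP dp => /dvdnP[c]; case: c => [|c] Hc.
    by apply/val_inj/eqP; rewrite eqn_leq le andbT -subn_eq0 Hc.
  by have := ltn_ord k; rewrite ltnNge; case/negP; apply: leq_trans (leq_subr l k); rewrite Hc mulSn leq_addr.
have ij : i = j.
  by case/orP: (leq_total j i) => le; [apply: key E le|symmetry; apply: key (esym E) le].
by congr pair => //; move: E; rewrite ij => /addrI.
Qed.

(* A union of N'-cosets meets every N-coset equally often when N' + N = K. *)
Lemma card_meet_coset (K N N' : {group G}) (X : {set G}) x0 y0 :
  N \subset K -> K \subset (N' <*> N)%g -> y0 - x0 \in K ->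
  (forall x, x \in X -> x - x0 \in K) ->
  (forall x y, y \in N' -> (x + y \in X) = (x \in X)) ->
  (#|[set x in X | (x - y0)%R \in N]| * #|K| = #|X| * #|N|)%N.
Proof.
move=> NK KNN Ky XK Xper.
pose S y := [set x in X | (x - y)%R \in N].
have SN y u : u \in N -> S (y + u) = S y.
  by move=> Nu; rewrite /S; apply/finset.setP => x; rewrite !inE; congr andb; rewrite opprD addrA; apply: groupBr.
have SN' y u : u \in N' -> #|S (y + u)| = #|S y|.
  move=> Nu; rewrite -(card_imset (mem (S y)) (addIr u)) /S; apply: eq_card => x.
  apply/idP/imsetP => [|[z]].
    rewrite !inE => /andP[Xx Nx]; exists (x - u); rewrite ?subrK // inE.
    by rewrite Xper ?groupN // Xx /= addrAC -addrA -opprD.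
  rewrite !inE => /andP[Xz Nz] ->; rewrite Xper // Xz /=.
  by rewrite opprD addrACA subrr addr0.
have S0 y : y - x0 \in K -> #|S y| = #|S y0|.
  move=> Kyx; have : y - y0 \in (N' <*> N)%g.
    by apply: (fintype.subsetP KNN); have := groupB Kyx Ky; rewrite opprB addrA subrK.
  case/zmod_joinP => u N'u [v Nv E].
  by rewrite -(subrK y0 y) E addrC addrA SN // SN'.
transitivity (\sum_(y : G | (y - x0)%R \in K) #|S y|)%N.
  rewrite (eq_bigr (fun _ => #|S y0|)) // sum_nat_const mulnC; congr (_ * _)%N.
  by rewrite -(card_imset (mem K) (addIr x0)); apply: eq_card => y; apply/imsetP/idP => [[z Kz ->]|Ky']; [rewrite unfold_in /= addrK|exists (y - x0); rewrite ?subrK].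
under eq_bigr => y _ do rewrite /S -sum1_card.
rewrite (exchange_big_dep (mem X)) /=; last by move=> y x _; rewrite inE => /andP[].
rewrite -sum_nat_const; apply: eq_bigr => x Xx; rewrite sum1_card.
rewrite -(card_imset (mem N) (inj_comp (addrI x) oppr_inj)); apply: eq_card => y.
apply/idP/imsetP => [|[z Nz ->]] /=.
  rewrite unfold_in !inE Xx /= => /andP[_ Nxy].
  by exists (x - y); rewrite //= opprB addrC subrK.
rewrite unfold_in !inE Xx opprB [X in X \in N]addrC subrK Nz andbT.
rewrite andbT addrAC groupD ?XK // groupN; exact: (fintype.subsetP NK).
Qed.

End FiniteGroups.

(** A maximal proper subgroup [M] above [K] has a cyclic quotient, generated by any [g] outside [M]
    and of order [d] dividing [a]. If [x] is [g *+ r] modulo [M], the character sends [x] to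
    [a / d * r]. *)
Lemma annihilator (G : finZmodType) a (K : {group G}) : (1 < a)%N ->
  (forall g : G, g *+ a = 0) -> K \proper [set: G] ->
  exists2 chi : {additive G -> 'Z_a}, (exists g, chi g != 0) & forall x, x \in K -> chi x = 0.
Proof.
move=> a1 torG Kp.
have a0 : (0 < a)%N by apply: ltnW.
have [M /maxgroupP[Mp Mmax] KM] := maxgroup_exists (gP := fun H => H \proper [set: G]) Kp.
have [g gM] : exists g, g \notin M.
  by case/properP: Mp => _ [g _ gM]; exists g.
have [d d1 dP] := order_modulo (torG g) a0 gM.
have da : (d %| a)%N by rewrite -dP torG group0.
have ex x : exists r, x - g *+ r \in M.
  have : x \in (<[g]> <*> M)%g.
    suff -> : (<[g]> <*> M)%G = [set: G] :> {set G} by rewrite inE.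
    apply/eqP; apply: contraT => ne.
    have pr : (<[g]> <*> M)%G \proper [set: G] by rewrite properT.
    have E := Mmax _ pr (joing_subr _ _).
    by move: gM; rewrite -E (fintype.subsetP (joing_subl _ _)) ?cycle_id.
  by case/zmod_joinP => _ /zmod_cycleP[r ->] [v Mv ->]; exists r; rewrite addrC addKr.
pose r x := sval (cid (ex x)).
have rP x : x - g *+ r x \in M by rewrite /r; case: cid.
have congr_r x m n : x - g *+ m \in M -> x - g *+ n \in M -> (m = n %[mod d])%N.
  move=> Hm Hn; apply/eqP; wlog le : m n Hm Hn / (n <= m)%N.
    by move=> W; case/orP: (leq_total n m) => le; [apply: W|rewrite eq_sym; apply: W].
  rewrite eqn_mod_dvd // -dP mulrnBr //.
  by have := groupB Hn Hm; rewrite opprB addrC addrA subrK.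
pose chi x : 'Z_a := inZp (a %/ d * r x).
have chiE x m : x - g *+ m \in M -> chi x = inZp (a %/ d * m).
  move=> Hm; apply/val_inj => /=; rewrite Zp_cast // -{2 4}(divnK da).
  by rewrite -!muln_modr (congr_r _ _ _ (rP x) Hm).
have chiD : {morph chi : x y / x + y}.
  move=> x y; rewrite (@chiE (x + y) (r x + r y)); last first.
    by rewrite mulrnDr opprD addrACA groupD.
  by apply/val_inj; rewrite /= mulnDr modnDm.
have chi0 : chi 0 = 0.
  rewrite (@chiE 0 0%N) ?muln0 ?mulr0n ?subr0 ?group0 //.
  by apply/val_inj; rewrite /= mod0n.
have chiB : {morph chi : x y / x - y}.
  by move=> x y; apply/(canRL (addrK _)); rewrite -chiD subrK.
pose CA := GRing.isZmodMorphism.Build G 'Z_a chi chiB.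
exists (HB.pack_for {additive G -> 'Z_a} chi CA) => [|x Kx] /=; last first.
  by rewrite (@chiE x 0%N) ?muln0 ?mulr0n ?subr0 ?(fintype.subsetP KM) //; apply/val_inj; rewrite /= mod0n.
exists g; rewrite (@chiE g 1%N) ?mulr1n ?subrr ?group0 // muln1.
apply/negP => /eqP/(congr1 val) /=; rewrite Zp_cast //= modn_small.
  have := divn_gt0 a (ltnW d1); rewrite (dvdn_leq a0 da) => H E.
  by rewrite E in H.
by apply: ltn_Pdiv.
Qed.

Section Homs.
Variables (R : realType) (a : nat) (mu : balanced_law R a).
Local Notation walk := (walk mu).
Local Notation rho := (law_rho mu).
Local Notation mix := (mix mu).
Local Notation colw := (colw mu).
Local Notation "''V_' n" := ('cV['Z_a]_n : finZmodType) (at level 8, n at level 2).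
Let a_gt1 : (1 < a)%N := law_gt1 mu.
Let a_gt0 : (0 < a)%N := ltnW a_gt1.

Lemma colV_torsion n (x : 'V_n) : x *+ a = 0.
Proof. by apply/matrixP => i j; rewrite mulmxnE mxE (Zp_torsion mu). Qed.

Section Ev.
Variables (B : finZmodType) (n : nat).
Hypothesis torB : forall g : B, g *+ a = 0.
Implicit Types (F : {ffun 'I_n -> B}) (H : {group B}) (x : 'V_n).

Lemma evD F x y : ev F (x + y) = ev F x + ev F y.
Proof.
rewrite /ev -big_split /=; apply: eq_bigr => i _; rewrite mxE.
by rewrite (mulrn_ZpD mu).
Qed.

Lemma ev0 F : ev F (0 : 'V_n) = 0.
Proof. by apply: (addrI (ev F (0 : 'V_n))); rewrite -evD !addr0. Qed.

Lemma evN F x : ev F (- x) = - ev F x.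
Proof. by apply: (addrI (ev F x)); rewrite -evD !subrr ev0. Qed.

Lemma evB F x y : ev F (x - y) = ev F x - ev F y.
Proof. by rewrite evD evN. Qed.

Lemma evMn F x m : ev F (x *+ m) = ev F x *+ m.
Proof. by elim: m => [|m IH]; rewrite ?mulr0n ?ev0 // !mulrS evD IH. Qed.

Definition unitv i : 'V_n := delta_mx i 0.

Lemma ev_unitv F i : ev F (unitv i) = F i.
Proof.
rewrite /ev (bigD1 i) //= big1 => [|j ji]; rewrite mxE ?(negPf ji) ?mulr0n // !eqxx addr0 /=.
by rewrite Zp_cast // modn_small.
Qed.

Lemma ev_units x : ev [ffun i => unitv i] x = x.
Proof.
apply/colP => j; rewrite summxE (bigD1 j) //= big1 => [|i ij].
  by rewrite ffunE mulmxnE mxE !eqxx addr0 natr_Zp.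
by rewrite ffunE mulmxnE mxE eq_sym (negPf ij) mul0rn.
Qed.

Definition evm F : {morphism [set: 'V_n] >-> B} :=
  Morphism (D := [set: 'V_n]) (mfun := ev F : 'V_n -> B) (fun x y _ _ => evD F x y).

Definition preF F H : {group 'V_n} := (evm F @*^-1 H)%G.
Definition kerF F : {group 'V_n} := ('ker (evm F))%G.
Definition imF F : {group B} := (evm F @* [set: 'V_n])%G.

Lemma mem_preF F H x : (x \in preF F H) = (ev F x \in H).
Proof. by rewrite !inE. Qed.

Lemma mem_kerF F x : (x \in kerF F) = (ev F x == 0).
Proof. by rewrite !inE. Qed.

Lemma mem_imF F g : reflect (exists x, ev F x = g) (g \in imF F).
Proof.
apply: (iffP idP) => [/morphimP[x _ _ ->]|[x <-]]; first by exists x.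
by apply: (@mem_morphim _ _ _ (evm F)); rewrite inE.
Qed.

Lemma ev_imF F x : ev F x \in imF F.
Proof. by apply/mem_imF; exists x. Qed.

Lemma imF_sub F H : (imF F \subset H) = [forall i, F i \in H].
Proof.
apply/idP/forallP => [FH i|FH].
  by rewrite -ev_unitv (fintype.subsetP FH) // ev_imF.
apply/fintype.subsetP => _ /mem_imF[x <-].
by apply: (big_ind (fun u => u \in H)) => [|u v|i _]; [apply: group0|apply: groupD|apply: groupMn].
Qed.

Lemma card_preF F H : H \subset imF F -> #|preF F H| = (#|kerF F| * #|H|)%N.
Proof. by move=> HF; rewrite card_morphpre. Qed.

Lemma card_V_imF F : #|[set: 'V_n]| = (#|kerF F| * #|imF F|)%N.
Proof.
rewrite -card_preF //; apply: eq_card => x; rewrite mem_preF ev_imF; by rewrite inE.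
Qed.

End Ev.

(** * Columns falling into a subgroup of large index *)

Section Odlyzko.
Variable (G : finZmodType).
Hypothesis torG : forall g : G, g *+ a = 0.

(* Each generator enlarging the span multiplies the index by at most a and
   the probability by at most rho. *)
Lemma walk_subgroup_le (Lam : {group G}) gs : exists2 c,
  (#|span_over Lam gs| <= a ^ c * #|Lam|)%N &
  forall v, walk gs (fun x => (x \in Lam)%:R) v <= rho ^+ c * (v \in span_over Lam gs)%:R.
Proof.
elim: gs => [|g gs [c cI IH]].
  by exists 0%N; rewrite ?expn0 ?mul1n // => v; rewrite expr0 mul1r.
set S := span_over Lam gs in cI IH *.
have SE : span_over Lam (g :: gs) = (<[g]> <*> S)%G by [].
have walkE v : walk (g :: gs) (fun x => (x \in Lam)%:R) v <=
    rho ^+ c * \sum_(r : 'Z_a) mu r * (v + g *+ r \in S)%:R.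
  rewrite mulr_sumr; apply: ler_sum => r _.
  by rewrite mulrCA ler_wpM2l ?law_ge0 // IH.
have out v : v \notin span_over Lam (g :: gs) -> forall r : 'Z_a, (v + g *+ r \in S) = false.
  move=> vn r; apply: contraNF vn => H; rewrite SE; apply/zmod_joinP.
  exists (g *+ (a - r)%N); first by apply/zmod_cycleP; exists (a - r)%N.
  exists (v + g *+ r) => //; rewrite mulrnBr ?torG ?sub0r; last by rewrite ltnW // -[X in (_ < X)%N](Zp_cast a_gt1).
  by rewrite addrC addrK.
have rho0 : 0 <= rho := law_rho_ge0 mu.
case gS: (g \in S).
  have SS : (<[g]> <*> S)%G = S.
    apply/val_inj/eqP; rewrite /= finset.eqEsubset joing_subr andbT join_subG subxx andbT.
    by rewrite cycle_subG.
  exists c; rewrite SE SS // => v; apply: le_trans (walkE v) _; rewrite ler_wpM2l ?exprn_ge0 //.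
  rewrite (eq_bigr (fun r => mu r * (v \in S)%:R)) => [|r _].
    by rewrite -mulr_suml law_sum mul1r.
  by rewrite groupDr // groupMn.
exists c.+1.
  rewrite SE; apply: (@leq_trans (a * #|S|)%N); last by rewrite expnS -mulnA leq_mul2l cI orbT.
  apply: (@leq_trans (#|<[g]>%g| * #|S|)%N).
    by rewrite /= zmod_joingE mul_cardG leq_pmulr ?cardG_gt0.
  by rewrite leq_mul2r dvdn_leq ?orbT // order_dvdn FinRing.zmodXgE torG.
move=> v; case vS: (v \in span_over Lam (g :: gs)); last first.
  apply: le_trans (walkE v) _; rewrite big1 ?mulr0 // => r _.
  by rewrite out ?vS ?mulr0.
rewrite mulr1; apply: le_trans (walkE v) _; rewrite exprSr ler_wpM2l ?exprn_ge0 //.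
by apply: step_not_in; rewrite ?gS.
Qed.

(** Chosen so that Bernoulli's inequality gives [rho <= rho1 ^+ a]. It converts the decay
    [rho ^+ c], for an index at most [a ^ c], into a decay by [rho1] for each factor [2] of the
    index. *)
Definition rho1 : R := 1 - (1 - rho) / a%:R.

Lemma rho1_ge0 : 0 <= rho1.
Proof.
rewrite subr_ge0 ler_pdivrMr ?ltr0n // mul1r.
have := law_rho_ge0 mu; have : 1 <= a%:R :> R by rewrite ler1n.
lra.
Qed.

Lemma rho1_lt1 : rho1 < 1.
Proof.
rewrite /rho1 ltrBlDr ltrDl divr_gt0 ?ltr0n // subr_gt0; exact: law_rho_lt1.
Qed.

Lemma rho_le_rho1 : rho <= rho1 ^+ a.
Proof.
have r1 := rho1_ge0.
have bern k : 1 - (1 - rho1) * k%:R <= rho1 ^+ k.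
  elim: k => [|k IH]; first by rewrite mulr0 subr0.
  rewrite exprS -natr1; have := ler_wpM2l r1 IH.
  have : 0 <= (1 - rho1) ^+ 2 * k%:R by rewrite mulr_ge0 // sqr_ge0.
  by rewrite expr2; nra.
apply: le_trans (bern a); rewrite /rho1 opprD opprK addrA subrr add0r.
by rewrite divfK ?pnatr_eq0 ?gtn_eqF // opprD addrA subrr add0r opprK.
Qed.

Lemma walk_small_index (Lam : {group G}) gs d v : {subset [set: G] <= span_over Lam gs} ->
  (2 ^ d * #|Lam| <= #|[set: G]|)%N ->
  walk gs (fun x => (x \in Lam)%:R) v <= rho1 ^+ d.
Proof.
move=> sp idx; have [c cI H] := walk_subgroup_le Lam gs.
apply: le_trans (H v) _; rewrite sp ?inE // mulr1.
have ge : (2 ^ d <= a ^ c)%N.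
  rewrite -(leq_pmul2r (cardG_gt0 Lam)); apply: leq_trans idx _; apply: leq_trans cI.
  by rewrite subset_leq_card //; apply/fintype.subsetP.
have dac : (d <= a * c)%N.
  rewrite -(@leq_exp2l 2) //; apply: leq_trans ge _; rewrite expnM.
  by case: (c) => // c'; rewrite leq_exp2r // ltnW // ltn_expl.
apply: (@le_trans _ _ (rho1 ^+ (a * c))).
  by rewrite exprM lerXn2r ?nnegrE ?exprn_ge0 ?rho1_ge0 ?law_rho_ge0 ?rho_le_rho1.
by rewrite ler_wiXn2l ?rho1_ge0 // ltW // rho1_lt1.
Qed.

End Odlyzko.

Lemma sum_colw_evV n (f : 'V_n -> R) :
  \sum_x colw x * f x = walk [seq unitv i | i <- enum 'I_n] f 0.
Proof.
have -> : [seq unitv i | i <- enum 'I_n] = [seq [ffun i => unitv i] i | i <- enum 'I_n].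
  by apply: eq_map => i; rewrite ffunE.
by rewrite -sum_colw_walk; apply: eq_bigr => x _; rewrite ev_units.
Qed.

Lemma units_gen n (K : {group 'V_n}) : (forall i, unitv i \in K) -> K = [set: 'V_n]%G.
Proof.
move=> H; apply/val_inj/setP => x; rewrite inE -(ev_units x).
by apply: (big_ind (fun u => u \in K)) => [|u v|i _]; rewrite ?group0 //; [apply: groupD|rewrite ffunE groupMn].
Qed.

Lemma colw_small_index n (Lam : {group 'V_n}) d : (2 ^ d * #|Lam| <= #|[set: 'V_n]|)%N ->
  \sum_(x : 'V_n) colw x * (x \in Lam)%:R <= rho1 ^+ d.
Proof.
move=> idx; rewrite sum_colw_evV; apply: walk_small_index => //; first exact: colV_torsion.
move=> x _; suff -> : span_over Lam [seq unitv i | i <- enum 'I_n] = [set: 'V_n]%G by rewrite inE.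
apply: units_gen => i.
have : unitv i \in [seq unitv i | i <- enum 'I_n] by apply: map_f; rewrite mem_enum.
elim: [seq _ | _ <- _] => //= g s IH; rewrite inE => /orP[/eqP ->|/IH zs].
  by apply: (fintype.subsetP (joing_subl _ _)); apply: cycle_id.
by apply: (fintype.subsetP (joing_subr _ _)).
Qed.

(** In coding terms, a lower bound on the minimum distance of the dual code of [Gam]. It ensures
    that [Gam] and the unit vectors still generate after any deletion of fewer than [t] of the
    latter. *)
Definition supp_ge n (Gam : {group 'V_n}) t := forall y : {ffun 'I_n -> 'Z_a},
  y != [ffun=> 0] -> (forall x, x \in Gam -> ev y x = 0) ->
  (t <= #|[set i | y i != 0%R]|)%N.

(** If [Gam] and the classes hit by at least [t] unit vectors did not generate, a nonzero character
    killing them would be supported on coordinates whose unit vectors lie in rarer classes. With [I]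
    classes modulo [Gam], there are fewer than [I * t <= s] such coordinates, against [supp_ge]. *)
Lemma robust_equidistribution n (Gam : {group 'V_n}) t s w : supp_ge Gam s -> (0 < t)%N ->
  (#|[set: 'V_n] : Gam|%g * t <= s)%N ->
  `|\sum_(x : 'V_n) colw x * (x - w \in Gam)%:R - #|[set: 'V_n] : Gam|%g%:R^-1|
    <= mix #|[set: 'V_n] : Gam|%g t.
Proof.
move=> rob t0 It; rewrite sum_colw_evV.
set gs := [seq _ | _ <- _].
apply: (@equidistribution _ _ mu 'V_n (@colV_torsion n) [set: 'V_n]%G Gam gs t) => //.
- by apply: finset.subsetT.
- by move=> x _; rewrite inE.
- pose K : {group 'V_n} := <<Gam :|: [set g | (t <= count (fun g' => (g' - g)%R \in Gam) gs)%N]>>%G.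
  change (is_true ([set: 'V_n] \subset K)).
apply: contraT => nK.
have Kp : K \proper [set: 'V_n] by rewrite properE finset.subsetT.
have [chi [g0 chig0] chiK] := annihilator a_gt1 (@colV_torsion n) Kp.
pose y := [ffun i => chi (unitv i)].
have yE x : ev y x = chi x.
  rewrite -[in RHS](ev_units x) /ev raddf_sum /=.
  by apply: eq_bigr => i _; rewrite !ffunE raddfMn.
have y0 : y != [ffun=> 0].
  apply: contraNneq chig0 => y0; rewrite -yE /ev big1 // => i _.
  by rewrite y0 ffunE mul0rn.
have le : (s <= #|[set i | y i != 0%R]|)%N.
  by apply: rob => // x xG; rewrite yE chiK // mem_gen // inE xG.
move: le; rewrite leqNgt => /negP; case.
set I := #|_ : _|%g in It *.
pose c (i : 'I_n) := (Gam :* unitv i)%g.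
apply: leq_trans It.
rewrite -sum1_card (partition_big c (mem (rcosets Gam [set: 'V_n]))) /=; last first.
  by move=> i _; apply/rcosetsP; exists (unitv i); rewrite ?inE.
apply: (@leq_ltn_trans (\sum_(C in rcosets Gam [set: 'V_n]) t.-1)%N); last first.
  by rewrite sum_nat_const -[X in (X * _ < _)%N]/I ltn_mul2l indexg_gt0 /= prednK.
apply: leq_sum => C /rcosetsP[v _ ->]; rewrite -ltnS prednK // sum1_card ltnNge.
apply/negP => tle.
have [i] : exists i, i \in [pred i | (i \in [set i | y i != 0]) && (c i == Gam :* v)%g].
  by apply/card_gt0P; apply: leq_trans tle.
rewrite !inE ffunE => /andP[yi /eqP ci].
suff iK : unitv i \in K by rewrite chiK ?eqxx in yi.
apply: mem_gen; rewrite inE; apply/orP; right; rewrite inE.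
apply: leq_trans tle _; rewrite /gs count_map -size_filter -sum1_size big_filter big_enum_cond /=.
rewrite -sum1_card big_mkcond [leqRHS]big_mkcond /=; apply: leq_sum => j _.
rewrite unfold_in /=; case: ifP => // /andP[_ /eqP cj].
have : unitv j \in (Gam :* unitv i)%g by rewrite -/(c i) ci -cj rcoset_refl.
by case/rcosetP => u uG ->; rewrite FinRing.zmodMgE addrK uG.
by rewrite inE.
Qed.

End Homs.

(** * Exposing the columns of a random matrix *)

Section Exposure.
Variables (R : realType) (a : nat) (mu : balanced_law R a).
Local Notation walk := (walk mu).
Local Notation rho := (law_rho mu).
Local Notation mix := (mix mu).
Local Notation cw := (colw mu).
Local Notation "''V_' n" := ('cV['Z_a]_n : finZmodType) (at level 8, n at level 2).
Let a_gt1 : (1 < a)%N := law_gt1 mu.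
Let a_gt0 : (0 < a)%N := ltnW a_gt1.

Section MulN.
Variables (n p : nat).

Definition mulm : {morphism [set: 'V_n] >-> 'V_n} :=
  Morphism (D := [set: 'V_n]) (mfun := (fun x => x *+ p) : 'V_n -> 'V_n)
    (fun x y _ _ => mulrnDl p x y).

Definition mulg_group (L : {group 'V_n}) : {group 'V_n} := (mulm @* L)%G.

Lemma mem_mulg_group (L : {group 'V_n}) x :
  reflect (exists2 y, y \in L & x = y *+ p) (x \in mulg_group L).
Proof.
apply: (iffP idP) => [/morphimP[y _ Ly ->]|[y Ly ->]]; first by exists y.
by apply: (@mem_morphim _ _ _ mulm); rewrite // inE.
Qed.

Lemma ptorsion_dvd (x : 'V_n) i : (p %| a)%N -> x *+ p = 0 -> (a %/ p %| x i 0%R)%N.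
Proof.
move=> pa xp; have p0 : (0 < p)%N by apply: dvdn_gt0 pa.
have := congr1 (fun z : 'V_n => val (z i 0)) xp; rewrite mulmxnE mxE.
rewrite [_ *+ p](_ : _ = inZp (x i 0 * p)); last first.
  by rewrite -{1}(natr_Zp (x i 0)) -mulrnA -(Zp_nat).
move=> /eqP H; have {H} : ((Zp_trunc a).+2 %| x i 0%R * p)%N by [].
move: (nat_of_ord (x i 0)) => k; rewrite Zp_cast // => H.
by rewrite -(dvdn_pmul2r p0) divnK.
Qed.

Lemma card_ptorsion : (p %| a)%N -> #|[set x : 'V_n | x *+ p == 0]| = (p ^ n)%N.
Proof.
move=> pa; have p0 : (0 < p)%N by apply: dvdn_gt0 pa.
pose f (h : {ffun 'I_n -> 'I_p}) : 'V_n := \col_i inZp (a %/ p * h i).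
have lt (j : 'I_p) : (a %/ p * j < (Zp_trunc a).+2)%N.
  by rewrite Zp_cast // -[X in (_ < X)%N](divnK pa) ltn_mul2l ltn_ord divn_gt0 // dvdn_leq.
have finj : injective f.
  move=> h h' /colP E; apply/ffunP => i; apply/val_inj/eqP.
  have := congr1 val (E i); rewrite !mxE /= !modn_small ?lt // => /eqP.
  by rewrite eqn_mul2l eqn0Ngt divn_gt0 // dvdn_leq.
have -> : (p ^ n = #|{ffun 'I_n -> 'I_p}|)%N by rewrite card_ffun !card_ord.
rewrite -(card_imset predT finj).
apply: eq_card => x; apply/idP/imsetP => [|[h _ ->]]; rewrite inE.
  move=> /eqP xp.
  have dv i : (a %/ p %| x i 0%R)%N by apply: ptorsion_dvd.
  have hlt i : (x i 0%R %/ (a %/ p) < p)%N.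
    have ap0 : (0 < a %/ p)%N by rewrite divn_gt0 // dvdn_leq.
    rewrite (ltn_divLR _ _ ap0) mulnC divnK //.
    by rewrite -[X in (_ < X)%N](Zp_cast a_gt1).
  exists [ffun i => Ordinal (hlt i)] => //; apply/colP => i; rewrite !mxE ffunE /= mulnC divnK //.
  by rewrite valZpK.
apply/eqP/colP => i; rewrite mulmxnE !mxE; apply/val_inj.
rewrite -Zp_nat -mulrnA Zp_nat /= Zp_cast // mulnAC divnK //.
by rewrite modnMr.
Qed.

End MulN.

Section Hom.
Variables (B : finZmodType) (n : nat).
Hypothesis torB : forall g : B, g *+ a = 0.
Hypothesis torBp : forall p (g : B), prime p -> (p %| a)%N -> g *+ (a %/ p) = 0.
Local Notation preF := (preF mu torB).
Local Notation kerF := (kerF mu torB (n := n)).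
Local Notation imF := (imF mu torB (n := n)).
Variables (F : {ffun 'I_n -> B}).
Implicit Types (Lam K : {group 'V_n}) (x : 'V_n).

(* The expectation of [f (Lam + <x_1, ..., x_m>)] on the event that the random
   columns [x_i] satisfy [F x_i = b_i]. *)
Fixpoint expo (bs : seq B) (f : {group 'V_n} -> R) (Lam : {group 'V_n}) : R :=
  if bs is b :: bs' then
    \sum_x cw x * ((ev F x == b)%:R * expo bs' f (Lam <*> <[x : 'V_n]>)%G)
  else f Lam.

Definition adjoin (Lam : {group 'V_n}) (xs : seq 'V_n) : {group 'V_n} :=
  foldl (fun (K : {group 'V_n}) x => (K <*> <[x]>)%G) Lam xs.

Lemma expo_iexp bs f Lam :
  expo bs f Lam = iexp (@colw _ _ mu n) (size bs) (fun xs => ([seq ev F x | x <- xs] == bs)%:R * f (adjoin Lam xs)).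
Proof.
elim: bs Lam => [|b bs IH] Lam /=; first by rewrite mul1r.
apply: eq_bigr => x _; congr (_ * _); rewrite IH -iexpZ; apply: eq_iexp => s _.
by rewrite eqseq_cons mulrA -natrM mulnb.
Qed.

Lemma expo_cat bs bs' f Lam : expo (bs ++ bs') f Lam = expo bs (expo bs' f) Lam.
Proof. by elim: bs Lam => //= b bs IH Lam; apply: eq_bigr => x _; rewrite IH. Qed.

Lemma joingCA (K : {group 'V_n}) (x y : 'V_n) :
  ((K <*> <[x]>) <*> <[y]> = (K <*> <[y]>) <*> <[x]>)%G.
Proof. by apply/val_inj; rewrite /= -!joingA [(<[x]> <*> _)%g]joingC. Qed.

Lemma expo_perm bs bs' f Lam : perm_eq bs bs' -> expo bs f Lam = expo bs' f Lam.
Proof.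
move=> pb; move: f Lam.
apply: (catCA_perm_ind (P := fun s => forall f Lam, expo bs f Lam = expo s f Lam)
  _ pb) => // s1 s2 s3 IH f Lam; rewrite IH.
have swap1 b s h K : expo (b :: s) h K = expo (s ++ [:: b]) h K.
  elim: s K => //= c s IHs K.
  transitivity (\sum_x cw x * ((ev F x == b)%:R * \sum_y cw y * ((ev F y == c)%:R *
      expo s h (K <*> <[x : 'V_n]> <*> <[y : 'V_n]>)%G))) => //.
  under [LHS]eq_bigr => x _ do rewrite !mulr_sumr.
  rewrite exchange_big /=; apply: eq_bigr => y _; rewrite -IHs /= !mulr_sumr.
  apply: eq_bigr => x _; rewrite joingCA.
  set E := expo _ _ _; set u := cw x; set v := cw y.
  by move: (_%:R) (_%:R) => c1 c2; ring.
rewrite catA expo_cat [in RHS]catA [RHS]expo_cat.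
move: (expo s3 f) => {IH} h; elim: s1 s2 Lam => [|g s1 IHs] s2 K; first by rewrite cats0.
transitivity (expo (g :: (s2 ++ s1)) h K).
  by apply: eq_bigr => r _; congr (_ * (_ * _)); apply: IHs.
have -> : s2 ++ g :: s1 = (s2 ++ [:: g]) ++ s1 by rewrite -catA.
by rewrite [RHS]expo_cat -swap1 -expo_cat.
Qed.

Variable H' : {group B}.
Hypothesis H'im : H' \subset imF F.
Let L : {group 'V_n} := preF F H'.

(** For [Lam] inside [L], the index of this group in [L] is [p] to the corank of [Lam] in [L / p L];
    ranks modulo the various primes are tracked through these orders. *)
Definition expU p (Lam : {group 'V_n}) : {group 'V_n} := (Lam <*> mulg_group p L)%G.

Lemma mulL_sub p : mulg_group p L \subset L.
Proof. by apply/fintype.subsetP => _ /mem_mulg_group[y Ly ->]; apply: groupMn. Qed.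

Lemma expU_sub p Lam : Lam \subset L -> expU p Lam \subset L.
Proof. by move=> LL; rewrite join_subG LL mulL_sub. Qed.

Lemma sub_expU p Lam : Lam \subset expU p Lam.
Proof. exact: joing_subl. Qed.

Lemma expU_mul p Lam x : x \in L -> x *+ p \in expU p Lam.
Proof.
move=> Lx; apply: (fintype.subsetP (joing_subr _ _)); apply/mem_mulg_group; by exists x.
Qed.

Lemma expU_adjoin p Lam (x : 'V_n) : expU p (Lam <*> <[x]>)%G = (<[x]> <*> expU p Lam)%G.
Proof. by apply/val_inj; rewrite /= joingA [(<[x]> <*> _)%g]joingC. Qed.

Lemma expU_adjoin_in p Lam x : x \in expU p Lam -> expU p (Lam <*> <[x]>)%G = expU p Lam.
Proof.
move=> xU; rewrite expU_adjoin; apply/val_inj/eqP.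
by rewrite /= finset.eqEsubset joing_subr andbT join_subG subxx andbT cycle_subG.
Qed.

Lemma card_expU_adjoin p Lam x : prime p -> x \in L -> x \notin expU p Lam ->
  #|expU p (Lam <*> <[x]>)%G| = (p * #|expU p Lam|)%N.
Proof.
by move=> pp Lx xU; rewrite expU_adjoin (card_join_cycle pp xU) // expU_mul.
Qed.

Lemma card_expU_adjoin_le p Lam x : prime p -> x \in L ->
  (#|expU p (Lam <*> <[x]>)%G| <= p * #|expU p Lam|)%N.
Proof.
move=> pp Lx; case xU: (x \in expU p Lam); last by rewrite card_expU_adjoin // xU.
by rewrite expU_adjoin_in // leq_pmull // prime_gt0.
Qed.

(** The [p]-torsion of [(Z/a)^n] consists of multiples of [a / p], which kills [B] by [torBp]. Hence
    it lies in [L] and is the kernel of multiplication by [p] on [L], so [L / p L] is as large as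
    for a free module of rank [n]. *)
Lemma card_mulL p : prime p -> (p %| a)%N -> #|L| = (p ^ n * #|mulg_group p L|)%N.
Proof.
move=> pp pa; rewrite /= card_morphim setTI mulnC -(card_ptorsion n pa).
have kE : ('ker (mulm n p))%g = [set x : 'V_n | x *+ p == 0] :> {set 'V_n}.
  by apply/finset.setP => x; rewrite !inE.
rewrite -kE -[LHS](@Lagrange _ L ('ker (mulm n p))%G) 1?mulnC //.
apply/fintype.subsetP => x.
have -> : (x \in ('ker (mulm n p))%G) = (x \in [set x : 'V_n | x *+ p == 0]) by rewrite -kE.
rewrite inE => /eqP xp.
rewrite mem_preF.
have pa1 : (a %/ p * p = a)%N by rewrite divnK.
have xE : exists y : 'V_n, x = y *+ (a %/ p).
  exists (\col_i inZp (x i 0%R %/ (a %/ p))); apply/colP => i; rewrite mulmxnE mxE.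
  have dv : (a %/ p %| x i 0%R)%N by apply: ptorsion_dvd.
  by rewrite -[inZp _]Zp_nat -mulrnA mulnC mulnC divnK // natr_Zp.
by case: xE => y ->; rewrite (evMn mu torB) torBp ?group0.
Qed.

Lemma card_expU1 p : prime p -> (p %| a)%N -> #|L| = (p ^ n * #|expU p 1%G|)%N.
Proof.
move=> pp pa; rewrite (card_mulL pp pa); congr (_ * #|(_ : {set 'V_n})|)%N.
by rewrite /expU /= joing1G.
Qed.

(** Iterating [L = Lam + p L] along the prime factors of [m] gives [L = Lam + m L]; for [m = a] the
    last term vanishes. *)
Lemma nakayama Lam : Lam \subset L -> (forall p, p \in primes a -> expU p Lam = L) -> Lam = L.
Proof.
move=> LL HU.
have step m : (0 < m)%N -> (forall p, p \in primes m -> p \in primes a) ->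
    forall x, x \in L -> exists2 u, u \in Lam & exists2 y, y \in L & x = u + y *+ m.
  elim/ltn_ind: m => m IH m0 ms x Lx; case: (leqP m 1) => [m1|m1].
    by exists 0; [apply: group0|exists x => //; rewrite add0r (_ : m = 1%N) ?mulr1n //; apply/eqP; rewrite eqn_leq m1].
  have pp := pdiv_prime m1; have pm := pdiv_dvd m; set p := pdiv m in pp pm.
  have pin : p \in primes a by apply: ms; rewrite mem_primes pp m0 pm.
  have m'0 : (0 < m %/ p)%N by rewrite divn_gt0 ?prime_gt0 // dvdn_leq.
  move: (Lx); rewrite -{1}(HU _ pin) => /zmod_joinP[u Lu [_ /mem_mulg_group[y Ly ->] ->]].
  have lt : (m %/ p < m)%N by rewrite ltn_Pdiv // prime_gt1.
  have sub q : q \in primes (m %/ p) -> q \in primes a.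
    move=> qin; apply: ms; move: qin; rewrite !mem_primes => /and3P[-> _ qd].
    by rewrite m0; apply: dvdn_trans qd _; rewrite dvdn_div.
  have [v Lv [z Lz ->]] := IH _ lt m'0 sub y Ly.
  exists (u + v *+ p); first by rewrite groupD // groupMn.
  by exists z => //; rewrite mulrnDl addrA -mulrnA divnK.
apply/val_inj/eqP; rewrite /= finset.eqEsubset LL; apply/fintype.subsetP => x Lx.
have [u Lu [y Ly ->]] := step a a_gt0 (fun p h => h) x Lx.
by rewrite (colV_torsion mu) addr0.
Qed.

Definition final (Lam : {group 'V_n}) : R := (Lam == L)%:R.

Lemma mem_L x b : b \in H' -> ev F x = b -> x \in L.
Proof. by move=> Hb E; rewrite mem_preF E. Qed.

(** A column enlarges [expU p] by a factor at most [p], so a corank modulo [p] above the number of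
    remaining columns can no longer be repaired. *)
Lemma expo_final0 p bs Lam : p \in primes a -> Lam \subset L -> {subset bs <= H'} ->
  (p ^ size bs * #|expU p Lam| < #|L|)%N -> expo bs final Lam = 0.
Proof.
move=> pin; have pp : prime p by move: pin; rewrite mem_primes => /and3P[].
elim: bs Lam => [|b bs IH] Lam LL bsH /=.
  rewrite expn0 mul1n /final; case: eqP => // ->.
  by rewrite ltnNge subset_leq_card ?sub_expU.
move=> lt; rewrite big1 // => x _; case: eqP => [E|_]; last by rewrite mul0r mulr0.
have Lx : x \in L by apply: mem_L E; rewrite bsH ?mem_head.
rewrite IH ?mulr0 //.
- by rewrite join_subG LL cycle_subG.
- by move=> c cb; apply: bsH; rewrite inE cb orbT.
apply: leq_ltn_trans lt; rewrite expnSr -mulnA leq_mul2l.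
by rewrite card_expU_adjoin_le ?orbT.
Qed.

Section Step.
Variables (Lam : {group 'V_n}) (d : nat).
Hypothesis LL : Lam \subset L.
Hypothesis Lsurj : L \subset (Lam <*> kerF F)%g.
Hypothesis codim : forall p, p \in primes a -> #|L| = (p ^ d * #|expU p Lam|)%N.

Definition capU (s : seq nat) : {group 'V_n} :=
  foldr (fun p K => (expU p Lam :&: K)%G) (kerF F) s.

Lemma mem_capU s x : (x \in capU s) = (x \in kerF F) && all (fun p => x \in expU p Lam) s.
Proof. by elim: s => /= [|p s IH]; rewrite ?andbT // in_setI IH andbCA. Qed.

Lemma kerF_L : kerF F \subset L.
Proof.
by apply/fintype.subsetP => x; rewrite mem_kerF mem_preF => /eqP ->; apply: group0.
Qed.

Lemma capU_ker s : capU s \subset kerF F.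
Proof. by apply/fintype.subsetP => x; rewrite mem_capU => /andP[]. Qed.

Lemma card_ker_capU s : {subset s <= primes a} ->
  (#|kerF F| <= (\prod_(p <- s) p ^ d) * #|capU s|)%N.
Proof.
elim: s => [|p s IH] ss /=; first by rewrite big_nil mul1n.
have pin : p \in primes a by apply: ss; rewrite mem_head.
apply: leq_trans (IH _) _; first by move=> q qs; apply: ss; rewrite inE qs orbT.
rewrite big_cons [(p ^ d * _)%N]mulnC -mulnA leq_mul2l; apply/orP; right.
rewrite -(leq_pmul2l (cardG_gt0 (expU p Lam))) mulnCA mulnA -codim //.
rewrite mul_cardG leq_mul2r; apply/orP; right; apply: subset_leq_card.
rewrite mul_subG ?expU_sub //.
exact: fintype.subset_trans (capU_ker s) kerF_L.
Qed.

Lemma prod_primes_le : (\prod_(p <- primes a) p <= a)%N.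
Proof.
rewrite [leqRHS](prod_prime_decomp a_gt0) /primes big_map !big_seq.
apply: leq_prod => -[p e] /mem_prime_decomp[pp e0 _] /=.
by rewrite -{1}(expn1 p) leq_exp2l // prime_gt1.
Qed.

(** The index of [capU] is bounded independently of [n], which is why the last columns can be
    treated by equidistribution. *)
Lemma card_V_capU : (#|[set: 'V_n]| <= #|B| * a ^ d * #|capU (primes a)|)%N.
Proof.
rewrite (card_V_imF mu torB F) mulnC -mulnA leq_mul ?max_card //.
apply: leq_trans (card_ker_capU (fun q h => h)) _.
rewrite leq_mul2r; apply/orP; right.
have -> : (\prod_(p <- primes a) p ^ d = (\prod_(p <- primes a) p) ^ d)%N.
  by elim: (primes a) => [|p s IH]; rewrite ?big_nil ?exp1n // !big_cons IH expnMn.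
have := prod_primes_le; case: (d) => // d' le; by rewrite leq_exp2r.
Qed.

Definition avoid b s : {set 'V_n} :=
  [set x | (ev F x == b) && all (fun p => x \notin expU p Lam) s].

(** Within the fibre of [F] above [b], a proportion [p ^- d] lies in [expU p Lam], and these
    conditions are independent for different primes by the Chinese remainder theorem. *)
Lemma card_avoid b s : b \in H' -> uniq s -> {subset s <= primes a} ->
  #|avoid b s|%:R = #|kerF F|%:R * \prod_(p <- s) (1 - p%:R ^- d) :> R.
Proof.
(* A base point [y0] of the fibre taken in [Lam] belongs to every [expU p Lam], so each condition on
   [x] becomes one on [x - y0], an element of [kerF F]. *)
move=> Hb; have [y0 Ly0 Ey0] : exists2 y0, y0 \in Lam & ev F y0 = b.
  have /mem_imF[v Ev] := fintype.subsetP H'im b Hb.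
  have := fintype.subsetP Lsurj v; rewrite mem_preF Ev => /(_ Hb)/zmod_joinP[u Lu [k]].
  rewrite mem_kerF => /eqP k0 E; exists u => //.
  by rewrite -Ev E (evD mu torB) k0 addr0.
elim: s => [|p s IH] /= u ss.
  rewrite big_nil mulr1; congr (_%:R); rewrite -(card_imset (mem (kerF F)) (addIr y0)).
  apply: eq_card => x; rewrite inE andbT; apply/idP/imsetP => [/eqP E|[k]].
    exists (x - y0); rewrite ?subrK //= mem_kerF.
    by rewrite (evB mu torB) E Ey0 subrr.
  by rewrite /= mem_kerF => /eqP k0 ->; rewrite (evD mu torB) k0 add0r Ey0.
case/andP: u => pns us.
have pin : p \in primes a by apply: ss; rewrite mem_head.
have ss' : {subset s <= primes a} by move=> q qs; apply: ss; rewrite inE qs orbT.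
have pp : prime p by move: pin; rewrite mem_primes => /and3P[].
have p0 : (0 < p)%N by apply: prime_gt0.
pose N := (expU p Lam :&: kerF F)%G.
have NK : N \subset kerF F by apply: finset.subsetIr.
have y0U : y0 \in expU p Lam by apply: (fintype.subsetP (sub_expU p Lam)).
(* Since [Lam] already maps onto [H'], [expU p Lam] and [kerF F] span [L], so the index [p ^ d]
   persists inside the kernel. *)
have cN : #|kerF F| = (p ^ d * #|N|)%N.
  apply/eqP; rewrite -(eqn_pmul2l (cardG_gt0 (expU p Lam))) mulnCA mulnA -codim //.
  rewrite mul_cardG; apply/eqP; congr (_ * _)%N.
  apply/eqP; rewrite eqn_leq; apply/andP; split; apply: subset_leq_card.
    by rewrite mul_subG ?expU_sub ?kerF_L.
  rewrite -zmod_joingE; apply: fintype.subset_trans Lsurj _.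
  by apply: genS; rewrite setSU // sub_expU.
have meet := @card_meet_coset _ (kerF F) N (capU s) (avoid b s) y0 y0 NK.
(* With [e] congruent to 1 modulo [p] and to 0 modulo the primes of [s], [k *+ e] lies in every
   [expU q Lam] for [q] in [s], and [k *+ (e - 1)] lies in [expU p Lam]. *)
have KNN : kerF F \subset (capU s <*> N)%g.
  apply/fintype.subsetP => k Kk; have Lk : k \in L by apply: (fintype.subsetP kerF_L).
  pose m := (\prod_(q <- s) q)%N.
  have cop : coprime p m.
    rewrite /m; elim: (s) pns ss' => [|q s' IH'] /=; first by rewrite big_nil coprimen1.
    rewrite inE negb_or => /andP[pq pns'] ss''; rewrite big_cons coprimeMr IH' // ?andbT.
      rewrite prime_coprime // dvdn_prime2 //.
      by have := ss'' q (mem_head _ _); rewrite mem_primes => /and3P[].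
    by move=> r rs; apply: ss''; rewrite inE rs orbT.
  pose e := chinese p m 1 0.
  have e1 : (e = 1 %[mod p])%N by apply: chinese_modl.
  have e0 : (m %| e)%N by rewrite /dvdn (chinese_modr cop 1 0) mod0n.
  have egt : (0 < e)%N.
    rewrite lt0n; apply: contra_eqN e1 => /eqP ->.
    by rewrite mod0n modn_small ?prime_gt1.
  apply/zmod_joinP; exists (k *+ e).
    rewrite mem_capU groupMn //; apply/allP => q qs.
    have qe : (q %| e)%N.
      by apply: dvdn_trans e0; rewrite /m (big_rem q) //= dvdn_mulr.
    by rewrite -(divnK qe) mulrnA expU_mul // groupMn.
  exists (- (k *+ (e - 1))); last by rewrite mulrnBr // mulr1n opprB addrC subrK.
  rewrite groupN in_setI andbC groupMn //=.
  have pe : (p %| e - 1)%N by rewrite -eqn_mod_dvd // e1.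
  by rewrite -(divnK pe) mulrnA expU_mul // groupMn.
have {}meet : (#|[set x in avoid b s | (x - y0)%R \in N]| * #|kerF F| = #|avoid b s| * #|N|)%N.
  apply: meet => //; first by rewrite subrr group0.
    by move=> x; rewrite inE => /andP[/eqP E _]; rewrite mem_kerF (evB mu torB) E Ey0 subrr.
  move=> x y; rewrite mem_capU mem_kerF => /andP[/eqP y0' /allP yU].
  rewrite !inE (evD mu torB) y0' addr0; congr (_ && _); apply: eq_in_all => q qs.
  by rewrite groupDr // yU.
have split : (#|avoid b s| = #|[set x in avoid b s | (x - y0)%R \in N]| + #|avoid b (p :: s)|)%N.
  rewrite -(cardsID [set x | x - y0 \in N] (avoid b s)); congr (_ + _)%N; apply: eq_card => x.
    by rewrite !inE.
  rewrite !inE /= andbC -andbA; case: eqP => //= E; rewrite andbC; congr (_ && _).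
  by rewrite (evB mu torB) E Ey0 subrr eqxx andbT groupBr.
have pd0 : p%:R ^+ d != 0 :> R by rewrite expf_neq0 // pnatr_eq0 -lt0n.
have K0 : #|kerF F|%:R != 0 :> R by rewrite pnatr_eq0 -lt0n cardG_gt0.
have meetR : #|[set x in avoid b s | (x - y0)%R \in N]|%:R = #|avoid b s|%:R * p%:R ^- d :> R.
  apply: (mulIf K0); rewrite -natrM meet cN !natrM natrX; field.
  exact: pd0.
rewrite big_cons mulrCA -IH // mulrBl mul1r; apply/eqP; rewrite eq_sym subr_eq; apply/eqP.
by rewrite {1}split natrD addrC meetR [_ * p%:R ^- d]mulrC.
Qed.


Lemma supp_ge_sub (K1 K2 : {group 'V_n}) s : K1 \subset K2 -> supp_ge K1 s -> supp_ge K2 s.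
Proof.
by move=> K12 H y y0 yK; apply: H => // x xK; apply: yK; apply: (fintype.subsetP K12).
Qed.

(** The set [X] is a union of cosets of [Gam]. Summing the coset estimate over [v] in [X] counts
    each point [#|Gam|] times; dividing at most [#|V|] error terms by [#|Gam|] leaves the index as a
    factor. *)
Lemma periodic_prob (X : {set 'V_n}) (Gam : {group 'V_n}) s t : supp_ge Gam s -> (0 < t)%N ->
  (#|[set: 'V_n] : Gam|%g * t <= s)%N -> (forall x y, y \in Gam -> (x + y \in X) = (x \in X)) ->
  `|\sum_(x in X) cw x - #|X|%:R / #|[set: 'V_n]|%:R| <=
     #|[set: 'V_n] : Gam|%g%:R * mix #|[set: 'V_n] : Gam|%g t.
Proof.
move=> rob t0 It Xper; set I := #|_ : _|%g.
have VI : (#|Gam| * I = #|[set: 'V_n]|)%N by rewrite Lagrange // finset.subsetT.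
have G0 : 0 < #|Gam|%:R :> R by rewrite ltr0n cardG_gt0.
have I0 : 0 < I%:R :> R by rewrite ltr0n indexg_gt0.
have key : #|Gam|%:R * (\sum_(x in X) cw x - #|X|%:R / #|[set: 'V_n]|%:R) =
    \sum_(v in X) (\sum_(x : 'V_n) cw x * (x - v \in Gam)%:R - I%:R^-1).
  rewrite sumrB sumr_const mulrBr; congr (_ - _); last first.
    by rewrite -VI natrM -[RHS]mulr_natl; field; rewrite !gt_eqF.
  rewrite exchange_big /= mulr_sumr [LHS]big_mkcond /=; apply: eq_bigr => x _.
  rewrite -mulr_sumr.
  have -> : \sum_(v in X) (x - v \in Gam)%:R = (x \in X)%:R * #|Gam|%:R :> R.
    have E : forall v, x - v \in Gam -> (v \in X) = (x \in X).
      by move=> v xv; rewrite -(Xper v (x - v) xv) addrC subrK.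
    transitivity (\sum_(v : 'V_n) (x \in X)%:R * (x - v \in Gam)%:R : R).
      rewrite [LHS]big_mkcond; apply: eq_bigr => v _; case xv: (x - v \in Gam).
        by rewrite (E v xv); case: (x \in X); rewrite ?mul1r ?mul0r.
      by rewrite mulr0; case: ifP.
    rewrite -mulr_sumr; congr (_ * _).
    rewrite (reindex_inj (inj_comp (addrI x) oppr_inj)) /=.
    under eq_bigr => v _ do rewrite opprB [v + _]addrC addrA addrN add0r.
    rewrite -natr_sum -big_mkcond sum1_card //.
  by case: (x \in X); rewrite ?mul1r ?mul0r ?mulr0 // mulrC.
rewrite -(ler_pM2l G0) -[X in X * `|_|]gtr0_norm // -normrM key.
apply: le_trans (ler_norm_sum _ _ _) _.
apply: (@le_trans _ _ (\sum_(v in X) mix I t)).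
  by apply: ler_sum => v _; apply: robust_equidistribution rob t0 It.
rewrite sumr_const -[leLHS]mulr_natl [leRHS]mulrA -natrM VI ler_wpM2r ?mix_ge0 // ler_nat.
by rewrite subset_leq_card // finset.subsetT.
Qed.

Definition qd d : R := \prod_(p <- primes a) (1 - p%:R ^- d).

Lemma step_prob b s t N : b \in H' -> supp_ge (Lam :&: kerF F)%G s -> (0 < t)%N ->
  (#|B| * a ^ d <= N)%N -> (N * t <= s)%N ->
  `|\sum_(x : 'V_n) cw x * ((ev F x == b)%:R * (all (fun p => x \notin expU p Lam) (primes a))%:R)
     - #|imF F|%:R^-1 * qd d| <= N%:R * mix N t.
Proof.
move=> Hb rob t0 BN Nts.
pose X := avoid b (primes a); pose Gam := capU (primes a).
have subG : Lam :&: kerF F \subset Gam.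
  apply/fintype.subsetP => x; rewrite in_setI mem_capU => /andP[Lx ->] /=.
  by apply/allP => p _; apply: (fintype.subsetP (sub_expU p Lam)).
have rob' : supp_ge Gam s by apply: supp_ge_sub rob.
have IN : (#|[set: 'V_n] : Gam|%g <= N)%N.
  rewrite -(leq_pmul2l (cardG_gt0 Gam)) Lagrange ?finset.subsetT // mulnC.
  by apply: leq_trans card_V_capU _; rewrite leq_mul2r BN orbT.
have It : (#|[set: 'V_n] : Gam|%g * t <= s)%N by apply: leq_trans Nts; rewrite leq_mul2r IN orbT.
have Xper x y : y \in Gam -> (x + y \in X) = (x \in X).
  rewrite mem_capU mem_kerF => /andP[/eqP y0 /allP yU].
  rewrite !inE (evD mu torB) y0 addr0; congr (_ && _); apply: eq_in_all => q qs.
  by rewrite groupDr // yU.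
have := periodic_prob rob' t0 It Xper.
have -> : \sum_(x in X) cw x = \sum_(x : 'V_n) cw x * ((ev F x == b)%:R *
    (all (fun p => x \notin expU p Lam) (primes a))%:R).
  rewrite big_mkcond /=; apply: eq_bigr => x _; rewrite inE -natrM mulnb.
  by case: (_ && _); rewrite ?mulr1 ?mulr0.
have -> : #|X|%:R / #|[set: 'V_n]|%:R = #|imF F|%:R^-1 * qd d.
  rewrite card_avoid ?primes_uniq // (card_V_imF mu torB F) natrM /qd.
  have K0 : #|kerF F|%:R != 0 :> R by rewrite pnatr_eq0 -lt0n cardG_gt0.
  have H0 : #|imF F|%:R != 0 :> R by rewrite pnatr_eq0 -lt0n cardG_gt0.
  by field; rewrite K0 H0.
move/le_trans; apply; apply: ler_pM; rewrite ?mix_ge0 // ?ler_nat //.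
by apply: ler_mix.
Qed.

End Step.

Lemma qd_ge0 d : 0 <= qd d.
Proof.
rewrite /qd big_seq; apply: prodr_ge0 => p; rewrite mem_primes => /and3P[pp _ _].
rewrite subr_ge0 invf_le1 ?exprn_gt0 ?ltr0n ?prime_gt0 //.
by rewrite exprn_ege1 // ler1n prime_gt0.
Qed.

Lemma qd_le1 d : qd d <= 1.
Proof.
rewrite /qd big_seq; apply: prodr_ile1 => p; rewrite mem_primes => /and3P[pp _ _].
apply/andP; split.
  rewrite subr_ge0 invf_le1 ?exprn_gt0 ?ltr0n ?prime_gt0 //.
  by rewrite exprn_ege1 // ler1n prime_gt0.
by rewrite lerBlDr lerDl invr_ge0 exprn_ge0.
Qed.

Definition cprod m : R := \prod_(i < m) qd i.+1.

Lemma cprod_ge0 m : 0 <= cprod m.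
Proof. by apply: prodr_ge0 => i _; apply: qd_ge0. Qed.

Lemma cprod_le1 m : cprod m <= 1.
Proof. by apply: prodr_ile1 => i _; rewrite qd_ge0 qd_le1. Qed.

Lemma cprodS m : cprod m.+1 = qd m.+1 * cprod m.
Proof. by rewrite /cprod big_ord_recr mulrC. Qed.

(** With as many columns left as the corank modulo every prime, none may be wasted: a column in some
    [expU p Lam] makes success impossible, any other lowers all coranks by one. The factors [qd]
    multiply to [cprod], and [nakayama] concludes at corank [0]. *)
Lemma expo_last bs Lam s t N : Lam \subset L -> L \subset (Lam <*> kerF F)%g ->
  (forall p, p \in primes a -> #|L| = (p ^ size bs * #|expU p Lam|)%N) ->
  {subset bs <= H'} -> supp_ge (Lam :&: kerF F)%G s -> (0 < t)%N ->
  (#|B| * a ^ size bs <= N)%N -> (N * t <= s)%N ->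
  `|expo bs final Lam - #|imF F|%:R ^- size bs * cprod (size bs)| <=
    (size bs)%:R * (N%:R * mix N t).
Proof.
elim: bs Lam => [|b bs IH] Lam LL Ls cod bsH rob t0 BN Nts.
  rewrite /= expr0 invr1 mul1r mul0r /cprod big_ord0 /final.
  suff -> : Lam = L by rewrite eqxx subrr normr0.
  apply: nakayama => // p pin; apply/val_inj/eqP.
  by rewrite eqEcard expU_sub //= (cod p pin) mul1n.
pose e := (size bs)%:R * (N%:R * mix N t); pose main := #|imF F|%:R ^- size bs * cprod (size bs).
pose A x := all (fun p => x \notin expU p Lam) (primes a).
have Hb : b \in H' by rewrite bsH ?mem_head.
have bsH' : {subset bs <= H'} by move=> c cb; apply: bsH; rewrite inE cb orbT.
have NM0 : 0 <= N%:R * mix N t by rewrite mulr_ge0 ?mix_ge0.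
have e0 : 0 <= e by rewrite mulr_ge0.
have H1 : 1 <= #|imF F|%:R :> R by rewrite ler1n cardG_gt0.
have main01 : 0 <= main <= 1.
  rewrite mulr_ge0 ?invr_ge0 ?exprn_ge0 ?cprod_ge0 //=.
  rewrite mulr_ile1 ?invr_ge0 ?exprn_ge0 ?cprod_ge0 ?cprod_le1 //.
  by rewrite invf_le1 ?exprn_gt0 ?exprn_ege1 // (lt_le_trans ltr01).
have BN' : (#|B| * a ^ size bs <= N)%N.
  apply: leq_trans BN; rewrite leq_mul2l; apply/orP; right.
  by rewrite /= expnS leq_pmull.
(* A column that meets some [expU p Lam] is handled by [expo_final0]; any other preserves the
   hypotheses of the induction, with every corank lowered by one. *)
have termP (x : 'V_n) : `|(ev F x == b)%:R * expo bs final (Lam <*> <[x]>)%G -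
     (ev F x == b)%:R * (A x)%:R * main| <= e.
  case: eqP => [E|_]; last by rewrite !mul0r subrr normr0.
  rewrite !mul1r; have Lx : x \in L by apply: mem_L E.
  have LLx : (Lam <*> <[x]>)%G \subset L by rewrite join_subG LL cycle_subG.
  case Ax: (A x); last first.
    move/negbT: Ax; rewrite /A => /allPn[p pin]; rewrite negbK => xU.
    have pp : prime p by move: pin; rewrite mem_primes => /and3P[].
    rewrite mul0r subr0 (expo_final0 pin) ?normr0 //.
    rewrite expU_adjoin_in // (cod p pin) /= expnS -mulnA.
    by rewrite ltn_Pmull ?prime_gt1 // muln_gt0 expn_gt0 prime_gt0 ?cardG_gt0.
  rewrite mul1r; apply: IH => //.
  - apply: fintype.subset_trans Ls _; rewrite join_subG joing_subr andbT.
    by apply: fintype.subset_trans (joing_subl _ _); apply: joing_subl.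
  - move=> p pin; have pp : prime p by move: pin; rewrite mem_primes => /and3P[].
    have xU : x \notin expU p Lam by apply: (allP Ax).
    by rewrite card_expU_adjoin // mulnA -expnSr; apply: cod.
  - by apply: supp_ge_sub rob; rewrite setSI // joing_subl.
have step := step_prob LL Ls cod Hb rob t0 BN Nts.
set PX := \sum_x _ in step.
have d1 : `|expo (b :: bs) final Lam - PX * main| <= e.
  rewrite /= /PX mulr_suml -sumrB.
  apply: le_trans (ler_norm_sum _ _ _) _.
  have -> : e = \sum_(x : 'V_n) cw x * e by rewrite -mulr_suml colw_sum mul1r.
  apply: ler_sum => x _.
  rewrite -mulrA -mulrBr normrM ger0_norm ?colw_ge0 // ler_wpM2l ?colw_ge0 //.
  exact: termP.
have d2 : `|PX * main - #|imF F|%:R^-1 * qd (size bs).+1 * main| <= N%:R * mix N t.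
  rewrite -mulrBl normrM; case/andP: main01 => m0 m1; rewrite (ger0_norm m0).
  by apply: le_trans step; rewrite ler_piMr.
have -> : #|imF F|%:R ^- size (b :: bs) * cprod (size (b :: bs)) = #|imF F|%:R^-1 * qd (size bs).+1 * main.
  rewrite /= exprS invfM cprodS /main.
  by set u := _ ^-1; set v := _ ^- _; ring.
apply: le_trans (ler_distD (PX * main) _ _) _.
by rewrite /= -natr1 mulrDl mul1r; apply: lerD.
Qed.

Definition pr_ev b : R := \sum_(x : 'V_n) cw x * (ev F x == b)%:R.

Lemma pr_ev_ge0 b : 0 <= pr_ev b.
Proof. by apply: sumr_ge0 => x _; rewrite mulr_ge0 ?colw_ge0. Qed.

Lemma expo_mass bs Lam : expo bs (fun=> 1) Lam = \prod_(b <- bs) pr_ev b.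
Proof.
elim: bs Lam => [|b bs IH] Lam /=; first by rewrite big_nil.
by rewrite big_cons mulr_suml; apply: eq_bigr => x _; rewrite IH mulrA.
Qed.

Lemma ler_expo bs f h Lam : (forall K, f K <= h K) -> expo bs f Lam <= expo bs h Lam.
Proof.
move=> fh; elim: bs Lam => [|b bs IH] Lam //=; apply: ler_sum => x _.
by rewrite ler_wpM2l ?colw_ge0 // ler_wpM2l.
Qed.

(** Failure forces some column into the current [expU p]. If [i] columns come after the first such
    one, that subgroup has index [p ^ (m + i.+1)] in [L], and [colw_small_index] applies. The
    condition [F x = b] is given up for this column, whence the exponent [(size bs).-1]. *)
Lemma expo_fail p m bs Lam beta : p \in primes a -> Lam \subset L -> {subset bs <= H'} ->
  (forall b, b \in bs -> pr_ev b <= beta) ->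
  #|L| = (p ^ (size bs + m) * #|expU p Lam|)%N ->
  expo bs (fun K => (p ^ m * #|expU p K| < #|L|)%N%:R) Lam <=
    (\sum_(i < size bs) rho1 mu ^+ (m + i.+1)) * beta ^+ (size bs).-1.
Proof.
move=> pin; have pp : prime p by move: pin; rewrite mem_primes => /and3P[].
have r0 := rho1_ge0 mu.
elim: bs Lam => [|b bs IH] Lam LL bsH betaP cod.
  by rewrite /= big_ord0 mul0r cod add0n ltnn.
have beta0 : 0 <= beta by apply: le_trans (pr_ev_ge0 b) (betaP b (mem_head _ _)).
have bsH' : {subset bs <= H'} by move=> c cb; apply: bsH; rewrite inE cb orbT.
have betaP' c : c \in bs -> pr_ev c <= beta by move=> cb; apply: betaP; rewrite inE cb orbT.
set f := fun K => _; set C := (\sum_(i < size bs) rho1 mu ^+ (m + i.+1)) * beta ^+ (size bs).-1.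
have f1 K : f K <= 1 by rewrite /f; case: (_ < _)%N.
have big bd : expo bs f bd <= beta ^+ size bs.
  apply: le_trans (ler_expo _ _ f1) _; rewrite expo_mass.
  elim: (bs) betaP' => [|c s IHs] bP; first by rewrite big_nil.
  rewrite big_cons exprS; apply: ler_pM; rewrite ?pr_ev_ge0 ?bP ?mem_head //.
    by apply: prodr_ge0 => ? _; apply: pr_ev_ge0.
  by apply: IHs => u us; apply: bP; rewrite inE us orbT.
have C0 : 0 <= C by rewrite mulr_ge0 ?exprn_ge0 // sumr_ge0 // => i _; apply: exprn_ge0.
have termP (x : 'V_n) : (ev F x == b)%:R * expo bs f (Lam <*> <[x]>)%G <=
    (x \in expU p Lam)%:R * beta ^+ size bs + (ev F x == b)%:R * C.
  case: eqP => [E|_]; last by rewrite !mul0r addr0 mulr_ge0 ?exprn_ge0.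
  have Lx : x \in L by apply: mem_L E; rewrite bsH ?mem_head.
  rewrite !mul1r; case xU: (x \in expU p Lam).
    by rewrite mul1r (le_trans (big _)) // lerDl.
  rewrite mul0r add0r; apply: IH => //.
    by rewrite join_subG LL cycle_subG.
  by rewrite card_expU_adjoin ?xU // mulnA -expnSr -addSn.
have CE : C = (\sum_(i < size bs) rho1 mu ^+ (m + i.+1)) * beta ^+ (size bs).-1 by [].
clearbody C.
rewrite /=; apply: (@le_trans _ _ (\sum_(x : 'V_n) cw x * ((x \in expU p Lam)%:R * beta ^+ size bs
    + (ev F x == b)%:R * C))).
  by apply: ler_sum => x _; rewrite ler_wpM2l ?colw_ge0.
under [leLHS]eq_bigr => x _ do rewrite mulrDr !mulrA.
rewrite big_split /= -!mulr_suml big_ord_recr /= mulrDl addrC; apply: lerD.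
  apply: le_trans (ler_wpM2r C0 (betaP b (mem_head _ _))) _; rewrite CE.
  case: (size bs) => [|k]; first by rewrite big_ord0 mul0r mulr0.
  by rewrite mulrCA /= -exprS.
rewrite ler_wpM2r ?exprn_ge0 //; apply: colw_small_index.
apply: (@leq_trans #|L|); last by rewrite subset_leq_card // finset.subsetT.
rewrite cod /= leq_mul2r; apply/orP; right.
by rewrite [(m + _)%N]addnC leq_exp2r ?addSn ?prime_gt1.
Qed.

End Hom.
End Exposure.

(** * Early and late columns of one matrix *)

Section Combination.
Variables (R : realType) (a : nat) (mu : balanced_law R a).
Local Notation walk := (walk mu).
Local Notation rho := (law_rho mu).
Local Notation mix := (mix mu).
Local Notation cw := (colw mu).
Local Notation "''V_' n" := ('cV['Z_a]_n : finZmodType) (at level 8, n at level 2).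
Let a_gt1 : (1 < a)%N := law_gt1 mu.
Let a_gt0 : (0 < a)%N := ltnW a_gt1.

Lemma adjoin_sub n (K : {group 'V_n}) xs (M : {group 'V_n}) :
  (adjoin K xs \subset M) = (K \subset M) && all (fun x => x \in M) xs.
Proof.
elim: xs K => [|x xs IH] K /=; first by rewrite andbT.
by rewrite IH join_subG cycle_subG andbA.
Qed.

Lemma mem_adjoin n (K : {group 'V_n}) xs x : x \in xs -> x \in adjoin K xs.
Proof. by have := adjoin_sub K xs (adjoin K xs); rewrite subxx => /esym/andP[_ /allP]; apply. Qed.

Definition act (B : finZmodType) n (F : {ffun 'I_n -> B}) (M : 'M['Z_a]_n) : {ffun 'I_n -> B} :=
  [ffun j => ev F (col j M)].

Definition colspan n (M : 'M['Z_a]_n) : {group 'V_n} := adjoin 1%G (cols M).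

Definition vals (B : finZmodType) n (F : {ffun 'I_n -> B}) : seq B := [seq F i | i <- enum 'I_n].

Lemma size_vals (B : finZmodType) n (F : {ffun 'I_n -> B}) : size (vals F) = n.
Proof. by rewrite size_map size_enum_ord. Qed.

Lemma mem_vals (B : finZmodType) n (F : {ffun 'I_n -> B}) i : F i \in vals F.
Proof. by apply: map_f; rewrite mem_enum. Qed.

(** For [s > 0], this means that [imF F] is generated by the values taken at least [s] times; [F x]
    is then nearly uniform on [imF F]. *)
Definition code (B : finZmodType) n s (F : {ffun 'I_n -> B}) :=
  all (fun g => g \in heavy s (vals F)) (vals F).

Lemma count_take_undup (T : eqType) (s : seq T) : exists r, perm_eq s (undup s ++ r).
Proof.
apply: perm_extract => x xs; rewrite count_uniq_mem ?undup_uniq // xs.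
by rewrite -has_count has_pred1 -mem_undup.
Qed.

(** One copy of every value is kept in [bs1], so that the columns exposed first already map onto the
    image of [F1]; this costs at most [#|T|] positions. *)
Lemma split_targets (T : finType) (bs : seq T) m : (m + #|T| <= size bs)%N ->
  exists bs1 bs2, [/\ perm_eq bs (bs1 ++ bs2), size bs2 = m & {subset bs <= bs1}].
Proof.
move=> le; have [r pr] := count_take_undup bs.
have szu : (size (undup bs) <= #|T|)%N.
  by rewrite cardE; apply: uniq_leq_size (undup_uniq _) _ => x _; rewrite mem_enum.
have szr : (m <= size r)%N.
  have := perm_size pr; rewrite size_cat => E.
  by rewrite E in le; rewrite -(leq_add2r #|T|); apply: leq_trans le _; rewrite addnC leq_add2l.
exists (undup bs ++ take (size r - m) r), (drop (size r - m) r); split.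
- by rewrite -catA cat_take_drop.
- by rewrite size_drop subKn.
- by move=> x xb; rewrite mem_cat mem_undup xb.
Qed.

Section Hom.
Variables (B : finZmodType).
Hypothesis torB : forall g : B, g *+ a = 0.
Hypothesis torBp : forall p (g : B), prime p -> (p %| a)%N -> g *+ (a %/ p) = 0.
Local Notation preF := (preF mu torB).
Local Notation kerF := (kerF mu torB).
Local Notation imF := (imF mu torB).

Lemma pr_evE n (F : {ffun 'I_n -> B}) b :
  pr_ev mu F b = walk (vals F) (fun x => (x == b)%:R) 0.
Proof. by rewrite /pr_ev (sum_colw_walk mu F (fun x => (x == b)%:R)). Qed.

Lemma vals_imF n (F : {ffun 'I_n -> B}) b : b \in vals F -> b \in imF F.
Proof. by case/mapP => i _ ->; rewrite -(ev_unitv mu F i) ev_imF. Qed.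

(* The probability that [F M = F1] and [ker F <= im M]. *)
Definition hit n (F F1 : {ffun 'I_n -> B}) : R :=
  \sum_M mxw mu M * ((act F M == F1) && (kerF F \subset colspan M))%:R.

(** When [F M = F1], the column span maps onto [imF F1]; containing [kerF F] then amounts to being
    all of [F^-1(imF F1)], which is what [final] tests. *)
Lemma hit_expo n (F F1 : {ffun 'I_n -> B}) :
  hit F F1 = expo mu F (vals F1) (final mu torB F (imF F1)) 1%G.
Proof.
rewrite expo_iexp size_vals -sum_mxw_iexp; apply: eq_bigr => M _; congr (_ * _).
rewrite -/(colspan M).
have -> : ([seq ev F x | x <- cols M] == vals F1) = (act F M == F1).
  rewrite /cols -map_comp; apply/eqP/eqP => [E|<-].
    apply/ffunP => j; rewrite ffunE.
    have jE : j \in enum 'I_n by rewrite mem_enum.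
    by have /eq_in_map/(_ j jE) := E.
  by apply: eq_map => j /=; rewrite ffunE.
case: eqP => [E|_]; last by rewrite mul0r.
rewrite mul1r /final /=; congr ((nat_of_bool _)%:R).
have colE j : ev F (col j M) = F1 j by rewrite -E ffunE.
have SL : colspan M \subset preF F (imF F1).
  rewrite adjoin_sub sub1G /=; apply/allP => _ /mapP[j _ ->].
  by rewrite mem_preF colE vals_imF ?mem_vals.
apply/idP/idP => [KM|/eqP ->]; last first.
  by apply/fintype.subsetP => x; rewrite mem_kerF mem_preF => /eqP ->; apply: group0.
apply/eqP/val_inj/eqP; rewrite /= finset.eqEsubset SL /=; apply/fintype.subsetP => v.
rewrite mem_preF => vim.
have sub : imF F1 \subset (evm mu torB F @* colspan M)%G.
  rewrite imF_sub; apply/forallP => j; rewrite -colE.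
  by apply: (@mem_morphim _ _ _ (evm mu torB F)); rewrite ?inE // mem_adjoin //; apply: map_f; rewrite mem_enum.
have /morphimP[u _ uM /= Eu] := fintype.subsetP sub _ vim.
have -> : v = (v - u) + u by rewrite subrK.
rewrite groupD //; apply: (fintype.subsetP KM).
by rewrite mem_kerF (evB mu torB) Eu subrr.
Qed.

Lemma hit_le n (F F1 : {ffun 'I_n -> B}) : hit F F1 <= \prod_(b <- vals F1) pr_ev mu F b.
Proof.
rewrite hit_expo -(expo_mass mu F _ 1%G); apply: ler_expo => K.
by rewrite /final; case: eqP.
Qed.

Lemma hit_ge0 n (F F1 : {ffun 'I_n -> B}) : 0 <= hit F F1.
Proof.
apply: sumr_ge0 => M _; rewrite mulr_ge0 // prodr_ge0 // => j _; apply: colw_ge0.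
Qed.

(* [bad] and [fail p] are the indicators of the two ways in which the group [K]
   spanned by the first columns can prevent the last [m] columns from being
   analysed: too sparse a dual vector, or too large a corank modulo [p]. *)
Definition bad n (F : {ffun 'I_n -> B}) s (K : {group 'V_n}) : R :=
  (~~ `[< supp_ge (K :&: kerF F)%G s >])%:R.

Definition fail n (F : {ffun 'I_n -> B}) H' m p (K : {group 'V_n}) : R :=
  (p ^ m * #|expU mu torB F H' p K| < #|preF F H'|)%N%:R.

Lemma expU_adjoin_le n (F : {ffun 'I_n -> B}) H' p (K : {group 'V_n}) xs : prime p ->
  all (fun x => x \in preF F H') xs ->
  (#|expU mu torB F H' p (adjoin K xs)| <= p ^ size xs * #|expU mu torB F H' p K|)%N.
Proof.
move=> pp; elim: xs K => [|x xs IH] K /=; first by rewrite mul1n.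
case/andP => xL xsL; apply: leq_trans (IH _ xsL) _.
rewrite expnSr -mulnA leq_mul2l; apply/orP; right.
exact: card_expU_adjoin_le.
Qed.

Section Fixed.
Variables (n m s : nat) (F F1 : {ffun 'I_n -> B}).
Variables (bs1 bs2 : seq B).
Hypothesis F1F : imF F1 \subset imF F.
Hypothesis pbs : perm_eq (vals F1) (bs1 ++ bs2).
Hypothesis sz2 : size bs2 = m.
Hypothesis gen1 : {subset vals F1 <= bs1}.
Let N := (#|B| * a ^ m)%N.
Hypothesis st : (0 < s %/ N)%N.
Let H' := imF F1.
Let kap : R := #|imF F|%:R ^- m * cprod R a m.
Let eps : R := m%:R * (N%:R * mix N (s %/ N)).

Let kap01 : 0 <= kap <= 1.
Proof.
have H1 : 1 <= #|imF F|%:R :> R by rewrite ler1n cardG_gt0.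
rewrite mulr_ge0 ?invr_ge0 ?exprn_ge0 ?cprod_ge0 //=.
rewrite mulr_ile1 ?invr_ge0 ?exprn_ge0 ?cprod_ge0 ?cprod_le1 //.
by rewrite invf_le1 ?exprn_gt0 ?exprn_ege1 // (lt_le_trans ltr01).
Qed.

Lemma subset_bs1 : {subset bs1 <= H'}.
Proof. by move=> b b1; apply: vals_imF; rewrite (perm_mem pbs) mem_cat b1. Qed.

Lemma subset_bs2 : {subset bs2 <= H'}.
Proof. by move=> b b2; apply: vals_imF; rewrite (perm_mem pbs) mem_cat b2 orbT. Qed.

Lemma size_bs1 : n = (size bs1 + m)%N.
Proof. by rewrite -sz2 -size_cat -(perm_size pbs) size_vals. Qed.

Lemma reach xs : [seq ev F x | x <- xs] = bs1 -> all (fun x => x \in preF F H') xs.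
Proof.
move=> E; apply/allP => x xin; rewrite mem_preF; apply: subset_bs1.
by rewrite -E map_f.
Qed.

(** Either the corank modulo some [p] exceeds [m], and the probability is [0] so that the error is
    [kap] itself; or a dual vector is too sparse, and the trivial bound [1] is paid; or [expo_last]
    applies with error [eps]. *)
Lemma last_columns xs : [seq ev F x | x <- xs] = bs1 ->
  `|expo mu F bs2 (final mu torB F H') (adjoin 1%G xs) - kap| <=
    eps + bad F s (adjoin 1%G xs) + kap * \sum_(p <- primes a) fail F H' m p (adjoin 1%G xs).
Proof.
move=> Exs; set K := adjoin 1%G xs.
have eps0 : 0 <= eps by rewrite !mulr_ge0 ?mix_ge0.
have xsL := reach Exs.
have KL : K \subset preF F H' by rewrite adjoin_sub sub1G.
have g01 : 0 <= expo mu F bs2 (final mu torB F H') K <= 1.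
  rewrite expo_iexp; apply/andP; split.
    by apply: iexp_ge0 => [x|ys _]; [apply: colw_ge0|rewrite mulr_ge0].
  rewrite -expo_iexp; apply: le_trans (_ : expo mu F bs2 (fun=> 1) K <= 1).
    by apply: ler_expo => L; rewrite /final; case: eqP.
  rewrite expo_mass; apply: prodr_ile1 => b _; rewrite pr_ev_ge0 /=.
  rewrite -(colw_sum mu n); apply: ler_sum => x _.
  by rewrite ler_piMr ?colw_ge0 //; case: eqP.
have fail0 p : 0 <= fail F H' m p K by rewrite /fail.
case failing: (has (fun p => p ^ m * #|expU mu torB F H' p K| < #|preF F H'|)%N (primes a)).
  case/hasP: failing => p pin lt.
  rewrite (expo_final0 pin KL subset_bs2) ?sz2 // sub0r normrN ger0_norm; last by case/andP: kap01.
  apply: (@le_trans _ _ (kap * \sum_(p <- primes a) fail F H' m p K)); last first.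
    by rewrite lerDr addr_ge0 ?ler0n.
  rewrite -[leLHS]mulr1 ler_wpM2l //; first by case/andP: kap01.
  rewrite (big_rem p) //= {1}/fail lt lerDl; apply: sumr_ge0 => q _; exact: fail0.
rewrite /bad; case: asboolP => rob; last first.
  apply: (@le_trans _ _ 1).
    case/andP: g01 => g0 g1; case/andP: kap01 => k0 k1.
    by move: g0 g1; set X := expo _ _ _ _ _ => g0 g1; rewrite ler_norml; apply/andP; split; lra.
  rewrite -[leLHS]add0r -[leLHS]addr0 lerD ?lerD //.
  by rewrite mulr_ge0 ?sumr_ge0 //; case/andP: kap01.
rewrite addr0; apply: (@le_trans _ _ eps); last first.
  by rewrite lerDl mulr_ge0 ?sumr_ge0 //; case/andP: kap01.
rewrite /kap /eps -sz2.
apply: (@expo_last _ _ mu B n torB F H' F1F bs2 K s (s %/ N)%N N KL _ _ subset_bs2 rob st _ _).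
- apply/fintype.subsetP => v; rewrite mem_preF => vim.
  have sub : H' \subset (evm mu torB F @* K)%G.
    rewrite /H' imF_sub; apply/forallP => j.
    have : F1 j \in [seq ev F x | x <- xs] by rewrite Exs gen1 // mem_vals.
    case/mapP => x xin ->; apply: (@mem_morphim _ _ _ (evm mu torB F)); rewrite ?inE //.
    exact: mem_adjoin.
  have /morphimP[u _ uK /= Eu] := fintype.subsetP sub _ vim.
  apply/zmod_joinP; exists u => //; exists (v - u); last by rewrite addrC subrK.
  by rewrite mem_kerF (evB mu torB) Eu subrr.
(* The corank is exactly [m]: at most [m] because failure is excluded, at least [m] because each of
   the [n - m] early columns lowers it by at most one. *)
- move=> p pin; have pp : prime p by move: pin; rewrite mem_primes => /and3P[].
  have pa : (p %| a)%N by move: pin; rewrite mem_primes => /and3P[].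
  apply/eqP; rewrite eqn_leq; apply/andP; split.
    move/hasPn: (negbT failing) => /(_ p pin); rewrite -leqNgt sz2; apply.
  rewrite sz2 (card_expU1 mu torB torBp F H' pp pa).
  have szx : size xs = size bs1 by rewrite -Exs size_map.
  rewrite [X in (_ <= p ^ X * _)%N]size_bs1 [(size bs1 + m)%N]addnC expnD -mulnA leq_mul2l; apply/orP; right.
  by rewrite -szx; apply: expU_adjoin_le.
- by rewrite sz2.
- by rewrite mulnC leq_trunc_div.
Qed.

Lemma hit_approx :
  `|hit F F1 - kap * \prod_(b <- bs1) pr_ev mu F b| <=
    eps * \prod_(b <- bs1) pr_ev mu F b + expo mu F bs1 (bad F s) 1%G
    + kap * \sum_(p <- primes a) expo mu F bs1 (fail F H' m p) 1%G.
Proof.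
rewrite hit_expo -/H' (expo_perm mu F _ _ pbs) expo_cat.
set g := expo mu F bs2 _.
pose E (f : {group 'V_n} -> R) := iexp (@colw _ _ mu n) (size bs1)
   (fun xs => ([seq ev F x | x <- xs] == bs1)%:R * f (adjoin 1%G xs)).
have EE f : expo mu F bs1 f 1%G = E f by rewrite expo_iexp.
have EZ c f : E (fun K => c * f K) = c * E f.
  by rewrite /E -iexpZ; apply: eq_iexp => xs _; rewrite mulrCA.
have ED f h : E (fun K => f K + h K) = E f + E h.
  by rewrite /E -iexpD; apply: eq_iexp => xs _; rewrite mulrDr.
have Esum : \sum_(p <- primes a) E (fail F H' m p) = E (fun K => \sum_(p <- primes a) fail F H' m p K).
  elim: (primes a) => [|p ps IH].
    rewrite big_nil; transitivity (0 * E (fun=> 0)); first by rewrite mul0r.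
    by rewrite -EZ; apply: eq_iexp => xs _; rewrite big_nil mul0r.
  by rewrite big_cons IH -ED; apply: eq_iexp => xs _; rewrite big_cons.
rewrite -(expo_mass mu F bs1 1%G) !EE.
under eq_bigr => p _ do rewrite EE.
rewrite Esum -!EZ -!ED.
have le1 f h : (forall xs, [seq ev F x | x <- xs] = bs1 -> f (adjoin 1%G xs) <= h (adjoin 1%G xs)) -> E f <= E h.
  move=> fh; apply: ler_iexp => [x|xs _]; first exact: colw_ge0.
  by case: eqP => [/fh le|_]; rewrite ?mul0r // !mul1r.
rewrite ler_norml; apply/andP; split.
  rewrite lerNl opprB -[X in X <= _]addrC -mulN1r -EZ -ED; apply: le1 => xs /last_columns.
  by rewrite ler_norml => /andP[H _]; rewrite !mulr1 mulN1r addrC -opprB lerNl.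
rewrite -mulN1r -EZ -ED; apply: le1 => xs /last_columns.
by rewrite ler_norml => /andP[_ H]; rewrite !mulr1 mulN1r.
Qed.

End Fixed.

Definition pairB : finZmodType := (B * 'Z_a)%type.

Definition pairF n (F : {ffun 'I_n -> B}) (y : {ffun 'I_n -> 'Z_a}) : {ffun 'I_n -> pairB} :=
  [ffun i => (F i, y i)].

Lemma tor_pair (g : pairB) : g *+ a = 0.
Proof.
have E k : g *+ k = (g.1 *+ k, g.2 *+ k) by elim: k => // k IH; rewrite !mulrS IH.
by rewrite E torB (Zp_torsion mu).
Qed.

Lemma ev_pairF n (F : {ffun 'I_n -> B}) y (x : 'V_n) : ev (pairF F y) x = (ev F x, ev y x).
Proof.
rewrite /ev; apply: (big_rec3 (fun (u : pairB) v w => u = (v, w))) => // i u v w _ ->.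
rewrite ffunE; have E k : ((F i, y i) : pairB) *+ k = (F i *+ k, y i *+ k).
  by elim: k => // k IH; rewrite !mulrS IH.
by rewrite E.
Qed.

Definition light n s (y : {ffun 'I_n -> 'Z_a}) :=
  (y != [ffun=> 0]) && (#|[set i | y i != 0%R]| < s)%N.

(* A sparse dual vector [y] of [K :&: ker F] takes on each column [x] a value that
   depends only on [F x]; such an event is a column event for the pair [(F, y)]. *)
Lemma expo_bad n s (F : {ffun 'I_n -> B}) bs :
  expo mu F bs (bad F s) 1%G <= \sum_(y | light s y) \sum_(sg : {ffun B -> 'Z_a})
     \prod_(b <- bs) walk (vals (pairF F y)) (fun x : pairB => (x == (b, sg b))%:R) 0.
Proof.
have E y (sg : {ffun B -> 'Z_a}) : \prod_(b <- bs) walk (vals (pairF F y)) (fun x : pairB => (x == (b, sg b))%:R) 0 =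
   iexp (@colw _ _ mu n) (size bs) (fun xs => \prod_(p <- zip bs xs) (ev (pairF F y) p.2 == (p.1, sg p.1))%:R).
  rewrite (iexp_prod _ _ (fun b x => (ev (pairF F y) x == (b, sg b))%:R)); apply: eq_bigr => b _.
  by rewrite (sum_colw_walk mu (pairF F y) (fun x : pairB => (x == (b, sg b))%:R)).
under eq_bigr => y _ do under eq_bigr => sg _ do rewrite E.
under eq_bigr => y _ do rewrite -iexp_sum.
rewrite -iexp_sum expo_iexp; apply: ler_iexp => [x|xs sz]; first exact: colw_ge0.
have nn y (sg : {ffun B -> 'Z_a}) : 0 <= \prod_(p <- zip bs xs) (ev (pairF F y) p.2 == (p.1, sg p.1))%:R :> R.
  by apply: prodr_ge0.
have nn2 : 0 <= \sum_(y | light s y) \sum_(sg : {ffun B -> 'Z_a})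
    \prod_(p <- zip bs xs) (ev (pairF F y) p.2 == (p.1, sg p.1))%:R :> R.
  by apply: sumr_ge0 => y _; apply: sumr_ge0 => sg _; apply: nn.
case: eqP => [Exs|_]; last by rewrite mul0r.
rewrite mul1r /bad; case: asboolP => // nrob.
move/existsNP: nrob => [y /not_implyP[y0 /not_implyP[yK /negP]]]; rewrite -ltnNge => ys.
rewrite (bigD1 y) /=; last by rewrite /light y0.
(* Columns with equal image under [F] differ by an element of [K :&: kerF F], which [y] kills; so
   [sg b] may be read off at the first position with target [b]. *)
pose sg : {ffun B -> 'Z_a} := [ffun b => ev y (nth 0 xs (index b bs))].
rewrite (bigD1 sg) //= -addrA.
have -> : \prod_(p <- zip bs xs) (ev (pairF F y) p.2 == (p.1, sg p.1))%:R = 1 :> R.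
  rewrite big_seq big1 // => -[b x] /= bx.
  have [k klt kE] : exists2 k, (k < size bs)%N & (b, x) = (nth 0 bs k, nth 0 xs k).
    case/(nthP (0, 0)): bx => k; rewrite size_zip sz minnn => klt <-.
    by exists k => //; rewrite nth_zip.
  case: kE => bE xE.
  have Fx : ev F x = b by rewrite bE xE -[in RHS]Exs (nth_map 0) ?sz.
  have bin : b \in bs by rewrite bE mem_nth.
  rewrite ev_pairF Fx ffunE.
  set x' := nth 0 xs _.
  have ilt : (index b bs < size xs)%N by rewrite sz index_mem.
  have bx' : ev F x' = b.
    by rewrite -(nth_map 0 0) // Exs nth_index.
  have : ev y (x - x') = 0.
    apply: yK; rewrite in_setI mem_kerF (evB mu torB) Fx bx' subrr eqxx andbT.
    by rewrite groupB // mem_adjoin // ?mem_nth // xE mem_nth // sz.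
  rewrite (evB mu (Zp_torsion mu)) => /eqP; rewrite subr_eq0 => /eqP ->.
  by rewrite eqxx.
rewrite lerDl addr_ge0 //.
  by apply: sumr_ge0 => sg' _; apply: nn.
by apply: sumr_ge0 => y' _; apply: sumr_ge0 => sg' _; apply: nn.
Qed.

(** A value of [(F, y)] taken at least [s] times has second component zero, because [y] has fewer
    than [s] nonzero entries; a nonzero entry of [y] thus gives a value outside the heavy
    subgroup. *)
Lemma light_sparse n s (F : {ffun 'I_n -> B}) y : light s y ->
  has (fun g => g \notin heavy s (vals (pairF F y))) (vals (pairF F y)).
Proof.
case/andP => y0 ys.
have [i yi] : exists i, y i != 0.
  apply/existsP; apply: contraR y0; rewrite negb_exists => /forallP H.
  by apply/eqP/ffunP => i; rewrite ffunE; apply/eqP; have := H i; rewrite negbK.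
apply/hasP; exists (pairF F y i); first exact: mem_vals.
have gK : group_set [set g : pairB | g.2 == 0].
  apply/group_setP; split; first by rewrite inE.
  by move=> g h; rewrite !inE => /eqP g0 /eqP h0; rewrite FinRing.zmodMgE /= g0 h0 addr0.
have sub : heavy s (vals (pairF F y)) \subset Group gK.
  rewrite gen_subG; apply/fintype.subsetP => g; rewrite !inE => sc; apply: contraLR ys => g2.
  rewrite -leqNgt; apply: leq_trans sc _.
  rewrite count_map -size_filter -sum1_size big_filter big_enum_cond /= sum1_card.
  apply: subset_leq_card; apply/fintype.subsetP => j; rewrite !inE unfold_in /= => /eqP/eqP/andP[_ /eqP E].
  by move: g2; rewrite -E ffunE.
by apply: contra yi => /(fintype.subsetP sub); rewrite inE ffunE.
Qed.

End Hom.
End Combination.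

(** * Summing over the homomorphisms with a given image *)

Section SumOverHoms.
Variables (R : realType) (a : nat) (mu : balanced_law R a).
Local Notation walk := (walk mu).
Local Notation rho := (law_rho mu).
Local Notation mix := (mix mu).
Local Notation "''V_' n" := ('cV['Z_a]_n : finZmodType) (at level 8, n at level 2).
Let a_gt1 : (1 < a)%N := law_gt1 mu.
Let a_gt0 : (0 < a)%N := ltnW a_gt1.

(** The right side of [sparse_sum_le] for a group of order [C] with [g] subgroups, [n'] exposed
    columns and [m] further ones. *)
Definition sparse_bound (C g n' m s : nat) (z : R) : R :=
  g%:R * z ^- (C * s) * ((1 + z * C%:R) * C%:R) ^+ m *
  ((1 + z * C%:R) * rho * (1 + C%:R * mix C s)) ^+ n'.

Variables (B : finZmodType).
Hypothesis torB : forall g : B, g *+ a = 0.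
Hypothesis torBp : forall p (g : B), prime p -> (p %| a)%N -> g *+ (a %/ p) = 0.
Local Notation kerF := (kerF mu torB).
Local Notation imF := (imF mu torB).
Local Notation hit := (hit mu torB).

Lemma sum_noncode n s (F1 : {ffun 'I_n -> B}) z : (0 < s)%N -> 0 < z <= 1 ->
  \sum_(F | ~~ code s F) hit F F1 <= sparse_bound #|B| #|{group B}| n 0 s z.
Proof.
move=> s0 z01; have e : n = (size (vals F1) + 0)%N by rewrite size_vals addn0.
have := sparse_sum_le mu torB s0 z01 e; rewrite size_vals -/(sparse_bound _ _ _ _ _ _).
apply: le_trans; rewrite [leLHS](eq_bigl (fun F : {ffun 'I_n -> B} => has (fun g => g \notin heavy s (vals F)) (vals F))).
  by apply: ler_sum => F _; apply: le_trans (hit_le _ _ _ _) _; apply: ler_prod => b _; rewrite pr_ev_ge0 pr_evE /=.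
by move=> F; rewrite -has_predC.
Qed.

(** The pairs [(F, y)] are homomorphisms to [B * 'Z_a], and [light_sparse] brings them under
    [sparse_sum_le]. The choice of [sg] costs a factor that does not grow with [n]. *)
Lemma sum_bad n m s bs1 z : (0 < s)%N -> 0 < z <= 1 -> n = (size bs1 + m)%N ->
  \sum_(F : {ffun 'I_n -> B}) expo mu F bs1 (bad mu torB F s) 1%G <=
  #|{ffun B -> 'Z_a}|%:R * sparse_bound #|pairB a B| #|{group (pairB a B)}| (size bs1) m s z.
Proof.
move=> s0 z01 nE.
apply: (@le_trans _ _ (\sum_(F : {ffun 'I_n -> B}) \sum_(y | light s y) \sum_(sg : {ffun B -> 'Z_a})
     \prod_(b <- bs1) walk (vals (pairF F y)) (fun x : pairB a B => (x == (b, sg b))%:R) 0)).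
  by apply: ler_sum => F _; apply: expo_bad.
under eq_bigr => F _ do rewrite exchange_big /=.
rewrite exchange_big /= mulr_natl -sumr_const; apply: ler_sum => sg _.
pose e : seq (pairB a B) := [seq (b, sg b) | b <- bs1].
have ne : n = (size e + m)%N by rewrite size_map.
have := sparse_sum_le mu (tor_pair mu torB) s0 z01 ne.
rewrite size_map -/(sparse_bound _ _ _ _ _ _); apply: le_trans.
rewrite pair_big_dep /=.
rewrite [leRHS](reindex (fun p : {ffun 'I_n -> B} * {ffun 'I_n -> 'Z_a} => pairF p.1 p.2)) /=; last first.
  exists (fun G : {ffun 'I_n -> pairB a B} => ([ffun i => (G i).1], [ffun i => (G i).2])) => [[F y] _|G _] /=.
    by congr pair; apply/ffunP => i; rewrite !ffunE.
  by apply/ffunP => i; rewrite !ffunE; case: (G i).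
rewrite big_mkcond [leRHS]big_mkcond /=; apply: ler_sum => -[F y] _ /=.
have nn : 0 <= \prod_(b <- e) walk (vals (pairF F y)) (fun x : pairB a B => (x == b)%:R) 0.
  by apply: prodr_ge0 => b _; apply: walk_ge0.
case: ifP => [ly|_]; last by case: ifP.
by rewrite (light_sparse F ly) /e big_map.
Qed.

Lemma card_half (K H : {group B}) : K \proper H -> (#|K| * 2 <= #|H|)%N.
Proof.
move=> KH; rewrite -(Lagrange (proper_sub KH)) leq_mul2l; apply/orP; right.
by rewrite ltn_neqAle eq_sym indexg_eq1 proper_subn // indexg_gt0.
Qed.

(** A map into [H] that violates [code] or has a smaller image has its heavy subgroup proper in [H],
    hence of order at most half that of [H]; such maps are rarer by a factor exponential in [n]. *)
Lemma code_count n s (H : {group B}) z : (0 < s)%N -> 0 < z <= 1 ->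
  (#|H|%:R ^+ n - \sum_(F : {ffun 'I_n -> B} | code s F && (imF F == H)) 1 : R) <=
    #|H|%:R ^+ n * (#|{group B}|%:R * z ^- (#|B| * s) * ((1 + z * #|B|%:R) / 2) ^+ n).
Proof.
move=> s0 z01; have z0 : 0 <= z by case/andP: z01 => /ltW.
have C0 : 0 <= 1 + z * #|B|%:R by rewrite addr_ge0 // mulr_ge0.
have hn : #|H|%:R ^+ n = \sum_(F : {ffun 'I_n -> B} | F \in ffun_on (mem H)) 1 :> R.
  by rewrite sumr_const card_ffun_on card_ord natrX.
rewrite {1}hn (bigID (fun F : {ffun 'I_n -> B} => code s F && (imF F == H))) /=.
have -> : \sum_(F : {ffun 'I_n -> B} | (F \in ffun_on (mem H)) && (code s F && (imF F == H))) 1 =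
   \sum_(F : {ffun 'I_n -> B} | code s F && (imF F == H)) 1 :> R.
  apply: eq_bigl => F; rewrite andbC; case: (code s F) => //=; case: eqP => //= FH.
  by apply/ffun_onP => i; rewrite -FH vals_imF // mem_vals.
rewrite addrAC subrr add0r.
apply: (@le_trans _ _ (\sum_(K : {group B} | K \proper H) \sum_(F : {ffun 'I_n -> B} | heavy s (vals F) == K) 1)).
  rewrite (exchange_big_dep predT) //= big_mkcond; apply: ler_sum => F _.
  case: ifP => [/andP[FH nc]|_]; last by apply: sumr_ge0.
  have hH : heavy s (vals F) \subset H.
    by apply: heavy_sub => // _ /mapP[i _ ->]; apply: (ffun_onP FH).
  have hp : heavy s (vals F) \proper H.
    rewrite properEneq hH andbT; apply: contra nc => /eqP hE.
    have cF : code s F by apply/allP => _ /mapP[i _ ->]; rewrite -[_ \in _]/(F i \in gval _) hE (ffun_onP FH).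
    have i1 : imF F \subset H by rewrite imF_sub; apply/forallP => i; apply: (ffun_onP FH).
    have i2 : H \subset imF F by rewrite -hE; apply: heavy_sub => // g /vals_imF.
    by rewrite cF /=; apply/eqP/val_inj/eqP; rewrite finset.eqEsubset i1 i2.
  rewrite (bigD1 (heavy s (vals F))) /=; last by rewrite hp eqxx.
  by rewrite lerDl sumr_ge0.
set T := _ * (_ * _).
apply: (@le_trans _ _ (\sum_(K : {group B} | K \proper H) (T / #|{group B}|%:R))); last first.
  have g0 : 0 < #|{group B}|%:R :> R by rewrite ltr0n; apply/card_gt0P; exists 1%G.
  rewrite sumr_const -[leLHS]mulr_natl mulrCA -[leRHS]mulr1 ler_wpM2l //.
    by rewrite /T !mulr_ge0 ?invr_ge0 ?exprn_ge0 // divr_ge0.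
  by rewrite ler_pdivrMr // mul1r ler_nat max_card.
apply: ler_sum => K KH; apply: le_trans (card_light_heavy n K s0 z01) _.
have g0 : #|{group B}|%:R != 0 :> R by rewrite pnatr_eq0 -lt0n; apply/card_gt0P; exists 1%G.
have -> : T / #|{group B}|%:R = z ^- (#|B| * s) * ((1 + z * #|B|%:R) * (#|H|%:R / 2)) ^+ n.
  by rewrite /T !exprMn; field; rewrite g0 expf_neq0 //; case/andP: z01 => /gt_eqF ->.
rewrite ler_wpM2l ?invr_ge0 ?exprn_ge0 // lerXn2r ?nnegrE ?mulr_ge0 ?divr_ge0 //.
rewrite ler_wpM2l // ler_pdivlMr // -natrM ler_nat; exact: card_half.
Qed.

Lemma prod_near1 (v : seq R) (u : R) : 0 <= u -> (forall x, x \in v -> 0 <= x /\ 1 - u <= x <= 1 + u) ->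
  `|\prod_(x <- v) x - 1| <= ((1 + u) ^+ size v - 1) + (size v)%:R * u.
Proof.
move=> u0 H.
have up : 0 <= \prod_(x <- v) x <= (1 + u) ^+ size v.
  elim: v H => [|x v IH] H; first by rewrite big_nil ler01 lexx.
  have [x0 /andP[_ x1]] := H x (mem_head _ _).
  have /andP[p0 p1] := IH (fun y yv => H y (mem_behead (s := x :: v) yv)).
  rewrite big_cons mulr_ge0 //= exprS ler_pM //.
have lo : 1 - (size v)%:R * u <= \prod_(x <- v) x.
  (* For [u <= 1] this is Bernoulli's inequality by induction; for [u > 1] the bound is negative
     unless the list is empty. *)
  case/andP: up => p0 _; case: (lerP u 1) => u1.
    elim: v H {p0} => [|x v IH] H; first by rewrite big_nil mul0r subr0.
    have [x0 /andP[x1 _]] := H x (mem_head _ _).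
    have IHv := IH (fun y yv => H y (mem_behead (s := x :: v) yv)).
    have pv : 0 <= \prod_(x <- v) x.
      by rewrite big_seq; apply: prodr_ge0 => y yv; case: (H y (mem_behead (s := x :: v) yv)).
    rewrite big_cons /=; apply: (@le_trans _ _ ((1 - u) * \prod_(x <- v) x)); last by rewrite ler_wpM2r.
    apply: (@le_trans _ _ ((1 - u) * (1 - (size v)%:R * u))); last by rewrite ler_wpM2l ?subr_ge0.
    have : 0 <= (size v)%:R * u * u by rewrite !mulr_ge0.
    rewrite -natr1; set k := (size v)%:R; nra.
  case: v H p0 => [|x v] H p0; first by rewrite big_nil mul0r subr0.
  apply: le_trans p0; rewrite subr_le0 /= -natr1.
  have : 0 <= (size v)%:R * u by rewrite mulr_ge0.
  nra.
case/andP: up => p0 p1.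
have Y1 : 1 <= (1 + u) ^+ size v by rewrite exprn_ege1 // lerDl.
have k0 : 0 <= (size v)%:R * u by rewrite mulr_ge0.
rewrite ler_norml; apply/andP; split; lra.
Qed.

Lemma pr_ev_code n s (F : {ffun 'I_n -> B}) b : (0 < s)%N -> code s F -> b \in imF F ->
  `|pr_ev mu F b - #|imF F|%:R^-1| <= mix #|B| s.
Proof.
move=> s0 cF bF; rewrite pr_evE.
have sub : {subset vals F <= imF F} by move=> g /vals_imF.
apply: le_trans (ler_mix mu s (max_card (mem (imF F)))).
apply: walk_heavy => //.
  rewrite imF_sub; apply/forallP => i; apply: (allP cF); exact: mem_vals.
by rewrite sub0r groupN.
Qed.

Definition geom_tail m : R := rho1 mu ^+ m / (1 - rho1 mu).

Lemma geom_tailP m k : \sum_(i < k) rho1 mu ^+ (m + i.+1) <= geom_tail m.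
Proof.
have r0 := rho1_ge0 mu; have r1 := rho1_lt1 mu.
have d0 : 0 < 1 - rho1 mu by rewrite subr_gt0.
have -> : \sum_(i < k) rho1 mu ^+ (m + i.+1) = rho1 mu ^+ m * \sum_(i < k) rho1 mu ^+ i.+1.
  by rewrite mulr_sumr; apply: eq_bigr => i _; rewrite exprD.
rewrite /geom_tail; apply: ler_wpM2l; first by rewrite exprn_ge0.
rewrite -[leRHS]mul1r ler_pdivlMr //.
suff -> : (\sum_(i < k) rho1 mu ^+ i.+1) * (1 - rho1 mu) = rho1 mu - rho1 mu ^+ k.+1.
  by have := exprn_ge0 k.+1 r0; lra.
elim: k => [|k IH]; first by rewrite big_ord0 mul0r expr1 subrr.
rewrite big_ord_recr /= mulrDl IH !exprS; ring.
Qed.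

(** Error relative to [#|imF F| ^- n]: the upper and the lower deviation of the product over the
    early columns, the equidistribution errors of the last [m] columns, and the chance of a corank
    above [m]. Only the last term survives when [n] grows with [m] fixed and [s = sqrt n]. *)
Definition code_err n m s : R :=
  let u := #|B|%:R * mix #|B| s in let N := (#|B| * a ^ m)%N in let Y := (1 + u) ^+ n in
  (Y - 1) + n%:R * u + m%:R * (N%:R * mix N (s %/ N)) * #|B|%:R ^+ m * Y
  + (size (primes a))%:R * #|B|%:R * geom_tail m * Y.

Lemma hit_code n m s (F F1 : {ffun 'I_n -> B}) bs1 bs2 : (0 < s)%N -> code s F ->
  imF F1 \subset imF F -> perm_eq (vals F1) (bs1 ++ bs2) -> size bs2 = m ->
  {subset vals F1 <= bs1} -> (0 < s %/ (#|B| * a ^ m))%N -> (0 < size bs1)%N ->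
  `|hit F F1 - #|imF F|%:R ^- n * cprod R a m| <=
    #|imF F|%:R ^- n * code_err n m s + expo mu F bs1 (bad mu torB F s) 1%G.
Proof.
move=> s0 cF F1F pbs sz2 gen1 sN bs10.
have := hit_approx torBp F1F pbs sz2 gen1 sN.
set h : R := #|imF F|%:R; set N := (#|B| * a ^ m)%N in sN *; set c := cprod R a m.
set eps := m%:R * (N%:R * _); set PP := \prod_(b <- bs1) _; set bd := expo mu F bs1 _ _.
set u := #|B|%:R * mix #|B| s.
have u0 : 0 <= u by rewrite mulr_ge0 ?mix_ge0.
have h1 : 1 <= h by rewrite ler1n cardG_gt0.
have h0 : 0 < h by rewrite (lt_le_trans ltr01).
have hB : h <= #|B|%:R by rewrite ler_nat max_card.
have eps0 : 0 <= eps by rewrite !mulr_ge0 ?mix_ge0.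
have c0 : 0 <= c := cprod_ge0 R a m; have c1 : c <= 1 := cprod_le1 R a m.
set Y := (1 + u) ^+ n; have Y1 : 1 <= Y by rewrite exprn_ege1 // lerDl.
have nE : n = (size bs1 + m)%N by rewrite -sz2 -size_cat -(perm_size pbs) size_vals.
have bsH : {subset bs1 <= imF F1}.
  by move=> b b1; apply: vals_imF; rewrite (perm_mem pbs) mem_cat b1.
have prb b : b \in bs1 -> `|pr_ev mu F b - h^-1| <= mix #|B| s.
  by move=> b1; apply: pr_ev_code => //; apply: (fintype.subsetP F1F); apply: bsH.
have hpr b : b \in bs1 -> 1 - u <= h * pr_ev mu F b <= 1 + u.
  move=> /prb; rewrite ler_distl => /andP[l1 l2].
  have hh : h * h^-1 = 1 by rewrite divff // gt_eqF.
  have hm : h * mix #|B| s <= u by rewrite ler_wpM2r ?mix_ge0.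
  have := ler_wpM2l (ltW h0) l1; have := ler_wpM2l (ltW h0) l2; rewrite mulrBr mulrDr hh => A1 A2.
  by apply/andP; split; [apply: le_trans A2; rewrite lerD2l lerN2|apply: le_trans A1 _; rewrite lerD2l].
pose v := [seq h * pr_ev mu F b | b <- bs1].
have vE : \prod_(x <- v) x = h ^+ size bs1 * PP.
  by rewrite big_map /PP; elim: (bs1) => [|b s' IH]; rewrite ?big_nil ?mulr1 // !big_cons IH /= exprS; ring.
have PPE : PP = h ^- size bs1 * \prod_(x <- v) x.
  by rewrite vE mulrA mulVf ?mul1r // expf_neq0 // gt_eqF.
have vP x : x \in v -> 0 <= x /\ 1 - u <= x <= 1 + u.
  by case/mapP => b b1 ->; split; [rewrite mulr_ge0 ?pr_ev_ge0 // ltW|apply: hpr].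
have near := prod_near1 u0 vP; rewrite size_map in near.
set W := \prod_(x <- v) x in vE PPE near.
have sn : (size bs1 <= n)%N by rewrite nE leq_addr.
have Ys : (1 + u) ^+ size bs1 <= Y by rewrite ler_weXn2l // lerDl.
have nu : (size bs1)%:R * u <= n%:R * u by rewrite ler_wpM2r // ler_nat.
have W0 : 0 <= W by rewrite /W big_seq; apply: prodr_ge0 => x /vP[].
have WY : W <= Y.
  apply: le_trans Ys; rewrite /W -(size_map (fun b => h * pr_ev mu F b)) -/v.
  elim: (v) vP => [|x w IH] H; first by rewrite big_nil.
  have [x0 /andP[_ x1]] := H x (mem_head _ _).
  rewrite big_cons exprS ler_pM //.
    by rewrite big_seq; apply: prodr_ge0 => y yw; case: (H y (mem_behead (s := x :: w) yw)).
  by apply: IH => y yw; apply: H; rewrite inE yw orbT.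
have betaP b : b \in bs1 -> pr_ev mu F b <= (1 + u) / h.
  by move=> /hpr/andP[_ H]; rewrite ler_pdivlMr // mulrC.
have failP p : p \in primes a -> expo mu F bs1 (fail mu torB F (imF F1) m p) 1%G <=
    geom_tail m * ((1 + u) / h) ^+ (size bs1).-1.
  move=> pin; have /and3P[pp _ pa] : [&& prime p, (0 < a)%N & (p %| a)%N] by rewrite -mem_primes.
  have cod : #|preF mu torB F (imF F1)| = (p ^ (size bs1 + m) * #|expU mu torB F (imF F1) p 1%G|)%N.
    by rewrite -nE; apply: card_expU1.
  apply: le_trans (expo_fail pin (sub1G _) bsH betaP cod) _.
  by rewrite ler_wpM2r ?geom_tailP // exprn_ge0 // divr_ge0 ?addr_ge0 // ltW.
(* The column whose condition was given up in [expo_fail] lacks its factor [1 / h]; this leaves one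
   factor [h <= #|B|]. *)
have bh : h ^- m * ((1 + u) / h) ^+ (size bs1).-1 <= h ^- n * (h * Y).
  rewrite expr_div_n mulrA mulrAC [X in X <= _]mulrC [leRHS]mulrA [leRHS]mulrC.
  have -> : h ^- m * h ^- (size bs1).-1 = h ^- n * h.
    have : h ^+ n = h ^+ m * h ^+ (size bs1).-1 * h.
      by rewrite -mulrA -exprSr prednK // -exprD nE addnC.
    by move=> ->; field; rewrite !expf_neq0 // gt_eqF.
  rewrite ler_wpM2r //; first by rewrite mulr_ge0 ?invr_ge0 ?exprn_ge0 // ltW.
  by rewrite ler_weXn2l ?lerDl //; apply: leq_trans (leq_pred _) sn.
have hm0 : 0 <= h ^- m by rewrite invr_ge0 exprn_ge0 // ltW.
have hn0 : 0 <= h ^- n by rewrite invr_ge0 exprn_ge0 // ltW.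
have hmn : h ^- n * h ^+ m = h ^- size bs1.
  by rewrite nE exprD; field; rewrite !expf_neq0 // gt_eqF.
have g0 : 0 <= geom_tail m.
  by apply: le_trans (geom_tailP m 0); rewrite big_ord0.
move=> main.
have main' : `|hit F F1 - h ^- n * c * W| <= h ^- n * (eps * h ^+ m * W) + bd +
    h ^- n * ((size (primes a))%:R * h * geom_tail m * Y).
  have E1 : h ^- m * c * PP = h ^- n * c * W.
    by rewrite PPE nE exprD; field; rewrite !expf_neq0 // gt_eqF.
  rewrite -E1; apply: le_trans main _; apply: lerD; first apply: lerD => //.
    by rewrite PPE -hmn [leLHS](_ : _ = h ^- n * (eps * h ^+ m * W)) //; ring.
  apply: (@le_trans _ _ (h ^- m * c * \sum_(p <- primes a) geom_tail m * ((1 + u) / h) ^+ (size bs1).-1)).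
    rewrite ler_wpM2l ?mulr_ge0 // !big_seq; apply: ler_sum => p; exact: failP.
  rewrite big_const_seq count_predT iter_addr_0 -[X in _ * X <= _]mulr_natl.
  apply: (@le_trans _ _ ((size (primes a))%:R * geom_tail m * (h ^- m * ((1 + u) / h) ^+ (size bs1).-1))).
    rewrite [leLHS](_ : _ = c * ((size (primes a))%:R * geom_tail m * (h ^- m * ((1 + u) / h) ^+ (size bs1).-1))); last by ring.
    have bh0 : 0 <= ((1 + u) / h) ^+ (size bs1).-1.
      by rewrite exprn_ge0 // divr_ge0 ?addr_ge0 // ltW.
    apply: ler_piMl => //; apply: mulr_ge0; apply: mulr_ge0 => //.
  apply: le_trans (ler_wpM2l _ bh) _; first by rewrite mulr_ge0.
  by rewrite [leLHS](_ : _ = h ^- n * ((size (primes a))%:R * h * geom_tail m * Y)) //; ring.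
have main2 : `|h ^- n * c * W - h ^- n * c| <= h ^- n * ((Y - 1) + n%:R * u).
  rewrite -[X in _ - X]mulr1 -mulrBr normrM ger0_norm ?mulr_ge0 //.
  rewrite -mulrA ler_wpM2l //; apply: (@le_trans _ _ `|W - 1|).
    by rewrite ler_piMl.
  by apply: le_trans near _; rewrite lerD // lerD2r.
apply: le_trans (ler_distD (h ^- n * c * W) _ _) _.
apply: le_trans (lerD main' main2) _.
rewrite /code_err -/u -/N -/Y -/eps.
have t1 : eps * h ^+ m * W <= eps * #|B|%:R ^+ m * Y.
  have hm : h ^+ m <= #|B|%:R ^+ m by rewrite lerXn2r ?nnegrE // ltW.
  apply: ler_pM => //; first by rewrite mulr_ge0 ?exprn_ge0 // ltW.
  exact: ler_wpM2l.
have t2 : (size (primes a))%:R * h * geom_tail m * Y <= (size (primes a))%:R * #|B|%:R * geom_tail m * Y.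
  by rewrite !ler_wpM2r ?(le_trans ler01 Y1) // ler_wpM2l.
have := ler_wpM2l hn0 t1; have := ler_wpM2l hn0 t2.
rewrite !mulrDr; lra.
Qed.

Definition total_err n m s z1 z2 z3 : R :=
  sparse_bound #|B| #|{group B}| n 0 s z1
  + #|{ffun B -> 'Z_a}|%:R * sparse_bound #|pairB a B| #|{group (pairB a B)}| (n - m) m s z2
  + #|{group B}|%:R * z3 ^- (#|B| * s) * ((1 + z3 * #|B|%:R) / 2) ^+ n
  + code_err n m s.

(** Nearly all of the [#|H| ^ n] maps into [H] have image [H] and satisfy [code], and each
    contributes about [cprod R a m / #|H| ^ n]; those outside [code] add little by [sum_noncode]. *)
Lemma sum_hit n m s z1 z2 z3 (H : {group B}) (F1 : {ffun 'I_n -> B}) : (0 < s)%N ->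
  (0 < s %/ (#|B| * a ^ m))%N -> (m + #|B| <= n)%N ->
  0 < z1 <= 1 -> 0 < z2 <= 1 -> 0 < z3 <= 1 -> imF F1 \subset H ->
  `|\sum_(F | imF F == H) hit F F1 - cprod R a m| <= total_err n m s z1 z2 z3.
Proof.
move=> s0 sN mn z1P z2P z3P F1H.
have szv : (m + #|B| <= size (vals F1))%N by rewrite size_vals.
have [bs1 [bs2 [pbs sz2 gen1]]] := split_targets szv.
have nE : n = (size bs1 + m)%N by rewrite -sz2 -size_cat -(perm_size pbs) size_vals.
have B0 : (0 < #|B|)%N by apply/card_gt0P; exists 0.
have bs10 : (0 < size bs1)%N.
  by rewrite -(ltn_add2r m) -nE add0n; apply: leq_trans mn; rewrite -[X in (X < _)%N]addn0 ltn_add2l.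
set h : R := #|H|%:R; set c := cprod R a m.
have h0 : 0 < h by rewrite ltr0n cardG_gt0.
have c0 : 0 <= c := cprod_ge0 R a m; have c1 : c <= 1 := cprod_le1 R a m.
have hn : 0 < h ^+ n by rewrite exprn_gt0.
pose Cn : R := \sum_(F : {ffun 'I_n -> B} | code s F && (imF F == H)) 1.
have cc := code_count n H s0 z3P; rewrite -/h -/Cn in cc.
have Cn1 : Cn <= h ^+ n.
  have -> : h ^+ n = \sum_(F : {ffun 'I_n -> B} | F \in ffun_on (mem H)) 1 :> R.
    by rewrite sumr_const card_ffun_on card_ord natrX.
  rewrite /Cn big_mkcond [leRHS]big_mkcond; apply: ler_sum => F _.
  case: ifP => [/andP[_ /eqP FH]|_]; last by case: ifP.
  suff -> : F \in ffun_on (mem H) by [].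
  by apply/ffun_onP => i; rewrite -FH vals_imF // mem_vals.
have Cn0 : 0 <= Cn by apply: sumr_ge0.
set e3 := _ * _ * _ in cc.
have cnd : 1 - e3 <= h ^- n * Cn.
  rewrite -(ler_pM2l hn) mulrA divff ?mul1r ?gt_eqF //.
  by rewrite mulrBr mulr1 lerBlDr -lerBlDl.
have cnu : h ^- n * Cn <= 1 by rewrite mulrC ler_pdivrMr // mul1r.
have ce0 : 0 <= code_err n m s.
  have u0 : 0 <= #|B|%:R * mix #|B| s by rewrite mulr_ge0 ?mix_ge0.
  have Y1 : 1 <= (1 + #|B|%:R * mix #|B| s) ^+ n by rewrite exprn_ege1 // lerDl.
  have g0 : 0 <= geom_tail m by apply: le_trans (geom_tailP m 0); rewrite big_ord0.
  have Y0 := le_trans ler01 Y1.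
  rewrite /code_err; apply: addr_ge0; first apply: addr_ge0; first apply: addr_ge0; rewrite ?subr_ge0 //.
  - by rewrite mulr_ge0.
  - by repeat (apply: mulr_ge0 => //); rewrite ?mix_ge0 ?exprn_ge0.
  - by repeat (apply: mulr_ge0 => //).
rewrite (bigID (code s)) /=.
set A1 := \sum_(i | _) _; set A2 := \sum_(i | _) _.
have A20 : 0 <= A2 by apply: sumr_ge0 => F _; apply: hit_ge0.
have A2le : A2 <= sparse_bound #|B| #|{group B}| n 0 s z1.
  apply: le_trans (sum_noncode F1 s0 z1P); rewrite /A2 big_mkcondl /=; apply: ler_sum => F _.
  by case: ifP => // _; apply: hit_ge0.
have A1le : `|A1 - h ^- n * Cn * c| <= h ^- n * Cn * code_err n m s +
    #|{ffun B -> 'Z_a}|%:R * sparse_bound #|pairB a B| #|{group (pairB a B)}| (n - m) m s z2.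
  have -> : h ^- n * Cn * c = \sum_(F : {ffun 'I_n -> B} | (imF F == H) && code s F) h ^- n * c.
    rewrite mulrAC mulr_sumr; apply: eq_big => [F|F _]; last by rewrite mulr1.
    by rewrite andbC.
  rewrite /A1 -sumrB; apply: le_trans (ler_norm_sum _ _ _) _.
  have nm : (n - m = size bs1)%N by rewrite nE addnK.
  rewrite nm; apply: le_trans (lerD (lexx _) (sum_bad s0 z2P nE)).
  have -> : h ^- n * Cn * code_err n m s = \sum_(F : {ffun 'I_n -> B} | (imF F == H) && code s F) h ^- n * code_err n m s.
    rewrite mulrAC mulr_sumr; apply: eq_big => [F|F _]; last by rewrite mulr1.
    by rewrite andbC.
  apply: (@le_trans _ _ (\sum_(F : {ffun 'I_n -> B} | (imF F == H) && code s F)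
     (h ^- n * code_err n m s + expo mu F bs1 (bad mu torB F s) 1%G))).
    apply: ler_sum => F /andP[/eqP FH cF].
    have := @hit_code n m s F F1 bs1 bs2 s0 cF _ pbs sz2 gen1 sN bs10.
    by rewrite /h -FH; apply; rewrite FH.
  rewrite big_split /= lerD2l [leLHS]big_mkcond; apply: ler_sum => F _; case: ifP => // _.
  rewrite expo_iexp; apply: iexp_ge0 => [x|xs _]; first exact: colw_ge0.
  by rewrite mulr_ge0.
have d2 : `|h ^- n * Cn * c - c| <= e3.
  have -> : h ^- n * Cn * c - c = - ((1 - h ^- n * Cn) * c) by ring.
  rewrite normrN normrM !ger0_norm ?subr_ge0 //.
  have : 1 - h ^- n * Cn <= e3 by lra.
  by apply: le_trans; rewrite ler_piMr ?subr_ge0.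
have d3 : h ^- n * Cn * code_err n m s <= code_err n m s by rewrite ler_piMl.
rewrite /total_err -/e3.
have -> : A1 + A2 - c = (A1 - h ^- n * Cn * c) + (h ^- n * Cn * c - c) + A2 by ring.
apply: le_trans (ler_normD _ _) _; rewrite (ger0_norm A20).
apply: le_trans (lerD (ler_normD _ _) A2le) _.
have := lerD A1le d2; move: d3; lra.
Qed.

End SumOverHoms.

(** * Asymptotics *)

Section Asymptotics.
Variables (R : realType).
Implicit Types (u v : nat -> R).

Lemma expr1D_le (u : R) n : 0 <= u -> n%:R * u <= 2^-1 -> (1 + u) ^+ n <= 1 + 2 * (n%:R * u).
Proof.
move=> u0; elim: n => [|n IH] nu; first by rewrite expr0 mul0r mulr0 addr0.
have nu' : n%:R * u <= 2^-1 by apply: le_trans nu; rewrite ler_wpM2r // ler_nat.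
rewrite exprSr; apply: le_trans (_ : (1 + 2 * (n%:R * u)) * (1 + u) <= _).
  by rewrite ler_wpM2r ?IH // addr_ge0.
rewrite -natr1 in nu *.
have k0 : 0 <= n%:R * u by rewrite mulr_ge0.
move: nu' k0; set k := n%:R; nra.
Qed.

Lemma mulrn_expr_le (q : R) t : 0 <= q < 1 -> t.+1%:R * q ^+ t <= (1 - q)^-1.
Proof.
case/andP=> q0 q1; have d0 : 0 < 1 - q by rewrite subr_gt0.
rewrite -[leRHS]mul1r ler_pdivlMr //.
apply: (@le_trans _ _ ((\sum_(i < t.+1) q ^+ i) * (1 - q))).
  rewrite ler_wpM2r ?(ltW d0) // mulr_natl -[X in _ *+ X]card_ord -sumr_const.
  by apply: ler_sum => i _; rewrite ler_wiXn2l // ?ltW // -ltnS.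
suff -> : (\sum_(i < t.+1) q ^+ i) * (1 - q) = 1 - q ^+ t.+1.
  by rewrite gerBl exprn_ge0.
elim: t => [|t IH]; first by rewrite big_ord_recl big_ord0 expr0 expr1 addr0 mul1r.
by rewrite big_ord_recr /= mulrDl IH !exprS; ring.
Qed.

(* Split [r = q ^ 4]: two of the four factors absorb [t.+1 ^ 2]. *)
Lemma sqr_expr_le (r : R) t : 0 <= r < 1 ->
  t.+1%:R ^+ 2 * r ^+ t <= (1 - Num.sqrt (Num.sqrt r))^-1 ^+ 2 * Num.sqrt r ^+ t.
Proof.
case/andP=> r0 r1; set p := Num.sqrt r; set q := Num.sqrt p.
have p0 : 0 <= p by apply: sqrtr_ge0. have q0 : 0 <= q by apply: sqrtr_ge0.
have p2 : p ^+ 2 = r by apply: sqr_sqrtr. have q2 : q ^+ 2 = p by apply: sqr_sqrtr.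
have lt1 (x : R) : 0 <= x -> x ^+ 2 < 1 -> x < 1.
  by move=> x0; rewrite expr_lt1.
have q1 : q < 1 by rewrite lt1 // q2 lt1 // p2.
have -> : r ^+ t = (q ^+ t) ^+ 2 * p ^+ t by rewrite -p2 -q2 -!exprM -exprD; congr (_ ^+ _); lia.
rewrite mulrA -exprMn ler_wpM2r ?exprn_ge0 // lerXn2r ?nnegrE ?mulr_ge0 ?exprn_ge0 //.
  by rewrite invr_ge0 subr_ge0 ltW.
by rewrite mulrn_expr_le ?q0.
Qed.

Lemma sqrt_bounds n : (Nat.sqrt n * Nat.sqrt n <= n < (Nat.sqrt n).+1 * (Nat.sqrt n).+1)%N.
Proof.
have [/ssrnat.leP h1 /ssrnat.ltP h2] := Stdlib.Arith.PeanoNat.Nat.sqrt_specif n.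
by apply/andP; split.
Qed.

Local Open Scope classical_set_scope.
Import numFieldNormedType.Exports.

Lemma near_ge (A : nat) : \forall n \near \oo, (A <= n)%N.
Proof. exact: nbhs_infty_ge. Qed.

Lemma sqrt_ge A n : (A * A <= n)%N -> (A <= Nat.sqrt n)%N.
Proof.
move=> An; have /andP[_ h] := sqrt_bounds n; rewrite leqNgt; apply/negP => h'.
have : ((Nat.sqrt n).+1 * (Nat.sqrt n).+1 <= A * A)%N by rewrite leq_mul.
by move=> /leq_trans/(_ An); rewrite leqNgt h.
Qed.

Lemma sqrt_div_cvg L : (0 < L)%N -> (fun n => (Nat.sqrt n %/ L)%N) @ \oo --> \oo.
Proof.
move=> L0; apply/cvgnyPge => A; near=> n.
rewrite leq_divRL //; apply: sqrt_ge; near: n; exact: near_ge.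
Unshelve. all: by end_near. Qed.

Lemma expr_div_cvg (q : R) L : (0 < L)%N -> 0 <= q < 1 ->
  (fun n => q ^+ (Nat.sqrt n %/ L)) @ \oo --> (0 : R).
Proof.
move=> L0 /andP[q0 q1]; apply: (cvg_comp _ _ (sqrt_div_cvg L0)).
by apply: cvg_expr; rewrite ger0_norm.
Qed.

Lemma squeeze0 u v : (\forall n \near \oo, 0 <= u n <= v n) -> v @ \oo --> (0 : R) -> u @ \oo --> (0 : R).
Proof.
move=> uv v0; apply: (squeeze_cvgr uv) => //; exact: cvg_cst.
Qed.

Lemma cvg_near_le u (l e : R) : u @ \oo --> l -> l < e -> \forall n \near \oo, u n <= e.
Proof. by move=> ul le; apply: (cvgr_le _ ul). Qed.

Lemma cvg0Ml u (c : R) : u @ \oo --> (0 : R) -> (fun n => c * u n) @ \oo --> (0 : R).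
Proof. by move=> u0; rewrite -[X in _ --> X](mulr0 c); apply: cvgMr. Qed.

(** With [t = sqrt n %/ L], [n] is at most [L ^ 2 * (t + 1) ^ 2], so a quadratic factor in [t] meets
    a geometric decay in [t]. *)
Lemma natr_expr_cvg (r : R) L : (0 < L)%N -> 0 <= r < 1 ->
  (fun n => n%:R * r ^+ (Nat.sqrt n %/ L)) @ \oo --> (0 : R).
Proof.
move=> L0 r01; have /andP[r0 r1] := r01.
set p := Num.sqrt r; have p0 : 0 <= p by apply: sqrtr_ge0.
have p1 : p < 1.
  by rewrite -(@expr_lt1 _ 2) // sqr_sqrtr.
set K : R := (1 - Num.sqrt p)^-1 ^+ 2.
apply: (@squeeze0 _ (fun n => (L * L)%N%:R * K * p ^+ (Nat.sqrt n %/ L))); last first.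
  rewrite -(mulr0 ((L * L)%N%:R * K)); apply: cvgMr; apply: expr_div_cvg => //.
  by rewrite p0.
apply: nearW => n; set t := (_ %/ L)%N.
rewrite mulr_ge0 ?exprn_ge0 //= -mulrA.
apply: le_trans (_ : (L * L)%N%:R * (t.+1%:R ^+ 2 * r ^+ t) <= _); last first.
  by rewrite ler_wpM2l // sqr_expr_le.
rewrite mulrA ler_wpM2r ?exprn_ge0 // -natrX -natrM ler_nat.
have /andP[_ /ltnW h] := sqrt_bounds n; apply: leq_trans h _.
have h2 : (Nat.sqrt n < t.+1 * L)%N by rewrite ltn_ceil.
rewrite expnS expn1 mulnACA [(L * _)%N]mulnC leq_mul //.
Qed.

(** With [s = sqrt n] and [n >= s * s], the expression is at most [(z ^- C * q ^+ s) ^+ s], whose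
    base is eventually at most [1 / 2]. *)
Lemma invX_expr_cvg (z q : R) C : 0 < z -> 0 <= q < 1 ->
  (fun n => z ^- (C * Nat.sqrt n) * q ^+ n) @ \oo --> (0 : R).
Proof.
move=> z0 /andP[q0 q1].
have h01 : 0 <= (2^-1 : R) < 1 by lra.
apply: squeeze0 (expr_div_cvg (ltn0Sn 0) h01).
have zC : 0 < z ^+ C / 2 by rewrite divr_gt0 ?exprn_gt0.
have qs : (fun n => q ^+ (Nat.sqrt n %/ 1)) @ \oo --> (0 : R) by apply: expr_div_cvg; rewrite ?q0.
near=> n; rewrite divn1.
have le : q ^+ (Nat.sqrt n) <= z ^+ C / 2.
  by near: n; have := cvg_near_le qs zC; apply: filterS => n; rewrite divn1.
rewrite mulr_ge0 ?invr_ge0 ?exprn_ge0 ?(ltW z0) //=.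
have /andP[sn _] := sqrt_bounds n; set s := Nat.sqrt n in le sn *.
apply: le_trans (_ : z ^- (C * s) * (q ^+ s) ^+ s <= _).
  rewrite ler_wpM2l ?invr_ge0 ?exprn_ge0 ?(ltW z0) // -exprM ler_wiXn2l //; exact: ltW.
rewrite exprM -exprVn -exprMn lerXn2r ?nnegrE ?mulr_ge0 ?invr_ge0 ?exprn_ge0 ?(ltW z0) //.
by rewrite ler_pdivrMl ?exprn_gt0.
Unshelve. all: by end_near. Qed.

End Asymptotics.

Section Limits.
Variables (R : realType) (a : nat) (mu : balanced_law R a).
Local Notation rho := (law_rho mu).
Local Notation mix := (mix mu).
Let a_gt1 : (1 < a)%N := law_gt1 mu.
Let a_gt0 : (0 < a)%N := ltnW a_gt1.
Local Open Scope classical_set_scope.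
Import numFieldNormedType.Exports.

Lemma mix_sqrt I N : (0 < N)%N -> exists r L, [/\ (0 < L)%N, 0 <= r < 1 &
  forall n, mix I (Nat.sqrt n %/ N) = r ^+ (Nat.sqrt n %/ L)].
Proof.
move=> N0; exists (1 - mix_eta mu ^+ I), (N * mix_len mu)%N; split.
- by rewrite muln_gt0 N0 mix_len_gt0.
- have /andP[e0 e1] := mix_eta01 mu.
  have eI : 0 < mix_eta mu ^+ I by rewrite exprn_gt0.
  have eI1 : mix_eta mu ^+ I <= 1 by rewrite exprn_ile1 // ltW.
  by rewrite subr_ge0 eI1 /= gtrBl.
- by move=> n; rewrite /mix divnMA.
Qed.

Lemma mix_cvg I N : (0 < N)%N -> (fun n => mix I (Nat.sqrt n %/ N)) @ \oo --> (0 : R).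
Proof. by case/(mix_sqrt I) => r [L [L0 r01 /funext ->]]; apply: expr_div_cvg. Qed.

Lemma natr_mix_cvg I N : (0 < N)%N -> (fun n => n%:R * mix I (Nat.sqrt n %/ N)) @ \oo --> (0 : R).
Proof.
case/(mix_sqrt I) => r [L [L0 r01 E]].
under eq_fun do rewrite E; exact: natr_expr_cvg.
Qed.

Lemma sparse_bound_cvg C g m : (0 < C)%N ->
  exists2 z : R, 0 < z <= 1 & (fun n => sparse_bound mu C g (n - m) m (Nat.sqrt n) z) @ \oo --> (0 : R).
Proof.
move=> C0; have r0 := law_rho_ge0 mu; have r1 := law_rho_lt1 mu.
have C0' : 0 < C%:R :> R by rewrite ltr0n.
have C1 : 1 <= C%:R :> R by rewrite ler1n.
(* This [z] gives [q = (2 - rho) * rho = 1 - (1 - rho) ^ 2 < 1]; the midpoint [p] of [q] and [1]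
   then leaves room for the factor [1 + C * mix]. *)
pose z : R := (1 - rho) / C%:R.
have zC : z * C%:R = 1 - rho by rewrite /z mulfVK // gt_eqF.
have z0 : 0 < z by rewrite divr_gt0 // subr_gt0.
exists z; first by rewrite z0 /= ler_pdivrMr // mul1r; apply: le_trans C1; rewrite gerBl.
pose q := (1 + z * C%:R) * rho.
have q0 : 0 <= q by rewrite /q zC; nra.
have q1 : q < 1 by rewrite /q zC; nra.
pose p := (1 + q) / 2.
have p01 : 0 <= p < 1 by rewrite /p; lra.
have p0 : 0 < p by rewrite /p; lra.
pose K : R := g%:R * ((1 + z * C%:R) * C%:R) ^+ m * p ^- m.
have A0 : 0 <= (1 + z * C%:R) * C%:R by rewrite zC; nra.
apply: (@squeeze0 _ _ (fun n => K * (z ^- (C * Nat.sqrt n) * p ^+ n))); last first.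
  by rewrite -(mulr0 K); apply: cvgMr; apply: invX_expr_cvg.
have e0 : 0 < (1 - q) / 2 by lra.
near=> n.
have mx : C%:R * mix C (Nat.sqrt n) <= (1 - q) / 2.
  near: n; have := cvg_near_le (cvg0Ml C%:R (mix_cvg C (ltn0Sn 0))) e0.
  by apply: filterS => n; rewrite divn1.
have nm : (m <= n)%N by near: n; apply: near_ge.
have mx0 : 0 <= C%:R * mix C (Nat.sqrt n) by rewrite mulr_ge0 ?mix_ge0.
rewrite /sparse_bound -/q; set x := C%:R * mix _ _ in mx mx0 *.
have B0 : 0 <= q * (1 + x) by rewrite mulr_ge0 // addr_ge0.
have Bp : q * (1 + x) <= p by rewrite /p; nra.
have zn : 0 <= z ^- (C * Nat.sqrt n) by rewrite invr_ge0 exprn_ge0 // ltW.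
apply/andP; split.
  by apply: mulr_ge0; [apply: mulr_ge0; [apply: mulr_ge0|apply: exprn_ge0]|apply: exprn_ge0].
rewrite [leRHS](_ : _ = g%:R * z ^- (C * Nat.sqrt n) * ((1 + z * C%:R) * C%:R) ^+ m * p ^+ (n - m)).
  rewrite ler_wpM2l //; last by rewrite lerXn2r ?nnegrE // ltW.
  by apply: mulr_ge0; [apply: mulr_ge0|apply: exprn_ge0].
have -> : p ^+ n = p ^+ (n - m) * p ^+ m by rewrite -exprD subnK.
by rewrite /K; field; rewrite !expf_neq0 // gt_eqF.
Unshelve. all: by end_near. Qed.

Lemma geom_tail_cvg : geom_tail mu @ \oo --> (0 : R).
Proof.
rewrite -(mul0r (1 - rho1 mu)^-1); apply: cvgMl; apply: cvg_expr.
by rewrite ger0_norm ?rho1_ge0 ?rho1_lt1.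
Qed.

Section Group.
Variables (B : finZmodType).

Lemma code_err_cvg m : (fun n => code_err mu B n m (Nat.sqrt n)) @ \oo -->
  (size (primes a))%:R * #|B|%:R * geom_tail mu m.
Proof.
have B0 : (0 < #|B|)%N by apply/card_gt0P; exists 0.
set C := #|B|; set N := (C * a ^ m)%N.
have N0 : (0 < N)%N by rewrite muln_gt0 B0 expn_gt0 a_gt0.
pose u n := C%:R * mix C (Nat.sqrt n).
have nu : (fun n => n%:R * u n) @ \oo --> (0 : R).
  rewrite [X in X @ _](_ : _ = fun n => C%:R * (n%:R * mix C (Nat.sqrt n %/ 1))).
    by apply: cvg0Ml; apply: natr_mix_cvg.
  by apply/funext => n; rewrite divn1 /u mulrCA.
pose Y n := (1 + u n) ^+ n.
have u0 n : 0 <= u n by rewrite mulr_ge0 ?mix_ge0.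
have Y1 : (fun n => Y n - 1) @ \oo --> (0 : R).
  apply: (@squeeze0 _ _ (fun n => 2 * (n%:R * u n))); last exact: cvg0Ml.
  have h0 : 0 < (2^-1 : R) by lra.
  have := cvg_near_le nu h0; apply: filterS => n h.
  rewrite subr_ge0 exprn_ege1 ?lerDl //= lerBlDl; exact: expr1D_le.
have Y2 : Y @ \oo --> (1 : R).
  rewrite [Y](_ : _ = (fun n => (Y n - 1) + 1)); last by apply/funext => n; rewrite subrK.
  by rewrite -[X in _ --> X]add0r; apply: cvgD => //; apply: cvg_cst.
have mN : (fun n => mix N (Nat.sqrt n %/ N)) @ \oo --> (0 : R) by apply: mix_cvg.
set G := _ * _ * _.
have -> : G = 0 + 0 + m%:R * (N%:R * 0) * C%:R ^+ m * 1 + G * 1 by ring.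
rewrite /code_err.
apply: cvgD; first apply: cvgD; first exact: cvgD.
  by apply: cvgM => //; apply: cvgMl; apply: cvgMr; apply: cvgMr.
by apply: cvgMr.
Qed.

Hypothesis torB : forall g : B, g *+ a = 0.
Hypothesis torBp : forall p (g : B), prime p -> (p %| a)%N -> g *+ (a %/ p) = 0.
Local Notation imF := (imF mu torB).
Local Notation hit := (hit mu torB).

(** First [m] is chosen to make the geometric tail and [|c - cprod R a m|] small; all other errors
    vanish as [n] grows. The quantifiers on [H] and [F1] stay inside the neighbourhood:
    [tower_mass_cvg] needs this uniformity. *)
Lemma sum_hit_cvg c e : cprod R a @ \oo --> c -> 0 < e ->
  \forall n \near \oo, forall (H : {group B}) (F1 : {ffun 'I_n -> B}), imF F1 \subset H ->
    `|\sum_(F | imF F == H) hit F F1 - c| <= e.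
Proof.
move=> cc e0.
have B0 : (0 < #|B|)%N by apply/card_gt0P; exists 0.
have P0 : (0 < #|pairB a B|)%N by apply/card_gt0P; exists 0.
have e4 : 0 < e / 4 by rewrite divr_gt0.
set S : R := (size (primes a))%:R * #|B|%:R.
have Gc : (fun m => S * geom_tail mu m) @ \oo --> (0 : R).
  by rewrite -(mulr0 S); apply: cvgMr; apply: geom_tail_cvg.
have [m [Gm cm]] : exists m, S * geom_tail mu m <= e / 4 /\ `|c - cprod R a m| <= e / 4.
  apply: (@filter_ex _ \oo); near=> m; split; near: m.
    exact: cvg_near_le Gc e4.
  by have /cvgrPdist_le/(_ _ e4) := cc.
have [z1 z1P c1] := sparse_bound_cvg #|{group B}| 0 B0.
have [z2 z2P c2] := sparse_bound_cvg #|{group (pairB a B)}| m P0.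
(* Makes [(1 + z3 * #|B|) / 2] equal to [3 / 4]. *)
pose z3 : R := (2 * #|B|%:R)^-1.
have B1 : 1 <= #|B|%:R :> R by rewrite ler1n.
have z30 : 0 < z3 by rewrite invr_gt0; lra.
have z3P : 0 < z3 <= 1 by rewrite z30 invf_le1; lra.
have c3 : (fun n => #|{group B}|%:R * z3 ^- (#|B| * Nat.sqrt n) * ((1 + z3 * #|B|%:R) / 2) ^+ n) @ \oo --> (0 : R).
  under eq_fun do rewrite -mulrA.
  rewrite -(mulr0 #|{group B}|%:R); apply: cvgMr; apply: invX_expr_cvg => //.
  have -> : z3 * #|B|%:R = 2^-1 by rewrite /z3; field; lra.
  lra.
have tot : (fun n => total_err mu B n m (Nat.sqrt n) z1 z2 z3) @ \oo --> S * geom_tail mu m.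
  rewrite -[S * _]add0r -[X in X + _]addr0 -[X in X + _ + _]addr0 -[X in _ + X + _ + _](mulr0 (#|{ffun B -> 'Z_a}|%:R : R)).
  apply: cvgD; last exact: code_err_cvg.
  apply: cvgD => //; apply: cvgD; last by apply: cvgMr.
  by move: c1; under eq_fun do rewrite subn0.
have Ge : S * geom_tail mu m < e / 2 by lra.
near=> n => H F1 F1H.
have t1 : total_err mu B n m (Nat.sqrt n) z1 z2 z3 <= e / 2.
  by near: n; have := cvg_near_le tot Ge.
have := @sum_hit _ _ mu _ torB torBp n m (Nat.sqrt n) z1 z2 z3 H F1 _ _ _ z1P z2P z3P F1H.
move=> /(_ _ _ _)/le_trans h.
apply: le_trans (ler_distD (cprod R a m) _ _) _.
have h1 : `|\sum_(F | imF F == H) hit F F1 - cprod R a m| <= e / 2.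
  apply: h t1.
  - apply: sqrt_ge; near: n; exact: near_ge.
  - rewrite divn_gt0 ?muln_gt0 ?B0 ?expn_gt0 ?a_gt0 //; apply: sqrt_ge; near: n; exact: near_ge.
  - near: n; exact: near_ge.
rewrite distrC in cm; lra.
Unshelve. all: by end_near. Qed.

(** A first-moment bound without the condition on kernels, used for singular matrices. The [F]
    satisfying [code] number at most [#|H| ^ n], have probability about [#|H| ^- n] each, and
    contribute at most [3 / 2]; the others at most [1 / 2]. *)
Lemma sum_pr_le : \forall n \near \oo, forall (H : {group B}) (F1 : {ffun 'I_n -> B}), imF F1 \subset H ->
    \sum_(F : {ffun 'I_n -> B} | imF F == H) \prod_(b <- vals F1) pr_ev mu F b <= 2.
Proof.
have B0 : (0 < #|B|)%N by apply/card_gt0P; exists 0.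
have [z1 z1P c1] := sparse_bound_cvg #|{group B}| 0 B0.
have nu := natr_mix_cvg #|B| (ltn0Sn 0).
have {}nu := cvg0Ml #|B|%:R nu.
have h2 : 0 < (2^-1 : R) by lra. have h4 : 0 < (4^-1 : R) by lra.
near=> n => H F1 F1H.
have s0 : (0 < Nat.sqrt n)%N by apply: sqrt_ge; near: n; exact: near_ge.
have sp : sparse_bound mu #|B| #|{group B}| n 0 (Nat.sqrt n) z1 <= 2^-1.
  by near: n; have := cvg_near_le c1 h2; apply: filterS => n; rewrite subn0.
have us : #|B|%:R * (n%:R * mix #|B| (Nat.sqrt n)) <= 4^-1.
  by near: n; have := cvg_near_le nu h4; apply: filterS => n; rewrite divn1.
rewrite (bigID (code (Nat.sqrt n))) /=.
have noncode : \sum_(F : {ffun 'I_n -> B} | (imF F == H) && ~~ code (Nat.sqrt n) F) \prod_(b <- vals F1) pr_ev mu F b <= 2^-1.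
  apply: le_trans sp.
  have e : n = (size (vals F1) + 0)%N by rewrite size_vals addn0.
  have := sparse_sum_le mu torB s0 z1P e; rewrite size_vals -/(sparse_bound _ _ _ _ _ _ _).
  apply: le_trans; rewrite big_mkcond [leRHS]big_mkcond; apply: ler_sum => F _.
  have pp : 0 <= \prod_(b <- vals F1) pr_ev mu F b by apply: prodr_ge0 => b _; apply: pr_ev_ge0.
  rewrite /code -has_predC; case: ifP => [/andP[_ h]|_].
    by rewrite (eq_has (a2 := predC (fun g => g \in heavy (Nat.sqrt n) (vals F)))) // h; under eq_bigr do rewrite pr_evE.
  by case: ifP => // _; apply: prodr_ge0 => b _; apply: walk_ge0.
set u := #|B|%:R * mix #|B| (Nat.sqrt n).
have u0 : 0 <= u by rewrite mulr_ge0 ?mix_ge0.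
have nu4 : n%:R * u <= 4^-1 by rewrite /u mulrCA.
have h0 : 0 < #|H|%:R :> R by rewrite ltr0n cardG_gt0.
have code1 : \sum_(F : {ffun 'I_n -> B} | (imF F == H) && code (Nat.sqrt n) F) \prod_(b <- vals F1) pr_ev mu F b <=
   \sum_(F : {ffun 'I_n -> B} | F \in ffun_on (mem H)) (#|H|%:R^-1 * (1 + u)) ^+ n.
  rewrite big_mkcond [leRHS]big_mkcond; apply: ler_sum => F _.
  have nn : 0 <= (#|H|%:R^-1 * (1 + u)) ^+ n by rewrite exprn_ge0 // mulr_ge0 ?addr_ge0 // invr_ge0 ltW.
  case: ifP => [/andP[/eqP FH cF]|_]; last by case: ifP.
  have -> : F \in ffun_on (mem H) by apply/ffun_onP => i; rewrite -FH vals_imF // mem_vals.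
  have bnd b : b \in vals F1 -> 0 <= pr_ev mu F b <= #|H|%:R^-1 * (1 + u).
    move=> bF; have bH : b \in imF F by rewrite FH (fintype.subsetP F1H) // vals_imF.
    have := pr_ev_code s0 cF bH; rewrite ler_distl pr_ev_ge0 FH => /andP[_ h] /=.
    apply: le_trans h _; rewrite mulrDr mulr1 lerD2l /u mulrA.
    rewrite -[leLHS]mul1r ler_wpM2r ?mix_ge0 // mulrC ler_pdivlMr // mul1r ler_nat.
    exact: max_card.
  rewrite -[X in _ ^+ X](size_vals F1).
  elim: (vals F1) bnd => [|b s' IH] bnd; first by rewrite big_nil.
  have /andP[b0 b1] := bnd b (mem_head _ _).
  rewrite big_cons exprS ler_pM //.
    by rewrite big_seq; apply: prodr_ge0 => x xs; have /andP[] := bnd x (mem_behead (s := b :: s') xs).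
  by apply: IH => x xs; apply: bnd; rewrite inE xs orbT.
have tot : \sum_(F : {ffun 'I_n -> B} | F \in ffun_on (mem H)) (#|H|%:R^-1 * (1 + u)) ^+ n <= 1 + 2^-1.
  rewrite sumr_const card_ffun_on card_ord -[leLHS]mulr_natl natrX -exprMn mulrA divff ?gt_eqF // mul1r.
  apply: le_trans (expr1D_le u0 _) _; lra.
lra.
Unshelve. all: by end_near. Qed.

End Group.
End Limits.

(** * Iteration over the [k] matrices and chains of images *)

Fixpoint chain_count (G : finGroupType) k (H : {group G}) : nat :=
  if k is k'.+1 then \sum_(H' : {group G} | H' \subset H) chain_count k' H' else (H == 1%G).

Section Towers.
Variables (R : realType) (a : nat) (mu : balanced_law R a).
Local Notation "''V_' n" := ('cV['Z_a]_n : finZmodType) (at level 8, n at level 2).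
Let a_gt1 : (1 < a)%N := law_gt1 mu.
Let a_gt0 : (0 < a)%N := ltnW a_gt1.
Variable (B : finZmodType).
Hypothesis torB : forall g : B, g *+ a = 0.
Local Notation kerF := (kerF mu torB).
Local Notation imF := (imF mu torB).
Local Notation hit := (hit mu torB).

(* By [tower_okE], this says that the kernel of [F] is the column span of the
   product of the matrices [Ms]. *)
Fixpoint tower_ok n (F : {ffun 'I_n -> B}) (Ms : seq 'M['Z_a]_n) : bool :=
  if Ms is M :: Ms' then (kerF F \subset colspan M) && tower_ok (act F M) Ms'
  else F == [ffun=> 0].

Definition tower n k (F : {ffun 'I_n -> B}) : R :=
  iexp (@mxw R a mu n) k (fun Ms => (tower_ok F Ms)%:R).

Lemma towerS n k (F : {ffun 'I_n -> B}) :
  tower k.+1 F = \sum_F1 hit F F1 * tower k F1.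
Proof.
under eq_bigr => F1 _ do rewrite mulr_suml.
rewrite exchange_big /=; apply: eq_bigr => M _.
rewrite (bigD1 (act F M)) //= eqxx big1 ?addr0 => [|F1 F1M]; last first.
  by rewrite eq_sym (negbTE F1M) mulr0 mul0r.
rewrite -mulrA; congr (_ * _); rewrite /tower -iexpZ; apply: eq_iexp => s _ /=.
by rewrite -natrM mulnb.
Qed.

Lemma tower_ge0 n k (F : {ffun 'I_n -> B}) : 0 <= tower k F.
Proof.
apply: iexp_ge0 => // M; by apply: prodr_ge0 => j _; apply: colw_ge0.
Qed.

Lemma act_imF n (F : {ffun 'I_n -> B}) (M : 'M['Z_a]_n) : imF (act F M) \subset imF F.
Proof. by rewrite imF_sub; apply/forallP => i; rewrite ffunE ev_imF. Qed.

Lemma hit_eq0 n (F F1 : {ffun 'I_n -> B}) : ~~ (imF F1 \subset imF F) -> hit F F1 = 0.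
Proof.
move=> h; apply: big1 => M _; case: eqP => [E|_]; last by rewrite mulr0.
by case/negP: h; rewrite -E act_imF.
Qed.

Definition tower_mass n k (H : {group B}) : R :=
  \sum_(F : {ffun 'I_n -> B} | imF F == H) tower k F.

Lemma tower_mass0 n (H : {group B}) : tower_mass n 0 H = (chain_count 0 H)%:R.
Proof.
have F0 : imF ([ffun=> 0] : {ffun 'I_n -> B}) = 1%G.
  have h : imF ([ffun=> 0] : {ffun 'I_n -> B}) \subset (1%G : {group B}).
    by rewrite imF_sub; apply/forallP => i; rewrite ffunE group1.
  by apply/val_inj/eqP; rewrite finset.eqEsubset h sub1G.
rewrite /tower_mass big_mkcond (bigD1 [ffun=> 0]) //= F0 eq_sym big1 => [|F Fn].
  by rewrite addr0 /tower /= eqxx; case: eqP.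
by rewrite /tower /= (negbTE Fn); case: ifP.
Qed.

Lemma tower_massS n k (H : {group B}) :
  tower_mass n k.+1 H = \sum_(H' : {group B} | H' \subset H)
     \sum_(F1 : {ffun 'I_n -> B} | imF F1 == H') (\sum_(F | imF F == H) hit F F1) * tower k F1.
Proof.
rewrite /tower_mass; under eq_bigr => F _ do rewrite towerS.
rewrite exchange_big /= (bigID (fun F1 : {ffun 'I_n -> B} => imF F1 \subset H)) /= [X in _ + X]big1 ?addr0.
  rewrite (partition_big (fun F1 : {ffun 'I_n -> B} => imF F1) (fun H' : {group B} => H' \subset H)) //=.
  apply: eq_bigr => H' H'H; apply: eq_big => [F1|F1 _]; last by rewrite mulr_suml.
  by apply/idP/idP => [/andP[]//|FE]; rewrite FE andbT; have := H'H; rewrite -(eqP FE).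
by move=> F1 F1H; apply: big1 => F /eqP FH; rewrite hit_eq0 ?mul0r // FH.
Qed.

Hypothesis torBp : forall p (g : B), prime p -> (p %| a)%N -> g *+ (a %/ p) = 0.
Local Open Scope classical_set_scope.
Import numFieldNormedType.Exports.

Lemma cvg_bigsum (I : finType) (P : pred I) (f : I -> nat -> R) (l : I -> R) :
  (forall i, f i @ \oo --> l i) -> (fun n => \sum_(i | P i) f i n) @ \oo --> \sum_(i | P i) l i.
Proof.
move=> fl; rewrite unlock /reducebig; elim: (index_enum I) => [|i s IH] /=; first exact: cvg_cst.
by case: (P i) => //=; apply: cvgD.
Qed.

(** In [tower_massS] the inner sum is replaced by [c] uniformly in [F1], so the error is a small
    constant times the total mass over the subgroups of [H]. That mass converges to [L] by
    induction, hence is eventually at most [|L| + 1]. *)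
Lemma tower_mass_cvg (c : R) k (H : {group B}) : cprod R a @ \oo --> c ->
  (fun n => tower_mass n k H) @ \oo --> c ^+ k * (chain_count k H)%:R.
Proof.
move=> cc; elim: k H => [|k IH] H.
  under eq_fun do rewrite tower_mass0; rewrite mul1r; exact: cvg_cst.
pose L : R := \sum_(H' : {group B} | H' \subset H) c ^+ k * (chain_count k H')%:R.
have gL : (fun n => \sum_(H' : {group B} | H' \subset H) tower_mass n k H') @ \oo --> L.
  exact: cvg_bigsum.
have -> : c ^+ k.+1 * (chain_count k.+1 H)%:R = c * L.
  by rewrite exprS -mulrA /= natr_sum mulr_sumr; congr (_ * _).
apply/cvgrPdist_le => e e0.
have cg : (fun n => c * \sum_(H' : {group B} | H' \subset H) tower_mass n k H') @ \oo --> c * L by exact: cvgMr.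
have e2 : 0 < e / 2 by rewrite divr_gt0.
have LL : 0 < `|L| + 1 by rewrite ltr_wpDl.
have eL : 0 < e / 2 / (`|L| + 1) by rewrite divr_gt0.
have hit_near := sum_hit_cvg mu torB torBp cc eL.
have L1 : L < `|L| + 1 by rewrite (le_lt_trans (ler_norm _)) // ltrDl.
near=> n.
have h1 : `|c * L - c * \sum_(H' : {group B} | H' \subset H) tower_mass n k H'| <= e / 2.
  by near: n; have /cvgrPdist_le/(_ _ e2) := cg.
apply: le_trans (ler_distD (c * \sum_(H' : {group B} | H' \subset H) tower_mass n k H') _ _) _.
have h2 : \sum_(H' : {group B} | H' \subset H) tower_mass n k H' <= `|L| + 1.
  by near: n; apply: cvg_near_le gL L1.
rewrite [X in _ <= X](splitr e); apply: lerD => //.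
rewrite tower_massS mulr_sumr -sumrB.
apply: (@le_trans _ _ (\sum_(H' : {group B} | H' \subset H) e / 2 / (`|L| + 1) * tower_mass n k H')).
  apply: le_trans (ler_norm_sum _ _ _) _; apply: ler_sum => H' H'H.
  rewrite /tower_mass !mulr_sumr -sumrB; apply: le_trans (ler_norm_sum _ _ _) _; apply: ler_sum => F1 /eqP F1H.
  rewrite -mulrBl normrM (ger0_norm (tower_ge0 _ _)) ler_wpM2r ?tower_ge0 // distrC.
  have : imF F1 \subset H by rewrite F1H.
  by move: (H) (F1); near: n.
rewrite -mulr_sumr -[leRHS](@divfK _ (`|L| + 1)) ?gt_eqF // ler_wpM2l //; exact: ltW.
Unshelve. all: by end_near. Qed.

End Towers.

Section ChainCount.
Variable B : finZmodType.
Let chain_to (k : nat) (H : {group B}) : {set {ffun 'I_k.+1 -> {group B}}} :=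
  [set G : {ffun 'I_k.+1 -> {group B}} |
    [&& G ord0 == 1%G, G ord_max == H
      & [forall i : 'I_k, G (widen_ord (leqnSn k) i) \subset G (lift ord0 i)]]].

(** Removing the top group leaves a chain ending at a subgroup of [H], which is the recursion of
    [chain_count]. *)
Lemma card_chain_to k H : #|chain_to k H| = chain_count k H.
Proof.
elim: k H => [|k IH] H /=.
  have oE (i : 'I_1) : i = ord0 by apply: ord1.
  have -> : chain_to 0 H = if H == 1%G then [set [ffun=> 1%G]] else set0.
    apply/setP => G; rewrite inE (oE ord_max).
    have -> : [forall i : 'I_0, G (widen_ord (leqnSn 0) i) \subset G (lift ord0 i)] by apply/forallP => -[].
    rewrite andbT; case: (H =P 1%G) => [-> | nH].
      rewrite !inE andbb; apply/eqP/eqP => [E|->]; last by rewrite ffunE.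
      by apply/ffunP => i; rewrite (oE i) ffunE.
    by rewrite inE; apply/negP => /andP[/eqP-> /eqP]; apply: nesym.
  by case: eqP => _; rewrite ?cards1 ?cards0.
pose last2 (G : {ffun 'I_k.+2 -> {group B}}) := G (widen_ord (leqnSn k.+1) ord_max).
rewrite -sum1_card (partition_big last2 (fun H' : {group B} => H' \subset H)) /=; last first.
  move=> G; rewrite inE => /and3P[_ /eqP <- /forallP/(_ ord_max)].
  by congr (_ \subset G _); apply: val_inj.
apply: eq_bigr => H' H'H; rewrite -IH -sum1_card.
pose ext (G : {ffun 'I_k.+1 -> {group B}}) : {ffun 'I_k.+2 -> {group B}} :=
  [ffun i => if unlift ord_max i is Some j then G j else H].
pose res (G : {ffun 'I_k.+2 -> {group B}}) : {ffun 'I_k.+1 -> {group B}} :=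
  [ffun i => G (widen_ord (leqnSn k.+1) i)].
have wE (i : 'I_k.+1) : widen_ord (leqnSn k.+1) i = lift ord_max i.
  by apply: val_inj; rewrite /= /bump leqNgt ltn_ord.
have extw G i : ext G (widen_ord (leqnSn k.+1) i) = G i by rewrite ffunE wE liftK.
have extm G : ext G ord_max = H by rewrite ffunE unlift_none.
rewrite (reindex_onto ext res) /=; last first.
  move=> G /andP[]; rewrite inE => /and3P[_ /eqP GH _] _; apply/ffunP => i; rewrite ffunE.
  by case: unliftP => [j ->|->] //; rewrite ffunE wE.
apply: eq_bigl => G; rewrite !inE.
have -> : res (ext G) = G by apply/ffunP => i; rewrite ffunE extw.
rewrite eqxx andbT /last2 extw extm eqxx /=.
have -> : ext G ord0 = G ord0 by rewrite -(extw G); congr (ext G _); apply: val_inj.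
case: (G ord0 == 1%G) => //=; rewrite andbC; case: eqP => //= GH.
have l0 (i : 'I_k) : lift ord0 (widen_ord (leqnSn k) i) = widen_ord (leqnSn k.+1) (lift ord0 i) by apply: val_inj.
apply/forallP/forallP => h i.
  by have := h (widen_ord (leqnSn k) i); rewrite l0 !extw.
case: (unliftP ord_max i) => [j iE|->]; last first.
  have -> : lift ord0 ord_max = ord_max :> 'I_k.+2 by apply: val_inj.
  by rewrite extw extm GH.
have -> : i = widen_ord (leqnSn k) j.
  by apply: val_inj; rewrite iE /= /bump leqNgt ltn_ord.
by rewrite l0 !extw; apply: h.
Qed.

Lemma card_subgroup_chains k : #|subgroup_chains B k| = chain_count k [set: B]%G.
Proof. exact: card_chain_to. Qed.

End ChainCount.

Lemma scalemx_inj (K : idomainType) m n (c : K) (A A' : 'M[K]_(m, n)) : c != 0 ->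
  c *: A = c *: A' -> A = A'.
Proof.
move=> c0 /matrixP E; apply/matrixP => i j.
by have := E i j; rewrite !mxE => /(mulfI c0).
Qed.

(** Since [d != 0], [M] is invertible over the fraction field, where one-sided inverses are
    two-sided; the adjugate keeps the argument over [K]. *)
Lemma mulmx_scalarC (K : idomainType) n (M Y : 'M[K]_n) (d : K) : d != 0 ->
  M *m Y = d%:M -> Y *m M = d%:M.
Proof.
move=> d0 MY.
have M0 : \det M != 0.
  apply: contraNneq (expf_neq0 n d0) => M0.
  by rewrite -det_scalar -MY det_mulmx M0 mul0r.
apply: (scalemx_inj M0); rewrite -mul_scalar_mx -mul_adj_mx -!mulmxA (mulmxA M) MY.
by rewrite mul_scalar_mx -scalemxAr mul_adj_mx !scale_scalar_mx mulrC.
Qed.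

Lemma eq_group (G : finGroupType) (K L : {group G}) : K =i L -> K = L.
Proof. by move=> KL; apply/val_inj/setP. Qed.

Lemma intr_Zp_eq0 a (x : int) : (1 < a)%N -> ((x%:~R : 'Z_a) == 0) = (a %| x)%Z.
Proof.
move=> a1; have E (m : nat) : ((m%:R : 'Z_a) == 0) = (a %| m)%N.
  by rewrite -(inj_eq val_inj) /= val_Zp_nat.
case: x => m; first by rewrite -pmulrn E.
by rewrite NegzE mulrNz oppr_eq0 -pmulrn E dvdzE abszN.
Qed.

Lemma intr_Zp_unit a (x : int) : (1 < a)%N -> coprime `|x| a -> (x%:~R : 'Z_a) \is a GRing.unit.
Proof.
move=> a1 xa; rewrite [x]intEsign rmorphM /= rmorphXn /= rmorphN1.
by rewrite unitrM unitrX ?unitrN1 // unitZpE // coprime_sym.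
Qed.

Lemma dvdzE_mul (a : nat) (x : int) : (a %| x)%Z -> x = a%:Z * (x %/ a)%Z.
Proof. by move=> /divzK; rewrite mulrC. Qed.

(** * Products of matrices and cokernels *)

Section Lattice.
Variables (a : nat).
Hypothesis a_gt1 : (1 < a)%N.
Local Notation "''V_' n" := ('cV['Z_a]_n : finZmodType) (at level 8, n at level 2).
Let a_gt0 : (0 < a)%N := ltnW a_gt1.

Definition redmx m n (M : 'M[int]_(m, n)) : 'M['Z_a]_(m, n) := map_mx intr M.
Definition liftmx m n (M : 'M['Z_a]_(m, n)) : 'M[int]_(m, n) := map_mx (fun x : 'Z_a => (x : nat)%:Z) M.

Lemma liftmxK m n (M : 'M['Z_a]_(m, n)) : redmx (liftmx M) = M.
Proof.
apply/matrixP => i j; rewrite !mxE -pmulrn.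
by apply: val_inj; rewrite /= val_Zp_nat // modn_small // -[X in (_ < X)%N](Zp_cast a_gt1) ltn_ord.
Qed.

Lemma redmxM m n p (M : 'M[int]_(m, n)) (N : 'M[int]_(n, p)) : redmx (M *m N) = redmx M *m redmx N.
Proof. exact: map_mxM. Qed.

Lemma redmxP m n (M : 'M[int]_(m, n)) : redmx M = 0 -> exists Z, M = a%:Z *: Z.
Proof.
move=> /matrixP M0; exists (map_mx (fun x => (x %/ a)%Z) M); apply/matrixP => i j; rewrite !mxE.
by apply: dvdzE_mul; rewrite -intr_Zp_eq0 //; have := M0 i j; rewrite !mxE => ->.
Qed.

Lemma mulmx_col_sum n (M : 'M['Z_a]_n) (x : 'V_n) : M *m x = \sum_j col j M *+ x j 0.
Proof.
apply/matrixP => i k; rewrite !mxE (ord1 k) summxE; apply: eq_bigr => j _.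
by rewrite mulmxnE mxE -mulr_natr -[in LHS](natr_Zp (x j 0)).
Qed.

Lemma colspanP n (M : 'M['Z_a]_n) (v : 'V_n) : reflect (exists x, v = M *m x) (v \in colspan M).
Proof.
apply: (iffP idP) => [|[x ->]]; last first.
  rewrite mulmx_col_sum; apply: (big_ind (fun v : 'V_n => v \in colspan M)); first exact: group0.
    by move=> u w; apply: groupD.
  by move=> j _; apply: groupMn; apply: mem_adjoin; apply: map_f; rewrite mem_enum.
have gK : group_set [set u : 'V_n | `[< exists x : 'cV['Z_a]_n, u = M *m x >]].
  apply/group_setP; split; first by rewrite inE; apply/asboolP; exists 0; rewrite mulmx0.
  move=> u w; rewrite !inE => /asboolP[x ->] /asboolP[y ->]; apply/asboolP.
  by exists (x + y); rewrite FinRing.zmodMgE mulmxDr.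
have sub : colspan M \subset Group gK.
  rewrite adjoin_sub sub1G /=; apply/allP => _ /mapP[j _ ->].
  by rewrite inE; apply/asboolP; exists (delta_mx j 0); rewrite -colE.
by move/(fintype.subsetP sub); rewrite inE => /asboolP.
Qed.

(* Over the integers, [M N X = b + a Z = b (1 + Q Z)], and the determinant of
   [1 + Q Z] is prime to [a]; hence [Y := N X adj(1 + Q Z)] satisfies
   [M Y = Y M = b * delta] with [delta] prime to [a]. *)
Lemma ker_sub_im n (M N : 'M['Z_a]_n) (Q b : nat) : a = (Q * b)%N ->
  (forall p, prime p -> (p %| a)%N -> (p %| Q)%N) ->
  (forall v : 'V_n, exists x : 'V_n, v *+ b = M *m N *m x) ->
  forall v : 'V_n, M *m v = 0 -> exists x : 'V_n, v = N *m x.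
Proof.
move=> aE Qp bV v Mv.
have b0 : (0 < b)%N by move: a_gt0; rewrite aE muln_gt0 => /andP[].
have Q1 : (1 < Q)%N.
  have pp := pdiv_prime a_gt1; apply: leq_trans (prime_gt1 pp) _.
  by apply: dvdn_leq; [move: a_gt0; rewrite aE muln_gt0 => /andP[]|apply: Qp; rewrite ?pdiv_dvd].
have [X XE] : exists X, M *m N *m X = (b%:R)%:M.
  have [f fE] := choice bV.
  exists (\matrix_(i, j) f (delta_mx j 0 : 'V_n) i 0); apply/matrixP => i j.
  have := congr1 (fun u : 'V_n => u i 0) (fE (delta_mx j 0)).
  rewrite mulmxnE !mxE => E; transitivity (((i == j) && true)%:R *+ b : 'Z_a).
    by rewrite E; apply: eq_bigr => l _; rewrite !mxE.
  by rewrite andbT -mulrnA mulnC mulrnA.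
set M' := liftmx M; set N' := liftmx N; set X' := liftmx X.
have : redmx (M' *m N' *m X' - (b%:Z)%:M) = 0.
  rewrite /redmx map_mxB -!/(redmx _) !redmxM !liftmxK XE /redmx map_scalar_mx /=.
  by rewrite -pmulrn subrr.
case/redmxP => Z ZE.
set E := 1%:M + Q%:Z *: Z.
have MNX : M' *m N' *m X' = b%:Z *: E.
  rewrite -[LHS](subrK (b%:Z)%:M) ZE /E scalerDr scalerA -PoszM scale_scalar_mx mulr1 addrC.
  by rewrite aE mulnC.
set dl := \det E.
(* A prime dividing [a] divides [Q] by hypothesis, and [\det E] is 1 modulo [Q]. *)
have cop : coprime `|dl| a.
  apply/negPn/negP => /eqP nc.
  have g1 : (1 < gcdn `|dl| a)%N.
    by move: nc; have := gcdn_gt0 `|dl| a; rewrite a_gt0 orbT; case: (gcdn _ _) => [|[|?]].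
  set p := pdiv (gcdn `|dl| a); have pp : prime p := pdiv_prime g1.
  have pg : (p %| gcdn `|dl| a)%N := pdiv_dvd _.
  move: pg; rewrite dvdn_gcd => /andP[pd pa].
  have pQ := Qp _ pp pa.
  have : (dl - 1)%:~R = 0 :> 'Z_Q.
    rewrite rmorphB /= /dl -det_map_mx /E map_mxD map_scalar_mx /= map_mxZ /=.
    have -> : Q%:~R = 0 :> 'Z_Q by apply/eqP; rewrite intr_Zp_eq0.
    by rewrite scale0r addr0 det1 subrr.
  move/eqP; rewrite intr_Zp_eq0 // => QD.
  have pD : (p%:Z %| dl - 1)%Z by apply: dvdz_trans QD; rewrite dvdzE.
  have : (p%:Z %| 1)%Z.
    by rewrite -[X in (_ %| X)%Z](subKr dl); apply: rpredB => //; rewrite dvdzE.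
  by rewrite dvdzE /= dvdn1 => /eqP p1; rewrite p1 in pp.
have dl0 : dl != 0 by apply: contraTneq cop => ->; rewrite /coprime gcd0n neq_ltn a_gt1 orbT.
set Y := N' *m X' *m \adj E.
have MY : M' *m Y = (b%:Z * dl)%:M.
  by rewrite /Y !mulmxA MNX -scalemxAl mul_mx_adj scale_scalar_mx.
have bz : b%:Z != 0 by rewrite eqz_nat -lt0n.
have YM := mulmx_scalarC (mulf_neq0 bz dl0) MY.
have : redmx (M' *m liftmx v) = 0 by rewrite redmxM !liftmxK.
case/redmxP => u uE.
(* From [M v = a u] and [Y M = b * dl] follows [b * dl * v = a * Y u]; cancelling [b] leaves
   [Q * Y u], and [Y] has [N] as its left factor. *)
have key : dl *: liftmx v = N' *m (Q%:Z *: (X' *m \adj E *m u)).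
  apply: (scalemx_inj bz).
  have -> : b%:Z *: (dl *: liftmx v) = Y *m M' *m liftmx v by rewrite YM mul_scalar_mx scalerA.
  rewrite -mulmxA uE -!scalemxAr scalerA -PoszM mulnC -aE.
  by rewrite /Y !mulmxA.
have := congr1 (@redmx _ _) key; rewrite redmxM liftmxK {1}/redmx map_mxZ -/(redmx _) liftmxK => Ev.
have dlu : (dl%:~R : 'Z_a) \is a GRing.unit.
  exact: intr_Zp_unit.
exists ((dl%:~R)^-1 *: redmx (Q%:Z *: (X' *m \adj E *m u))).
by rewrite -scalemxAr -Ev scalerA mulVr ?scale1r.
Qed.

End Lattice.

Section LatticeHom.
Variables (R : realType) (a : nat) (mu : balanced_law R a).
Let a_gt1 : (1 < a)%N := law_gt1 mu.
Local Notation "''V_' n" := ('cV['Z_a]_n : finZmodType) (at level 8, n at level 2).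
Variable (B : finZmodType).
Hypothesis torB : forall g : B, g *+ a = 0.
Local Notation kerF := (kerF mu torB).
Local Notation imF := (imF mu torB).

Lemma ev_sum n (F : {ffun 'I_n -> B}) (I : Type) (s : seq I) (f : I -> 'V_n) :
  ev F (\sum_(i <- s) f i) = \sum_(i <- s) ev F (f i).
Proof.
elim: s => [|i s IH]; first by rewrite !big_nil (ev0 mu torB).
by rewrite !big_cons (evD mu torB) IH.
Qed.

Lemma ev_act n (F : {ffun 'I_n -> B}) (M : 'M['Z_a]_n) (x : 'V_n) : ev (act F M) x = ev F (M *m x).
Proof.
rewrite mulmx_col_sum ev_sum; apply: eq_bigr => j _.
by rewrite (evMn mu torB) ffunE.
Qed.

Section Level.
Variables (Q b : nat).
Hypothesis aE : a = (Q * b)%N.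
Hypothesis Qp : forall p, prime p -> (p %| a)%N -> (p %| Q)%N.
Hypothesis torb : forall g : B, g *+ b = 0.

Lemma ker_colspanM n (F : {ffun 'I_n -> B}) (M N : 'M['Z_a]_n) :
  (kerF F == colspan (M *m N)) = (kerF F \subset colspan M) && (kerF (act F M) == colspan N).
Proof.
apply/eqP/andP => [kE|[kM /eqP kN]].
  have sub : kerF F \subset colspan M.
    apply/fintype.subsetP => v; rewrite kE => /colspanP[x ->].
    by apply/colspanP; exists (N *m x); rewrite mulmxA.
  split => //; apply/eqP; apply: eq_group => v.
  rewrite mem_kerF ev_act; apply/eqP/idP => [Fv|].
    have : M *m v \in kerF F by rewrite mem_kerF Fv.
    rewrite kE => /colspanP[x xE].
    (* The vectors [v] and [N x] agree only after applying [M]. As [b] kills [B], the image of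
       [M N], which is [kerF F], contains all multiples of [b], and [ker_sub_im] puts their
       difference in the image of [N]. *)
    have MD : M *m (v - N *m x) = 0 by rewrite mulmxBr xE mulmxA subrr.
    have bV (u : 'V_n) : exists y : 'V_n, u *+ b = M *m N *m y.
      by apply/colspanP; rewrite -kE mem_kerF (evMn mu torB) torb.
    have [y yE] := ker_sub_im a_gt1 aE Qp bV MD.
    by apply/colspanP; exists (y + x); rewrite mulmxDr -yE subrK.
  move=> /colspanP[x ->]; apply/eqP.
  have : M *m N *m x \in colspan (M *m N) by apply/colspanP; exists x.
  by rewrite -kE mem_kerF mulmxA.
apply: eq_group => v; apply/idP/idP => [vk|].
  have /colspanP[w wE] := fintype.subsetP kM _ vk.
  have : w \in kerF (act F M) by rewrite mem_kerF ev_act -wE -(mem_kerF mu torB).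
  rewrite kN => /colspanP[x xE]; apply/colspanP; exists x.
  by rewrite wE xE mulmxA.
move=> /colspanP[x ->].
have : N *m x \in kerF (act F M) by rewrite kN; apply/colspanP; exists x.
by rewrite !mem_kerF ev_act mulmxA.
Qed.

Lemma tower_okE n (F : {ffun 'I_n -> B}) (Ms : seq 'M['Z_a]_n) :
  tower_ok mu torB F Ms = (kerF F == colspan (foldr mulmx 1%:M Ms)).
Proof.
elim: Ms F => [|M Ms IH] F /=; last by rewrite ker_colspanM IH.
have c1 : colspan (1%:M : 'M['Z_a]_n) = [set: 'V_n]%G.
  by apply: eq_group => v; rewrite inE; apply/colspanP; exists v; rewrite mul1mx.
rewrite c1; apply/eqP/eqP => [->|kE].
  apply: eq_group => v; rewrite (mem_kerF mu torB) [RHS]inE.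
  by rewrite /ev big1 ?eqxx // => i _; rewrite ffunE mul0rn.
apply/ffunP => i; rewrite ffunE -(ev_unitv mu F i); apply/eqP.
by rewrite -(mem_kerF mu torB) kE inE.
Qed.

End Level.

(** Automorphisms of [B] act by composition on the surjections with kernel [L]: freely because these
    are onto, and transitively because two surjections with the same kernel differ by an
    automorphism. *)
Lemma card_surj_ker n (L : {group 'V_n}) (F0 : {ffun 'I_n -> B}) :
  imF F0 = [set: B]%G -> kerF F0 = L ->
  #|[set F : {ffun 'I_n -> B} | (imF F == [set: B]%G) && (kerF F == L)]| = num_aut B.
Proof.
move=> im0 ker0.
have sur0 g : exists x : 'V_n, ev F0 x = g by apply/(mem_imF mu torB); rewrite im0 inE.
pose comp (f : {perm B}) : {ffun 'I_n -> B} := [ffun i => f (F0 i)].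
have autP f : f \in Aut [set: B] -> {morph f : x y / x + y}.
  by rewrite inE => /andP[_ /morphicP h] x y; apply: h; rewrite inE.
have ev_comp f (x : 'V_n) : f \in Aut [set: B] -> ev (comp f) x = f (ev F0 x).
  move=> /autP fD; have f0 : f 0 = 0 by apply: (addIr (f 0)); rewrite -fD !add0r.
  have fM g m : f (g *+ m) = f g *+ m by elim: m => // m IH; rewrite !mulrS fD IH.
  rewrite /ev (big_morph f fD f0); apply: eq_bigr => i _; by rewrite ffunE fM.
rewrite /num_aut -(card_in_imset (f := comp) (D := Aut [set: B])) => [|f g fA gA E]; last first.
  by apply/perm.permP => b; have [x <-] := sur0 b; rewrite -!ev_comp // E.
congr #|pred_of_set _|; apply/setP => F; rewrite inE; apply/andP/imsetP => [[/eqP imE /eqP kerE]|[f fA ->]].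
  have sur g : exists x : 'V_n, ev F x = g by apply/(mem_imF mu torB); rewrite imE inE.
  have kk (x : 'V_n) : (ev F x == 0) = (ev F0 x == 0) by rewrite -!(mem_kerF mu torB) kerE ker0.
  have [s sE] := choice sur0.
  have fE (x : 'V_n) : ev F (s (ev F0 x)) = ev F x.
    by apply/eqP; rewrite -subr_eq0 -(evB mu torB) kk (evB mu torB) sE subrr.
  have inj : injective (fun b => ev F (s b)).
    move=> b1 b2 /eqP; rewrite -subr_eq0 -(evB mu torB) kk (evB mu torB) !sE subr_eq0 => /eqP //.
  exists (perm inj); last first.
    by apply/ffunP => i; rewrite ffunE permE -(ev_unitv mu F0 i) fE (ev_unitv mu).
  rewrite inE; apply/andP; split; first by apply/fintype.subsetP => x; rewrite inE.
  apply/morphicP => x y _ _; rewrite !permE.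
  have [u <-] := sur0 x; have [v <-] := sur0 y.
  by rewrite !FinRing.zmodMgE -(evD mu torB) !fE (evD mu torB).
split; apply/eqP; apply: eq_group => x.
  have [y yE] := sur0 (f^-1%g x); rewrite inE.
  by apply/(mem_imF mu torB); exists y; rewrite ev_comp // yE permKV.
rewrite -ker0 !mem_kerF ev_comp //.
have f0 : f 0 = 0 by apply: (addIr (f 0)); rewrite -(autP _ fA) !add0r.
by rewrite -{1}f0 (inj_eq perm_inj).
Qed.

End LatticeHom.

(** * Primary parts of torsion groups *)

Section ZmodFacts.
Implicit Types G : zmodType.

Lemma mulrn_gcd G (x : G) m n : (0 < m)%N -> x *+ m = 0 -> x *+ n = 0 -> x *+ gcdn m n = 0.
Proof.
move=> m0 xm xn; have [c _ /dvdnP[q qE]] := Bezoutl n m0.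
have : x *+ (gcdn m n + c * n) = 0 by rewrite qE mulnC mulrnA xm mul0rn.
by rewrite mulrnDr [(c * n)%N]mulnC mulrnA xn mul0rn addr0.
Qed.

Lemma mulrn_dvd G (x : G) m n : (m %| n)%N -> x *+ m = 0 -> x *+ n = 0.
Proof. by case/dvdnP => q -> xm; rewrite mulnC mulrnA xm mul0rn. Qed.

Lemma mulrn_eqmod G (x : G) d m n : x *+ d = 0 -> m = n %[mod d] -> x *+ m = x *+ n.
Proof. by move=> xd mn; rewrite -(mulrn_modn m xd) mn mulrn_modn. Qed.

Lemma zmod_isomI (U V : zmodType) (f : U -> V) : {morph f : x y / x - y} -> bijective f -> zmod_isom U V.
Proof.
move=> fB fbij; pose F := GRing.isZmodMorphism.Build U V f fB.
by exists (HB.pack_for {additive U -> V} f F).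
Qed.

Section Sub.
Variables (U V : zmodType) (h : U -> V).
Hypothesis hB : {morph h : x y / x - y}.
Lemma sub_morph0 : h 0 = 0. Proof. by rewrite -(subrr 0) hB subrr. Qed.
Lemma sub_morphN x : h (- x) = - h x. Proof. by rewrite -sub0r hB sub_morph0 sub0r. Qed.
Lemma sub_morphD x y : h (x + y) = h x + h y.
Proof. by rewrite -{1}(opprK y) hB sub_morphN opprK. Qed.
Lemma sub_morphMn x n : h (x *+ n) = h x *+ n.
Proof. by elim: n => [|n IH]; rewrite ?sub_morph0 // !mulrS sub_morphD IH. Qed.
Lemma sub_morph_sum (I : Type) (s : seq I) (f : I -> U) : h (\sum_(i <- s) f i) = \sum_(i <- s) h (f i).
Proof. exact: (big_morph h sub_morphD sub_morph0). Qed.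
End Sub.
End ZmodFacts.

Section Primary.
Variables (G : zmodType) (D : nat) (P : {fset nat}).
Hypothesis D0 : (0 < D)%N.
Hypothesis GD : forall x : G, x *+ D = 0.
Hypothesis primeP : forall p, p \in P -> prime p.

(* The integer that acts on a group killed by [D] as the projection onto its
   [p]-primary part. *)
Definition idem p := chinese D`_p D`_p^' 1 0.

Lemma idem1 p : idem p = 1 %[mod D`_p].
Proof. by rewrite /idem chinese_modl // coprime_partC. Qed.

Lemma idem0 p : (D`_p^' %| idem p)%N.
Proof. by rewrite /dvdn /idem chinese_modr ?coprime_partC // mod0n. Qed.

Lemma part_idem p : (D %| D`_p * idem p)%N.
Proof. by rewrite -{1}(partnC p D0) dvdn_mul // idem0. Qed.

Lemma part_dvdC p q : prime p -> prime q -> q != p -> (D`_q %| D`_p^')%N.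
Proof.
move=> pp qq qp; rewrite -(@Gauss_dvdr _ (D`_p)%N) ?partnC ?dvdn_part //.
by rewrite !p_part coprimeXl // coprimeXr // prime_coprime // dvdn_prime2.
Qed.

Lemma primaryP p (x : G) : prime p -> x \in primary_part G p <-> x *+ D`_p = 0.
Proof.
move=> pp; split=> [/asboolP[e xe]|xD]; last by apply/asboolP; exists (logn p D); rewrite -p_part.
have := mulrn_gcd _ xe (GD x); rewrite expn_gt0 prime_gt0 // => /(_ isT).
apply: mulrn_dvd; have pe : p.-nat (p ^ e)%N by rewrite pnatX pnat_id.
by rewrite -(part_pnat_id (pnat_dvd (dvdn_gcdl _ D) pe)) partn_dvd // dvdn_gcdr.
Qed.

Lemma idem_primary p q (x : G) : prime p -> prime q -> x \in primary_part G q ->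
  x *+ idem p = if q == p then x else 0.
Proof.
move=> pp qq /(primaryP x qq) xq; case: (q =P p) => [qp|/eqP qp].
  by rewrite qp in xq; rewrite (mulrn_eqmod xq (idem1 p)).
by apply: mulrn_dvd xq; apply: dvdn_trans (idem0 p); apply: part_dvdC.
Qed.

Lemma prime_val (p : P) : prime (val p).
Proof. exact: primeP (valP p). Qed.

Lemma primary_sumB (u v : primary_sum G P) p :
  primary_sum_val (u - v) p = primary_sum_val u p - primary_sum_val v p.
Proof.
have -> : primary_sum_val (u - v) = primary_sum_val u - primary_sum_val v by exact: (raddfB (\val : primary_sum G P -> _)).
by rewrite !ffunE.
Qed.

Fact proj_primary (x : G) : [ffun p : P => x *+ idem (val p)] \in primary_family G P.
Proof.
apply/forallP => p; rewrite ffunE; apply/primaryP; first exact: prime_val.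
by rewrite -mulrnA mulnC; apply: mulrn_dvd (part_idem _) (GD x).
Qed.

Lemma idem_sum (f : {ffun P -> G}) (p : P) : f \in primary_family G P ->
  (\sum_q f q) *+ idem (val p) = f p.
Proof.
move=> /forallP fP; rewrite -sumrMnl (bigD1 p) //= big1 => [|q qp].
  by rewrite addr0 (idem_primary _ _ (fP p)) ?eqxx ?prime_val.
rewrite (idem_primary _ _ (fP q)) ?prime_val //.
by case: eqP => // /val_inj E; rewrite E eqxx in qp.
Qed.

Definition off_primary (x : G) := forall p, p \in P -> x *+ idem p = 0.

(** [G[P]] is the quotient of [G] by [off_primary], the common kernel of the projections;
    isomorphisms are thereby traded for surjections defined on [G]. *)
Lemma primary_sum_isomP (B : zmodType) : zmod_isom (primary_sum G P) B <->
  exists h : G -> B, [/\ {morph h : x y / x - y}, forall b, exists x, h x = b &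
    forall x, h x = 0 <-> off_primary x].
Proof.
have primary_ext (u v : primary_sum G P) : (forall p, primary_sum_val u p = primary_sum_val v p) -> u = v.
  by move=> uv; apply/val_inj/ffunP => p; apply: uv.
have famP (u : primary_sum G P) : primary_sum_val u \in primary_family G P by case: u.
split=> [[phi [psi phiK psiK]]|[h [hB hsur hker]]].
  pose pr x := PrimarySum (proj_primary x).
  have prE x p : primary_sum_val (pr x) p = x *+ idem (val p) by rewrite ffunE.
  exists (phi \o pr); split=> [x y|b|x].
  - rewrite /= -raddfB; congr (phi _); apply: primary_ext => p.
    by rewrite primary_sumB !prE mulrnBl.
  - exists (\sum_p primary_sum_val (psi b) p); rewrite /= -[RHS](psiK b); congr (phi _).
    by apply: primary_ext => p; rewrite prE idem_sum.
  split=> [/= h0 p pP|xP].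
    have : pr x = 0 by apply: (can_inj phiK); rewrite h0 raddf0.
    by move/(congr1 (fun u => primary_sum_val u [` pP]%fset)); rewrite prE /= => ->; rewrite ffunE.
  have -> : (phi \o pr) x = phi 0; last exact: raddf0.
  congr (phi _); apply: primary_ext => p; rewrite prE xP ?(valP p) //; by rewrite [RHS]ffunE.
have key (u : primary_sum G P) (p : P) : (\sum_q primary_sum_val u q) *+ idem (val p) = primary_sum_val u p.
  exact: idem_sum.
pose phi (u : primary_sum G P) := h (\sum_q primary_sum_val u q).
have phiB : {morph phi : u v / u - v}.
  move=> u v; rewrite /phi -hB -sumrB; congr (h _); apply: eq_bigr => q _.
  exact: primary_sumB.
apply: (zmod_isomI phiB).
have [s sE] := choice hsur.
exists (fun b => PrimarySum (proj_primary (s b))) => [u|b].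
  apply: primary_ext => p; rewrite ffunE.
  have : h (s (phi u) - \sum_q primary_sum_val u q) = 0 by rewrite hB sE subrr.
  by move/hker/(_ _ (valP p)); rewrite mulrnBl key => /eqP; rewrite subr_eq0 => /eqP.
rewrite /phi -[RHS]sE; apply/eqP; rewrite -subr_eq0 -hB; apply/eqP/hker => p pP.
have := key (PrimarySum (proj_primary (s b))) [` pP]%fset.
by rewrite mulrnBl /= => ->; rewrite ffunE subrr.
Qed.

Variables (Q b : nat).
Hypothesis Qb0 : (0 < Q * b)%N.
Hypothesis primeQb : forall p, prime p -> (p %| Q * b)%N = (p \in P).
Hypothesis primeQ : forall p, p \in P -> (p %| Q)%N.

(** Such an [x] is killed by [D] and by the sum [c] of the integers [idem p]. A prime [q] of [P]
    dividing [D] does not divide [c], which is 1 modulo [q]; so the order of [x] is prime to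
    [Q * b], and [x] is divisible by [Q * b]. *)
Lemma off_primary_mul x : off_primary x -> exists y, x = y *+ (Q * b).
Proof.
move=> xP; pose c := (\sum_(p : P) idem (val p))%N.
have xc : x *+ c = 0 by rewrite /c -sumrMnr big1 // => p _; apply: xP (valP p).
have xg := mulrn_gcd D0 (GD x) xc.
have cop : coprime (gcdn D c) (Q * b).
  apply/negPn/negP => nc.
  have g1 : (1 < gcdn (gcdn D c) (Q * b))%N.
    by rewrite ltn_neqAle eq_sym nc gcdn_gt0 Qb0 orbT.
  have [q qq] : exists2 q, prime q & (q %| gcdn (gcdn D c) (Q * b))%N.
    by exists (pdiv (gcdn (gcdn D c) (Q * b))); rewrite ?pdiv_prime ?pdiv_dvd.
  rewrite !dvdn_gcd => /andP[/andP[qD qc] qa].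
  have qP : q \in P by rewrite -primeQb.
  have qDq : (q %| D`_q)%N by rewrite p_part dvdn_exp // logn_gt0 mem_primes qq D0.
  have q1 : idem q = 1 %[mod q].
    by have := congr1 (modn^~ q) (idem1 q); rewrite !modn_dvdm.
  move: qc; rewrite /c (bigD1 [` qP]%fset) //= dvdn_addl.
    by rewrite /dvdn q1 modn_small ?prime_gt1.
  apply: dvdn_sum => p pq; apply: dvdn_trans (idem0 _); apply: dvdn_trans qDq _.
  apply: part_dvdC => //; first exact: prime_val.
  by apply: contra pq => /eqP qE; apply/eqP/val_inj.
have [u _ /dvdnP[v vE]] := Bezoutl (gcdn D c) Qb0.
exists (x *+ v); rewrite -mulrnA -vE mulrnDr [(u * _)%N]mulnC mulrnA xg mul0rn addr0.
by rewrite gcdnC (eqP cop).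
Qed.

(** Multiples of [b] lie in the kernel of [h], so [b G] is contained in [Q b G], hence in
    [Q ^ j b G] for all [j]. Once [Q ^ j] is divisible by the [p]-part of [D], [idem p] kills that
    group. *)
Lemma mul_off_primary (B : zmodType) (h : G -> B) x : {morph h : x y / x - y} ->
  (forall g : B, g *+ b = 0) -> (forall x, h x = 0 <-> exists y, x = y *+ (Q * b)) ->
  off_primary (x *+ (Q * b)).
Proof.
move=> hB torb hker p pP.
have iter j : forall x : G, exists y : G, x *+ b = y *+ (Q ^ j * b).
  elim: j => [|j IH] {}x; first by exists x; rewrite mul1n.
  have [y ->] := IH x.
  have /hker[z zE] : h (y *+ b) = 0 by rewrite sub_morphMn.
  exists z; rewrite mulnC mulrnA zE -mulrnA; congr (_ *+ _).
  by rewrite expnSr; ring.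
have [y yE] := iter (logn p D) x.
rewrite [(Q * b)%N]mulnC mulrnA yE -!mulrnA.
apply: mulrn_dvd (GD y); apply: dvdn_trans (part_idem p) _.
rewrite mulnA dvdn_mul // mulnAC dvdn_mulr // dvdn_mulr // p_part dvdn_exp2r // primeQ //.
Qed.

Lemma primary_sum_isom_quotP (B : zmodType) : (forall g : B, g *+ b = 0) ->
  zmod_isom (primary_sum G P) B <->
  exists h : G -> B, [/\ {morph h : x y / x - y}, forall b, exists x, h x = b &
    forall x, h x = 0 <-> exists y, x = y *+ (Q * b)].
Proof.
move=> torb; rewrite primary_sum_isomP; split=> -[h [hB hsur hker]]; exists h; split=> // x.
  rewrite hker; split; first exact: off_primary_mul.
  by case=> y ->; apply/hker; rewrite sub_morphMn // mulnC mulrnA torb mul0rn.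
split=> [/hker[y ->]|/off_primary_mul/hker //]; exact: mul_off_primary hB torb hker.
Qed.

End Primary.

Section Cokernel.
Variables (R : realType) (a : nat) (mu : balanced_law R a).
Let a_gt1 : (1 < a)%N := law_gt1 mu.
Local Notation "''V_' n" := ('cV['Z_a]_n : finZmodType) (at level 8, n at level 2).
Variable (B : finZmodType).
Hypothesis torB : forall g : B, g *+ a = 0.
Local Notation kerF := (kerF mu torB).
Local Notation imF := (imF mu torB).
Local Notation redmx := (redmx a).

Lemma mulrz_Zp (U : zmodType) (g : U) (x : int) : g *+ a = 0 -> g *~ x = g *+ ((x%:~R : 'Z_a) : nat).
Proof.
move=> ga.
have E (m : nat) : g *+ ((m%:R : 'Z_a) : nat) = g *+ m.
  by rewrite val_Zp_nat // mulrn_modn.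
case: x => m; first by rewrite -!pmulrn E.
rewrite NegzE mulrNz rmorphN /= -!pmulrn; apply/eqP; rewrite eq_sym -addr_eq0; apply/eqP.
have ga' : g *+ (Zp_trunc a).+2 = 0 by rewrite Zp_cast.
have N0 := congr1 (@nat_of_ord _) (addNr (m.+1%:R : 'Z_a)).
by rewrite -(E m.+1) -mulrnDr -(mulrn_modn _ ga') [X in g *+ X]N0.
Qed.

Section Quotient.
Variables (n : nat) (M : 'M[int]_n).
Local Notation G := (Cok M).
Local Notation pi := (\pi_(Cok M)%qT : 'cV[int]_n -> Cok M).

Lemma piB : {morph pi : x y / x - y}.
Proof. by move=> x y; rewrite /= !piE. Qed.

Lemma pi_eq x y : pi x = pi y <-> exists u, x - y = M *m u.
Proof.
split=> [/eqP|[u uE]]; first by rewrite -Quotient.idealrBE => /asboolP.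
by apply/eqP; rewrite -Quotient.idealrBE; apply/asboolP; exists u.
Qed.

Lemma pi_surj (x : G) : exists v, pi v = x.
Proof. by exists (repr x); rewrite reprK. Qed.

Lemma Cok_torsion (x : G) : x *+ `|\det M|%N = 0.
Proof.
have [v <-] := pi_surj x; rewrite -(sub_morphMn piB) -(sub_morph0 piB).
apply/pi_eq; exists (\adj M *m (sgz (\det M) *: v)).
by rewrite subr0 mulmxA mul_mx_adj mul_scalar_mx scalerA mulrC -abszEsg -scaler_nat natz.
Qed.

Lemma redmx_colspan (v : 'cV[int]_n) :
  (redmx v \in colspan (redmx M)) <-> exists y, pi v = y *+ a.
Proof.
split=> [/colspanP[x xE]|[y]].
  have : redmx (v - M *m liftmx x) = 0 by rewrite /redmx map_mxB -!/(redmx _) redmxM liftmxK // -xE subrr.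
  case/(redmxP a_gt1) => Z ZE; exists (pi Z); rewrite -(sub_morphMn piB); apply/pi_eq.
  exists (liftmx x); apply/eqP; rewrite subr_eq addrC -subr_eq ZE; apply/eqP.
  by rewrite -scaler_nat natz.
have [w <-] := pi_surj y; rewrite -(sub_morphMn piB) => /pi_eq[u uE].
apply/colspanP; exists (redmx u); rewrite -redmxM -uE /redmx map_mxB -!/(redmx _).
suff -> : redmx (w *+ a) = 0 by rewrite subr0.
by apply/matrixP => i j; rewrite !mxE mulmxnE rmorphMn /= (Zp_torsion mu).
Qed.

(** [Cok M] modulo [a] is [(Z/a)^n] modulo the column span of the reduction of [M]; both sides say
    that this quotient is isomorphic to [B]. *)
Lemma Cok_homP :
  (exists h : G -> B, [/\ {morph h : x y / x - y}, forall b, exists x, h x = b &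
    forall x, h x = 0 <-> exists y, x = y *+ a]) <->
  (exists2 F : {ffun 'I_n -> B}, imF F = [set: B]%G & kerF F = colspan (redmx M)).
Proof.
split=> [[h [hB hsur hker]]|[F imE kerE]].
  pose F : {ffun 'I_n -> B} := [ffun i => h (pi (delta_mx i 0))].
  have hpB : {morph (h \o pi) : x y / x - y} by move=> x y; rewrite /= piB hB.
  have evF v : ev F (redmx v) = h (pi v).
    have vE : v = \sum_i (delta_mx i 0) *~ v i 0.
      apply/matrixP => i j; rewrite (ord1 j) summxE (bigD1 i) //= big1 => [|k ki].
        by rewrite addr0 -scaler_int intz !mxE !eqxx mulr1.
      by rewrite -scaler_int intz !mxE eq_sym (negbTE ki) mulr0.
    rewrite [in RHS]vE -[RHS]/((h \o pi) _) (sub_morph_sum hpB).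
    rewrite /ev; apply: eq_bigr => i _; rewrite ffunE !mxE.
    rewrite -mulrz_Zp //.
    case: (v i 0) => m; first by rewrite -!pmulrn (sub_morphMn hpB).
    by rewrite NegzE !mulrNz -!pmulrn (sub_morphN hpB) (sub_morphMn hpB).
  exists F; apply: eq_group => x.
    rewrite [RHS]inE; apply/(mem_imF mu torB).
    have [y <-] := hsur x; have [v <-] := pi_surj y.
    by exists (redmx v); rewrite evF.
  rewrite mem_kerF -(liftmxK a_gt1 x) evF; apply/eqP/idP => [/hker|] /redmx_colspan //.
  by move/hker.
have sub0 u : (exists w, u = M *m w) -> ev F (redmx u) = 0.
  case=> w ->; apply/eqP; rewrite -(mem_kerF mu torB) kerE; apply/colspanP.
  by exists (redmx w); rewrite redmxM.
have evR x y : ev F (redmx (x - y)) = ev F (redmx x) - ev F (redmx y).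
  by rewrite /redmx map_mxB (evB mu torB).
pose h (x : G) := ev F (redmx (repr x)).
have hpi v : h (pi v) = ev F (redmx v).
  have /pi_eq/sub0 : pi (repr (pi v)) = pi v by rewrite reprK.
  by rewrite evR => /eqP; rewrite subr_eq0 => /eqP.
exists h; split=> [x y|g|x].
- have [u <-] := pi_surj x; have [v <-] := pi_surj y.
  by rewrite -piB !hpi evR.
- have : g \in imF F by rewrite imE inE.
  by case/(mem_imF mu torB) => v <-; exists (pi (liftmx v)); rewrite hpi liftmxK.
have [v <-] := pi_surj x; rewrite hpi -redmx_colspan -kerE mem_kerF.
by split=> [->|/eqP].
Qed.

Variables (P : {fset nat}) (Q b : nat).
Hypothesis primeP : forall p, p \in P -> prime p.
Hypothesis aE : a = (Q * b)%N.
Hypothesis prime_a : forall p, prime p -> (p %| a)%N = (p \in P).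
Hypothesis primeQ : forall p, p \in P -> (p %| Q)%N.
Hypothesis torb : forall g : B, g *+ b = 0.

Lemma Cok_primary_isomP : \det M != 0 ->
  zmod_isom (primary_sum (Cok M) P) B <->
  exists2 F : {ffun 'I_n -> B}, imF F = [set: B]%G & kerF F = colspan (redmx M).
Proof.
move=> M0; have D0 : (0 < `|\det M|)%N by rewrite absz_gt0.
rewrite -Cok_homP; have Qb0 : (0 < Q * b)%N by rewrite -aE ltnW.
rewrite (@primary_sum_isom_quotP _ _ _ D0 Cok_torsion primeP Q b) -?aE //; exact: ltnW.
Qed.

End Quotient.
End Cokernel.

(** * Probability *)

Section Prob.
Variables (d : measure_display) (T : measurableType d) (R : realType) (Pr : probability T R).
Local Open Scope classical_set_scope.
Implicit Types A B : set T.

Definition prob A : R := fine (Pr A).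

Lemma probE A : measurable A -> Pr A = (prob A)%:E.
Proof. by move=> mA; rewrite /prob fineK // fin_num_measure. Qed.

Lemma prob_ge0 A : 0 <= prob A.
Proof. exact: fine_ge0. Qed.

Lemma prob_setT : prob classical_sets.setT = 1.
Proof. by rewrite /prob probability_setT. Qed.

Lemma prob_set0 : prob classical_sets.set0 = 0.
Proof. by rewrite /prob measure0. Qed.

Lemma le_prob A B : measurable A -> measurable B -> A `<=` B -> prob A <= prob B.
Proof.
by move=> mA mB AB; rewrite -lee_fin -!probE //; apply: le_measure => //; exact/mem_set.
Qed.

Lemma prob_setU A B : measurable A -> measurable B -> [disjoint A & B] ->
  prob (A `|` B) = prob A + prob B.
Proof.
move=> mA mB /disj_setPS AB; apply: EFin_inj; rewrite EFinD -!probE //; last exact: measurableU.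
by rewrite measureU //; apply/seteqP; split=> // x /AB.
Qed.

Lemma prob_setU_le A B : measurable A -> measurable B -> prob (A `|` B) <= prob A + prob B.
Proof.
move=> mA mB; rewrite -lee_fin EFinD -!probE //; last exact: measurableU.
exact: measureU2.
Qed.

Lemma prob_exists_le (I : finType) (p : I -> set T) : (forall i, measurable (p i)) ->
  prob [set w | exists i, p i w] <= \sum_i prob (p i).
Proof.
move=> mp.
suff h (s : seq I) : measurable [set w | exists2 i, i \in s & p i w] /\
    prob [set w | exists2 i, i \in s & p i w] <= \sum_(i <- s) prob (p i).
  have [_] := h (index_enum I); apply: le_trans; rewrite le_eqVlt; apply/orP; left; apply/eqP.
  by congr prob; apply/seteqP; split=> w /= [i]; exists i; rewrite ?mem_index_enum.
elim: s => [|i s [ms IH]].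
  rewrite (_ : [set w | _] = classical_sets.set0); last by apply/seteqP; split=> w //= [].
  by rewrite prob_set0 big_nil.
rewrite (_ : [set w | _] = p i `|` [set w | exists2 i, i \in s & p i w]).
  split; first exact: measurableU.
  by rewrite big_cons; apply: le_trans (prob_setU_le (mp i) ms) _; rewrite lerD2l.
apply/seteqP; split=> w /=.
  by case=> j; rewrite inE => /orP[/eqP->|js] pj; [left|right; exists j].
by case=> [pi|[j js pj]]; [exists i; rewrite ?mem_head|exists j; rewrite ?inE ?js ?orbT].
Qed.

Section Finite.
Variables (I : finType) (Z : T -> I).
Hypothesis mZ : forall i, measurable [set w | Z w = i].

Lemma measurable_mem (s : seq I) : measurable [set w | Z w \in s].
Proof.
elim: s => [|i s IH]; first by rewrite [X in measurable X](_ : _ = classical_sets.set0) //; apply/seteqP; split.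
rewrite [X in measurable X](_ : _ = [set w | Z w = i] `|` [set w | Z w \in s]); first exact: measurableU.
apply/seteqP; split=> w /=; rewrite inE.
  by case/orP => [/eqP|]; [left|right].
by case=> [->|->]; rewrite ?eqxx ?orbT.
Qed.

Lemma prob_mem (s : seq I) : uniq s -> prob [set w | Z w \in s] = \sum_(i <- s) prob [set w | Z w = i].
Proof.
elim: s => [|i s IH] /=; first by rewrite big_nil -prob_set0 => _; congr prob; apply/seteqP; split.
case/andP => is_ us; rewrite big_cons -IH // -prob_setU //; last 2 first.
- exact: measurable_mem.
- by apply/disj_setPS => w [/= ->]; rewrite (negbTE is_).
congr prob; apply/seteqP; split=> w /=; rewrite inE.
  by case/orP => [/eqP|]; [left|right].
by case=> [->|->]; rewrite ?eqxx ?orbT.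
Qed.

Lemma prob_sum (Phi : pred I) : prob [set w | Phi (Z w)] = \sum_(i | Phi i) prob [set w | Z w = i].
Proof.
rewrite [X in prob X](_ : _ = [set w | Z w \in enum Phi]).
  by rewrite prob_mem ?enum_uniq // big_enum.
by apply/seteqP; split=> w /=; rewrite mem_enum.
Qed.

Lemma prob_sum1 : \sum_i prob [set w | Z w = i] = 1.
Proof. by rewrite -prob_setT -prob_sum; congr prob; apply/seteqP; split. Qed.
End Finite.

Lemma measurable_count (E : countType) (Y : T -> E) (S : set E) :
  (forall e, measurable [set w | Y w = e]) -> measurable (Y @^-1` S).
Proof.
move=> mY; rewrite [X in measurable X](_ : _ = \bigcup_e ([set w | Y w = e] `&` [set w | S e])).
  apply: countable_bigcupT_measurable => // e; have [Se|Se] := pselect (S e).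
      have -> // : [set w | Y w = e] `&` [set w | S e] = [set w | Y w = e].
    by apply/seteqP; split=> w //= [].
  have -> // : [set w | Y w = e] `&` [set w | S e] = classical_sets.set0.
  by apply/seteqP; split=> w //= [].
apply/seteqP; split=> [w Sw|w [e _ [/= <-]]] //.
by exists (Y w).
Qed.

Lemma prob_indep (I : finType) (d' : measure_display) (E : measurableType d') (X : I -> T -> E)
    (A : I -> set E) : mutually_independent Pr X ->
  (forall i, measurable (A i)) -> (forall i, measurable (X i @^-1` A i)) ->
  prob [set w | forall i, A i (X i w)] = \prod_i prob (X i @^-1` A i).
Proof.
move=> ind mA mXA; pose J := [fset i | i in enum I]%fset.
have JP i : i \in J by apply/imfsetP; exists i => //=; rewrite mem_enum.
have mcap : measurable [set w | forall i, A i (X i w)].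
  rewrite [X in measurable X](_ : _ = \bigcap_(i in [set: I]) (X i @^-1` A i)).
    exact: fin_bigcap_measurable.
  by apply/seteqP; split=> [w h i _|w h i]; apply: h.
apply: EFin_inj; rewrite -probE //.
have -> : [set w | forall i, A i (X i w)] = \bigcap_(i in [set` J]) (X i @^-1` A i).
  by apply/seteqP; split=> [w h i _|w h i]; apply: h => //; apply: JP.
rewrite ind // (perm_big (index_enum I)) /=.
  by rewrite -prodEFin; apply: eq_bigr => i _; rewrite probE.
by apply: uniq_perm => [||i]; rewrite ?fset_uniq ?index_enum_uniq // mem_index_enum; apply: JP.
Qed.

End Prob.

Section Law.
Variables (R : realType) (alpha : R) (halpha : 0 < alpha <= 1 / 2%:R).
Variables (d0 : measure_display) (T0 : measurableType d0) (Pr0 : probability T0 R).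
Variables (xi : {RV Pr0 >-> int}) (hxi : alpha_balanced Pr0 xi alpha).
Local Open Scope classical_set_scope.

Lemma measurable_xi (A : set int) : measurable (xi @^-1` A).
Proof. exact: measurable_funPTI. Qed.

Definition xi_law a (r : 'Z_a) : R := prob Pr0 [set w | (xi w)%:~R = r].

Section Modulus.
Variable a : nat.
Hypothesis a_gt1 : (1 < a)%N.

Lemma xi_law_sum : \sum_r @xi_law a r = 1.
Proof. by apply: (@prob_sum1 _ _ _ Pr0 _ (fun w => (xi w)%:~R : 'Z_a)) => r; apply: (measurable_xi [set x : int | x%:~R = r]). Qed.

Lemma modp_Zp p c (x : int) : prime p -> (p %| a)%N ->
  ((x%:~R : 'Z_a) == c %[mod p])%N = ((x%:~R : 'F_p) == c%:R).
Proof.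
move=> pp pa; have p1 := prime_gt1 pp.
have E : ((x%:~R : 'F_p) == ((x%:~R : 'Z_a) : nat)%:R).
  have := intr_Zp_eq0 (x - ((x%:~R : 'Z_a) : nat)%:Z) a_gt1.
  rewrite rmorphB /= -pmulrn natr_Zp subrr eqxx => /esym xa.
  rewrite -subr_eq0 pmulrn -rmorphB /=.
  have : (p %| x - ((x%:~R : 'Z_a) : nat)%:Z)%Z by apply: dvdz_trans xa; rewrite dvdzE.
  rewrite -(intr_Zp_eq0 _ p1); rewrite (Fp_Zcast pp) //.
rewrite (eqP E) -(inj_eq val_inj) /= !val_Fp_nat //.
Qed.

Lemma xi_law_bal p c : prime p -> (p %| a)%N ->
  \sum_(r : 'Z_a | (r == c %[mod p])%N) xi_law r <= 1 - alpha.
Proof.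
move=> pp pa; rewrite -(@prob_sum _ _ _ Pr0 _ (fun w => (xi w)%:~R : 'Z_a) _ (fun r : 'Z_a => r == c %[mod p])%N).
  have := hxi pp; rewrite -lee_fin -probE; last by apply: (measurable_xi [set x : int | ((x%:~R : 'Z_a) == c %[mod p])%N]).
  apply: le_trans; apply: le_trans (@le_bigmax _ _ _ 0%E _ (c%:R : 'F_p)).
  rewrite [X in (Pr0 X <= _)%E](_ : _ = [set w | (xi w)%:~R = c%:R :> 'F_p]) //.
  by apply/seteqP; split=> w /=; rewrite modp_Zp // => /eqP.
by move=> r; apply: (measurable_xi [set x : int | x%:~R = r]).
Qed.

Definition xi_balanced : balanced_law R a.
Proof.
apply: (@BalancedLaw R a (@xi_law a) (1 - alpha)) => //.
- by move=> r; apply: prob_ge0.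
- exact: xi_law_sum.
- by case/andP: halpha => _ h; lra.
- by case/andP: halpha => h _; lra.
- exact: xi_law_bal.
Defined.

End Modulus.
End Law.

Section MatrixLaw.
Variables (R : realType) (d : measure_display) (T : measurableType d) (Pr : probability T R).
Variables (d0 : measure_display) (T0 : measurableType d0) (Pr0 : probability T0 R) (xi : {RV Pr0 >-> int}).
Variables (k n : nat) (M : 'I_k -> {RV Pr >-> 'M[int]_n}).
Hypothesis hM : mutually_independent Pr (fun i : 'I_k => M i : T -> 'M[int]_n).
Hypothesis hxiM : forall i : 'I_k, iid_entries Pr Pr0 (M i) xi.
Variables (a : nat) (mu : balanced_law R a).
Hypothesis muE : law_mu mu =1 xi_law xi (a := a).
Local Open Scope classical_set_scope.

Lemma measurable_M i (A : set 'M[int]_n) : measurable (M i @^-1` A).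
Proof. exact: measurable_funPTI. Qed.

Lemma prob_redmx i (m : 'M['Z_a]_n) : prob Pr [set w | redmx a (M i w) = m] = mxw mu m.
Proof.
have [ind law] := hxiM i.
rewrite [X in prob _ X](_ : _ = [set w | forall ij : 'I_n * 'I_n,
    [set x : int | x%:~R = m ij.1 ij.2] (M i w ij.1 ij.2)]).
  rewrite (@prob_indep _ _ _ _ _ _ _ _ (fun ij => [set x : int | x%:~R = m ij.1 ij.2]) ind) // => [|ij]; last first.
    exact: (measurable_M i [set N : 'M[int]_n | (N ij.1 ij.2)%:~R = m ij.1 ij.2]).
  rewrite /mxw /colw exchange_big pair_big /=; apply: eq_bigr => -[x y] _ /=.
  by rewrite mxE muE /xi_law /prob law.
apply/seteqP; split=> w /= h.
  by move=> ij; rewrite -h mxE.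
by apply/matrixP => x y; rewrite mxE (h (x, y)).
Qed.

Lemma prob_redmxs (ms : {ffun 'I_k -> 'M['Z_a]_n}) :
  prob Pr [set w | [ffun i => redmx a (M i w)] = ms] = \prod_i mxw mu (ms i).
Proof.
rewrite [X in prob _ X](_ : _ = [set w | forall i, [set N | redmx a N = ms i] (M i w)]).
  rewrite (@prob_indep _ _ _ _ _ _ _ _ (fun i => [set N | redmx a N = ms i]) hM) // => [|i]; last exact: measurable_M.
  by apply: eq_bigr => i _; rewrite -(prob_redmx i).
apply/seteqP; split=> w /= h.
  by move=> i; rewrite -h ffunE.
by apply/ffunP => i; rewrite ffunE.
Qed.

Lemma measurable_redmxs (ms : {ffun 'I_k -> 'M['Z_a]_n}) :
  measurable [set w | [ffun i => redmx a (M i w)] = ms].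
Proof.
rewrite [X in measurable X](_ : _ = \bigcap_(i in [set: 'I_k]) (M i @^-1` [set N | redmx a N = ms i])).
  by apply: fin_bigcap_measurable => // i _; apply: measurable_M.
apply/seteqP; split=> w /= h.
  by move=> i _ /=; rewrite -h ffunE.
by apply/ffunP => i; rewrite ffunE; apply: h.
Qed.

Lemma measurable_Ms (S : ('I_k -> 'M[int]_n) -> Prop) : measurable [set w | S (fun i => M i w)].
Proof.
have := @measurable_count _ _ {ffun 'I_k -> 'M[int]_n} (fun w => [ffun i => M i w]) (fun ms => S ms).
have -> : (fun w => [ffun i => M i w] : {ffun 'I_k -> 'M[int]_n}) @^-1` (fun ms => S ms) = [set w | S (fun i => M i w)].
  by apply/seteqP; split=> w /=; congr S; apply/funext => i; rewrite ffunE.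
apply=> ms.
rewrite [X in measurable X](_ : _ = \bigcap_(i in [set: 'I_k]) (M i @^-1` [set N | N = ms i])).
  by apply: fin_bigcap_measurable => // i _; apply: measurable_M.
apply/seteqP; split=> w /= h.
  by move=> i _ /=; rewrite -h ffunE.
by apply/ffunP => i; rewrite ffunE; apply: h.
Qed.

Lemma prob_redmxs_sum (Phi : pred (seq 'M['Z_a]_n)) :
  prob Pr [set w | Phi [seq redmx a (M i w) | i <- enum 'I_k]] = iexp (@mxw R a mu n) k (fun ms => (Phi ms)%:R).
Proof.
pose Phi' (ms : {ffun 'I_k -> 'M['Z_a]_n}) := Phi [seq ms i | i <- enum 'I_k].
rewrite [X in prob _ X](_ : _ = [set w | Phi' [ffun i => redmx a (M i w)]]); last first.
  apply/seteqP; split=> w /=; rewrite /Phi'.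
    by congr (is_true (Phi _)); apply: eq_map => i; rewrite ffunE.
  by congr (is_true (Phi _)); apply: eq_map => i; rewrite ffunE.
rewrite (prob_sum _ measurable_redmxs).
rewrite -iexp_tuple (reindex (fun ms : {ffun 'I_k -> 'M['Z_a]_n} => [tuple ms i | i < k])) /=.
  rewrite big_mkcond; apply: eq_bigr => ms _; rewrite prob_redmxs big_map big_enum /=.
  rewrite /Phi'; case: ifP => _; by rewrite ?mulr1 ?mulr0.
exists (fun t : k.-tuple 'M['Z_a]_n => [ffun i => tnth t i]) => [ms _|t _].
  by apply/ffunP => i; rewrite ffunE tnth_mktuple.
by apply: eq_from_tnth => i; rewrite tnth_mktuple ffunE.
Qed.

End MatrixLaw.

(** * Singular matrices *)

Section SingularMatrices.
Variables (R : realType) (a : nat) (mu : balanced_law R a).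
Let a_gt1 : (1 < a)%N := law_gt1 mu.
Local Notation "''V_' n" := ('cV['Z_a]_n : finZmodType) (at level 8, n at level 2).

Lemma sum_act n (B : finZmodType) (F F1 : {ffun 'I_n -> B}) :
  \sum_M mxw mu M * (act F M == F1)%:R = \prod_(b <- vals F1) pr_ev mu F b.
Proof.
rewrite -(expo_mass mu F _ 1%G) expo_iexp size_vals -sum_mxw_iexp; apply: eq_bigr => M _; congr (_ * _).
rewrite mulr1; congr ((nat_of_bool _)%:R).
rewrite /cols -map_comp; apply/eqP/eqP => [<-|E].
  by apply: eq_map => j /=; rewrite ffunE.
apply/ffunP => j; rewrite ffunE.
have jE : j \in enum 'I_n by rewrite mem_enum.
by have /eq_in_map/(_ j jE) := E.
Qed.

Local Notation torZ := (Zp_torsion mu).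
(* Any [M] with [det M = 0] over the integers is killed by a primitive vector [y]
   modulo [2 ^ e.+1], hence by the [2 ^ e] surjections [u y] with [u] a unit. *)
Definition kill_count n (m : 'M['Z_a]_n) : nat :=
  #|[set F : {ffun 'I_n -> 'Z_a} | (imF mu torZ F == [set: 'Z_a]%G) && (act F m == [ffun=> 0])]|.

(** Factors of 2 are divided out of a nonzero kernel vector; the sum of absolute values decreases,
    so the descent ends at a vector with an odd entry. *)
Lemma primitive_kernel n (M : 'M[int]_n) : \det M = 0 ->
  exists (y : 'rV[int]_n) i, y *m M = 0 /\ ~~ (2 %| y 0%R i)%Z.
Proof.
move/eqP/det0P => [v v0 vM].
have [s vs] : exists s, (\sum_j `|v 0%R j|%N < s)%N by eexists; apply: ltnSn.
elim: s v v0 vM vs => // s IH v v0 vM vs.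
have [/existsP[i odd]|ev2] := boolP [exists i, ~~ (2 %| v 0%R i)%Z]; first by exists v, i.
have even i : (2 %| v 0%R i)%Z by move/existsPn: ev2 => /(_ i); rewrite negbK.
pose v' : 'rV[int]_n := map_mx (fun x => (x %/ 2)%Z) v.
have vE : v = 2%:Z *: v'.
  by apply/rowP => j; rewrite !mxE; apply: (@dvdzE_mul 2).
have vEj j : `|v 0%R j|%N = (2 * `|v' 0%R j|)%N.
  by have /rowP/(_ j) -> := vE; rewrite [X in `|X|%N]mxE abszM.
have v'0 : v' != 0 by apply: contra v0 => /eqP v'0; rewrite vE v'0 scaler0.
apply: (IH v') => //.
  by apply: (@scalemx_inj _ _ _ (2%:Z)) => //; rewrite scaler0 scalemxAl -vE.
have [i vi] : exists i, v' 0 i != 0 by apply/rV0Pn.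
apply: leq_trans _ (vs : (_ <= s)%N).
rewrite (bigD1 i) //= [X in (_ < X)%N](bigD1 i) //= -addSn leq_add //.
  by rewrite vEj mul2n -addnn -addn1 leq_add2l lt0n absz_eq0.
by apply: leq_sum => j _; rewrite vEj leq_pmull.
Qed.

(** The [2 ^ e] units [u] of [Z/a] give distinct multiples [u y] of the primitive kernel vector,
    since its odd entry is a unit; that entry also makes each of them surjective. *)
Lemma singular_kill_count n (M : 'M[int]_n) e : a = (2 ^ e.+1)%N -> \det M = 0 ->
  (2 ^ e <= kill_count (redmx a M))%N.
Proof.
move=> aE /primitive_kernel[y [i [yM yi]]].
have cu : #|{: {unit 'Z_a}}| = (2 ^ e)%N.
  have := card_units_Zp (ltnW a_gt1); rewrite /units_Zp cardsT => ->.
  by rewrite {1}aE totient_pfactor // mul1n.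
have unit_i : ((y 0 i)%:~R : 'Z_a) \is a GRing.unit.
  apply: intr_Zp_unit => //; rewrite {1}aE coprime_sym coprime_pexpl // coprime2n.
  by move: yi; rewrite dvdzE /= dvdn2 negbK.
pose F (u : {unit 'Z_a}) : {ffun 'I_n -> 'Z_a} := [ffun j => val u * (y 0 j)%:~R].
have Finj : injective F.
  move=> u v /ffunP/(_ i); rewrite !ffunE => /(mulIr unit_i); exact: val_inj.
rewrite -cu -(card_imset _ Finj); apply: subset_leq_card; apply/fintype.subsetP => _ /imsetP[u _ ->].
have evF (x : 'V_n) : ev (F u) x = val u * \sum_j (y 0 j)%:~R * x j 0.
  rewrite /ev mulr_sumr; apply: eq_bigr => j _; rewrite ffunE -mulr_natr natr_Zp mulrA //.
rewrite inE; apply/andP; split.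
  apply/eqP; apply: eq_group => g; rewrite [RHS]inE; apply/(mem_imF mu torZ).
  exists (\col_j if j == i then (val u * (y 0 i)%:~R)^-1 * g else 0).
  rewrite evF (bigD1 i) //= big1 => [|j ji]; last by rewrite mxE (negbTE ji) mulr0.
  have uu : val u * (y 0 i)%:~R \is a GRing.unit by rewrite unitrM unit_i (valP u).
  by rewrite mxE eqxx addr0 !mulrA mulrV ?mul1r.
apply/eqP/ffunP => j; rewrite !ffunE evF.
have := congr1 (fun A : 'rV[int]_n => ((A 0 j)%:~R : 'Z_a)) yM; rewrite !mxE rmorph_sum /= => yMj.
rewrite (eq_bigr (fun l => (y 0 l * M l j)%:~R)) => [|l _]; last by rewrite !mxE rmorphM.
by rewrite yMj mulr0.
Qed.

Local Open Scope classical_set_scope.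

(** Markov's inequality: the mean of [kill_count] is the sum in [sum_pr_le] for [H = Z/a] and
    [F1 = 0], hence eventually at most 2. *)
Lemma kill_count_tail (N : nat) : (0 < N)%N ->
  \forall n \near \oo, \sum_(m : 'M['Z_a]_n | (N <= kill_count m)%N) mxw mu m <= 2 / N%:R.
Proof.
move=> N0; have := sum_pr_le mu torZ; apply: filterS => n /(_ [set: 'Z_a]%G [ffun=> 0]) h.
have N0' : 0 < N%:R :> R by rewrite ltr0n.
have mx0 (m : 'M['Z_a]_n) : 0 <= mxw mu m by apply: prodr_ge0 => j _; apply: colw_ge0.
rewrite ler_pdivlMr // mulr_suml; apply: le_trans (h _); last first.
  by apply/fintype.subsetP => x; rewrite !inE.
under [leRHS]eq_bigr => F _ do rewrite -sum_act.
rewrite exchange_big /= big_mkcond; apply: ler_sum => m _.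
rewrite -mulr_sumr; case: ifP => [Nm|_]; last by rewrite mulr_ge0 // sumr_ge0.
rewrite ler_wpM2l //; apply: (@le_trans _ _ (kill_count m)%:R); first by rewrite ler_nat.
rewrite /kill_count -sum1_card natr_sum big_mkcond [leRHS]big_mkcond; apply: ler_sum => F _.
by rewrite inE; case: (_ == _) => //=; case: (_ == _).
Qed.

End SingularMatrices.

(** * The limiting constant *)

Section Pochhammer.
Variable R : realType.
Local Open Scope classical_set_scope.
Import numFieldNormedType.Exports.

Lemma qpochhammer_cvg (p : nat) : (1 < p)%N ->
  (fun n : nat => \prod_(0 <= i < n) (1 - (p%:R^-1 : R) * p%:R^-1 ^+ i)) @ \oo --> qpochhammer (p%:R^-1 : R) p%:R^-1.
Proof.
move=> p1; have q0 : 0 <= (p%:R^-1 : R) by rewrite invr_ge0.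
have q1 : (p%:R^-1 : R) <= 1 by rewrite invf_le1 ?ltr0n ?ler1n // ltnW.
have f01 i : 0 <= 1 - (p%:R^-1 : R) * p%:R^-1 ^+ i <= 1.
  by rewrite -exprS subr_ge0 exprn_ile1 // gerBl exprn_ge0.
have pr0 n : 0 <= \prod_(0 <= i < n) (1 - (p%:R^-1 : R) * p%:R^-1 ^+ i).
  by apply: prodr_ge0 => i _; case/andP: (f01 i).
apply: nonincreasing_is_cvgn.
  by apply/nonincreasing_seqP => n; rewrite big_nat_recr //= ler_piMr //; case/andP: (f01 n).
by exists 0 => _ [n _ <-].
Qed.

Lemma cvg_bigprod (I : eqType) (s : seq I) (f : I -> nat -> R) (l : I -> R) :
  (forall i, i \in s -> f i @ \oo --> l i) -> (fun n => \prod_(i <- s) f i n) @ \oo --> \prod_(i <- s) l i.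
Proof.
elim: s => [|i s IH] fl.
  by under eq_fun do rewrite big_nil; rewrite big_nil; apply: cvg_cst.
under eq_fun do rewrite big_cons; rewrite big_cons; apply: cvgM; first by apply: fl; rewrite mem_head.
by apply: IH => j js; apply: fl; rewrite inE js orbT.
Qed.

Lemma cprod_cvg (P : {fset nat}) a : (0 < a)%N -> (forall p, p \in P -> prime p) ->
  (forall p, prime p -> (p %| a)%N = (p \in P)) ->
  cprod R a @ \oo --> \prod_(p <- P) qpochhammer (p%:R^-1 : R) p%:R^-1.
Proof.
move=> a0 primeP prime_a.
have PE : perm_eq (primes a) P.
  apply: uniq_perm; rewrite ?primes_uniq ?fset_uniq // => p; rewrite mem_primes a0 /=.
  by apply/andP/idP => [[pp]|pP]; [rewrite prime_a|have pp := primeP _ pP; rewrite prime_a].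
rewrite (_ : cprod R a = fun n => \prod_(p <- P) \prod_(0 <= i < n) (1 - (p%:R^-1 : R) * p%:R^-1 ^+ i)).
  by apply: cvg_bigprod => p pP; apply: qpochhammer_cvg; apply: prime_gt1; apply: primeP.
apply/funext => n; rewrite exchange_big big_mkord; apply: eq_bigr => i _.
by rewrite /qd (perm_big _ PE); apply: eq_bigr => p _; rewrite -exprS exprVn.
Qed.

End Pochhammer.

(** * From towers to cokernels of products *)

Section Assembly.
Variables (R : realType) (k : nat) (B : finZmodType) (P : {fset nat}).
Variables (Q b a : nat) (mu : balanced_law R a).
Hypothesis aE : a = (Q * b)%N.
Hypothesis torB : forall g : B, g *+ a = 0.
Hypothesis torb : forall g : B, g *+ b = 0.
Hypothesis primeP : forall p, p \in P -> prime p.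
Hypothesis prime_a : forall p, prime p -> (p %| a)%N = (p \in P).
Hypothesis primeQ : forall p, p \in P -> (p %| Q)%N.
Let a_gt1 : (1 < a)%N := law_gt1 mu.

Lemma redmx_prod n (M : 'I_k -> 'M[int]_n) :
  redmx a (\prod_(i < k) M i) = foldr mulmx 1%:M [seq redmx a (M i) | i <- enum 'I_k].
Proof.
have -> : \prod_(i < k) M i = \prod_(i <- enum 'I_k) M i.
  by rewrite enumT [index_enum _]unlock.
elim: (enum _) => [|i s IH]; first by rewrite big_nil /= /redmx map_mx1.
by rewrite big_cons /= -IH /redmx -map_mxM.
Qed.

Lemma det_prod_neq0 n (M : 'I_k -> 'M[int]_n) :
  (forall i, \det (M i) != 0) -> \det (\prod_(i < k) M i) != 0.
Proof.
move=> M0; elim/big_rec: _ => [|i N _ N0]; first by rewrite det1.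
by rewrite [X in \det X](_ : _ = M i *m N) // det_mulmx mulf_neq0.
Qed.

Definition surj_onto_B n (ms : seq 'M['Z_a]_n) : bool :=
  [exists F : {ffun 'I_n -> B}, (imF mu torB F == [set: B]%G) && tower_ok mu torB F ms].

Lemma Cok_prodP n (M : 'I_k -> 'M[int]_n) : (forall i, \det (M i) != 0) ->
  zmod_isom (primary_sum (Cok (\prod_(i < k) M i)) P) B <->
  surj_onto_B [seq redmx a (M i) | i <- enum 'I_k].
Proof.
move=> M0; rewrite (Cok_primary_isomP mu torB primeP aE prime_a primeQ torb) ?det_prod_neq0 //.
have Qp p : prime p -> (p %| a)%N -> (p %| Q)%N by move=> pp; rewrite prime_a //; apply: primeQ.
rewrite redmx_prod; split=> [[F imE kerE]|/existsP[F /andP[/eqP imE]]].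
  by apply/existsP; exists F; rewrite (tower_okE mu torB aE Qp torb) imE kerE !eqxx.
by rewrite (tower_okE mu torB aE Qp torb) => /eqP kerE; exists F.
Qed.

(** The tower mass is the expected number of surjections with the right kernel; by [card_surj_ker]
    this number is [num_aut B] when there is one, and [0] otherwise. *)
Lemma surj_onto_B_mass n :
  iexp (@mxw R a mu n) k (fun ms => (surj_onto_B ms)%:R) = tower_mass mu torB n k [set: B]%G / (num_aut B)%:R.
Proof.
have aut0 : (num_aut B)%:R != 0 :> R by rewrite pnatr_eq0 -lt0n cardG_gt0.
apply: (mulIf aut0); rewrite mulfVK // mulrC -iexpZ /tower_mass -iexp_sum.
have Qp p : prime p -> (p %| a)%N -> (p %| Q)%N by move=> pp; rewrite prime_a //; apply: primeQ.
apply: eq_iexp => ms _; rewrite -natr_sum.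
have [/existsP[F0 /andP[/eqP im0]]|] := boolP (surj_onto_B ms).
  rewrite (tower_okE mu torB aE Qp torb) => /eqP ker0; rewrite mulr1; congr (_%:R).
  rewrite -(card_surj_ker im0 ker0) -sum1_card big_mkcond [RHS]big_mkcond /=.
  apply: eq_bigr => F _; rewrite inE (tower_okE mu torB aE Qp torb).
  by case: (_ == _) => //=; case: (_ == _).
rewrite mulr0 => /existsPn no; rewrite big1 // => F imE.
by have := no F; rewrite imE /= => /negbTE ->.
Qed.

End Assembly.

Section Trivial.
Variables (B : finZmodType).
Hypothesis B1 : #|B| = 1%N.

Lemma trivial_eq (x y : B) : x = y.
Proof. by have /fintype_le1P := eq_leq B1; apply. Qed.

Lemma trivial_group (H : {group B}) : H = 1%G.
Proof. by apply: eq_group => x; rewrite (trivial_eq x 0) !group1. Qed.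

Lemma trivial_chain_count k (H : {group B}) : chain_count k H = 1%N.
Proof.
elim: k H => [|k IH] H /=; first by rewrite (trivial_group H) eqxx.
by rewrite (big_pred1 1%G) // => H'; rewrite (trivial_group H') sub1G /= eqxx.
Qed.

Lemma trivial_num_aut : num_aut B = 1%N.
Proof.
rewrite /num_aut (_ : Aut _ = 1%g) ?cards1 //; apply/setP => f.
have -> : f = 1%g by apply/perm.permP => x; apply: trivial_eq.
by rewrite !group1.
Qed.

Lemma trivial_isom (G : zmodType) : zmod_isom (primary_sum G fset0) B.
Proof.
apply: (@zmod_isomI _ _ (fun=> 0)) => [x y|]; first by rewrite subr0.
exists (fun=> 0) => [u|x]; last exact: trivial_eq.
by apply/val_inj/ffunP => -[p pP]; exfalso; have := pP; rewrite in_fset0.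
Qed.

End Trivial.

Import numFieldNormedType.Exports.
Local Open Scope classical_set_scope.
Local Open Scope ring_scope.

Theorem theorem1p1 (R : realType) (k : nat) (hk : (1 <= k)%N)
  (alpha : R) (halpha : 0 < alpha <= 1 / 2%:R)
  (d0 : measure_display) (T0 : measurableType d0) (Pr0 : probability T0 R)
  (xi : {RV Pr0 >-> int}) (hxi : alpha_balanced Pr0 xi alpha)
  (d : nat -> measure_display) (T : forall n : nat, measurableType (d n))
  (Pr : forall n : nat, probability (T n) R)
  (M : forall n : nat, 'I_k -> {RV (Pr n) >-> 'M[int]_n})
  (hM : forall n : nat, (1 <= n)%N ->
     mutually_independent (Pr n) (fun i : 'I_k => M n i : T n -> 'M[int]_n))
  (hxiM : forall (n : nat) (i : 'I_k), (1 <= n)%N ->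
     iid_entries (Pr n) Pr0 (M n i) xi)
  (B : finZmodType) (P : {fset nat})
  (hP : forall p : nat, p \in P -> prime p)
  (hPB : forall p : nat, prime p -> (p %| #|B|)%N -> p \in P) :
  Pr n [set w | zmod_isom (primary_sum (Cok (\prod_(i < k) M n i w)) P) B]
    @[n --> \oo] -->
  ((\prod_(p <- P) qpochhammer (p%:R^-1) (p%:R^-1) ^+ k)
     * #|subgroup_chains B k|%:R / (num_aut B)%:R)%:E.
Proof.
have B0 : (0 < #|B|)%N by apply/card_gt0P; exists 0.
(* For empty [P] the modulus [a] would be [1], excluded by [law_gt1]; but then [B] is trivial, and
   the probabilities and the limit are all [1]. *)
case: (fset_0Vmem P) => [P0|[p0 p0P]].
  have B1 : #|B| = 1%N.
    apply/eqP; rewrite eqn_leq B0 andbT leqNgt; apply/negP => B1.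
    by have := hPB _ (pdiv_prime B1) (pdiv_dvd _); rewrite P0 in_fset0.
  have RE : (\prod_(p <- P) qpochhammer (p%:R^-1) (p%:R^-1) ^+ k)
     * #|subgroup_chains B k|%:R / (num_aut B)%:R = 1 :> R.
    by rewrite P0 big_seq_fset0 card_subgroup_chains trivial_chain_count // trivial_num_aut // divr1 mulr1.
  rewrite RE.
  have E n : Pr n [set w | zmod_isom (primary_sum (Cok (\prod_(i < k) M n i w)) P) B]%classic = 1%:E.
    rewrite -(@probability_setT _ _ _ (Pr n)); congr (Pr n _); apply/seteqP; split=> // w _ /=.
    by rewrite P0; apply: trivial_isom.
  under eq_fun do rewrite E; exact: cvg_cst.
(* Through [Q], the primes dividing [a] are exactly those of [P], and [a %/ p] is still a multiple
   of [b]. *)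
pose b := #|B|; pose Q := (\prod_(p <- P) p)%N; pose a := (Q * b)%N.
have Q0 : (0 < Q)%N by rewrite /Q big_seq prodn_cond_gt0 // => p /hP/prime_gt0.
have a0 : (0 < a)%N by rewrite muln_gt0 Q0.
have primeQ p : p \in P -> (p %| Q)%N.
  by move=> pP; rewrite /Q (big_rem p) //= dvdn_mulr.
have a_gt1 : (1 < a)%N.
  apply: leq_trans (prime_gt1 (hP _ p0P)) _; apply: dvdn_leq => //.
  by rewrite dvdn_mulr // primeQ.
have prime_a p : prime p -> (p %| a)%N = (p \in P).
  move=> pp; apply/idP/idP => [|pP]; last by rewrite dvdn_mulr // primeQ.
  rewrite Euclid_dvdM // => /orP[|/hPB]; last exact.
  rewrite /Q Euclid_dvd_prod // big_has => /hasP[q qP]; rewrite (dvdn_prime2 pp (hP _ qP)).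
  by move/eqP->.
have torb (g : B) : g *+ b = 0 by rewrite -FinRing.zmodXgE /b -cardsT expg_cardG ?inE.
have torB (g : B) : g *+ a = 0 by rewrite /a mulnC mulrnA torb mul0rn.
have torBp p (g : B) : prime p -> (p %| a)%N -> g *+ (a %/ p) = 0.
  move=> pp; rewrite prime_a // => /primeQ/divnK pQ.
  by rewrite /a -pQ mulnAC mulnK ?prime_gt0 // mulnC mulrnA torb mul0rn.
have aE0 : a = (Q * b)%N by [].
clearbody a; pose mu := xi_balanced halpha hxi a_gt1.
have cc := @cprod_cvg R P a a0 hP prime_a; set c := \prod_(p <- P) qpochhammer _ _ in cc.
have -> : \prod_(p <- P) qpochhammer p%:R^-1 p%:R^-1 ^+ k = c ^+ k by rewrite /c prodrXl.
rewrite card_subgroup_chains.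
pose E n : set (T n) := [set w | zmod_isom (primary_sum (Cok (\prod_(i < k) M n i w)) P) B]%classic.
pose A n : set (T n) := [set w | surj_onto_B mu torB [seq redmx a (M n i w) | i <- enum 'I_k]]%classic.
pose S n : set (T n) := [set w | exists i, \det (M n i w) = 0]%classic.
have mE n : measurable (E n).
  exact: (measurable_Ms (M n) (fun ms => zmod_isom (primary_sum (Cok (\prod_(i < k) ms i)) P) B)).
have mA n : measurable (A n).
  exact: (measurable_Ms (M n) (fun ms => surj_onto_B mu torB [seq redmx a (ms i) | i <- enum 'I_k])).
have mS n : measurable (S n).
  exact: (measurable_Ms (M n) (fun ms => exists i, \det (ms i) = 0)).
(* [Cok_prodP] requires nonzero determinants, so the two events can differ only on [S n]. *)
have EA n : `|prob (Pr n) (E n) - prob (Pr n) (A n)| <= prob (Pr n) (S n).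
  have EAw w : ~ S n w -> E n w <-> A n w.
    move=> nS; have := Cok_prodP mu aE0 torB torb hP prime_a primeQ (M := fun i => M n i w).
    by apply=> i; apply/negP => /eqP d0'; apply: nS; exists i.
  have sub (X Y : set (T n)) : measurable X -> measurable Y ->
      (forall w, ~ S n w -> X w -> Y w) -> prob (Pr n) X <= prob (Pr n) Y + prob (Pr n) (S n).
    move=> mX mY XY; apply: le_trans (prob_setU_le _ mY (mS n)); apply: le_prob => //; first exact: measurableU.
    by move=> w Xw; have [Sw|nSw] := pselect (S n w); [right|left; apply: XY].
  have h1 := sub _ _ (mE n) (mA n) (fun w nS => (EAw w nS).1).
  have h2 := sub _ _ (mA n) (mE n) (fun w nS => (EAw w nS).2).
  rewrite ler_norml; apply/andP; split; lra.
have limA : (fun n => prob (Pr n) (A n)) @ \oo --> c ^+ k * (chain_count k [set: B]%G)%:R / (num_aut B)%:R.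
  have lim := @tower_mass_cvg _ _ mu _ torB torBp c k [set: B]%G cc.
  have : (fun n => tower_mass mu torB n k [set: B]%G / (num_aut B)%:R) @ \oo --> c ^+ k * (chain_count k [set: B]%G)%:R / (num_aut B)%:R by exact: cvgMl.
  apply: cvg_trans; apply: near_eq_cvg; near=> n.
  have n1 : (1 <= n)%N by near: n; exact: nbhs_infty_ge.
  rewrite -(surj_onto_B_mass k mu aE0 torB torb prime_a primeQ).
  by rewrite -(@prob_redmxs_sum _ _ _ _ _ _ _ xi _ _ (M n) (hM n n1) (fun i => hxiM n i n1) _ mu (fun=> erefl)).
have limS : (fun n => prob (Pr n) (S n)) @ \oo --> (0 : R).
  (* The auxiliary modulus [2 ^ e.+1] is independent of [a]. Each of the [k] matrices is singular
     with probability eventually at most [2 / 2 ^ e], and [e] is arbitrary. *)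
  have S_le e : \forall n \near \oo, prob (Pr n) (S n) <= k%:R * 2 * (2^-1) ^+ e.
    have a2 : (1 < 2 ^ e.+1)%N by rewrite -{1}(expn0 2) ltn_exp2l.
    have := @kill_count_tail R _ (xi_balanced halpha hxi a2) (2 ^ e) _; rewrite expn_gt0 => /(_ isT) tail.
    near=> n.
    have n1 : (1 <= n)%N by near: n; exact: nbhs_infty_ge.
    apply: le_trans (prob_exists_le (Pr n) (p := fun i => [set w | \det (M n i w) = 0]) _) _.
      by move=> i; apply: (measurable_M (M n) i [set N | \det N = 0]).
    rewrite -mulrA -[X in X%:R * _](card_ord k) mulr_natl -sumr_const; apply: ler_sum => i _.
    pose mu2 := xi_balanced halpha hxi a2.
    have mZ m : measurable [set w | redmx (2 ^ e.+1) (M n i w) = m].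
      exact: (measurable_M (M n) i [set N | redmx (2 ^ e.+1) N = m]).
    apply: (@le_trans _ _ (prob (Pr n) [set w | (2 ^ e <= kill_count mu2 (redmx (2 ^ e.+1) (M n i w)))%N])).
      apply: le_prob.
      - exact: (measurable_M (M n) i [set N | \det N = 0]).
      - exact: (measurable_M (M n) i [set N | (2 ^ e <= kill_count mu2 (redmx (2 ^ e.+1) N))%N]).
      - by move=> w /= Mw0; apply: singular_kill_count.
    rewrite (prob_sum (Pr n) mZ (fun m => (2 ^ e <= kill_count mu2 m)%N)).
    under eq_bigr => m _ do rewrite (@prob_redmx _ _ _ _ _ _ _ xi _ _ (M n) (fun i => hxiM n i n1) _ mu2 (fun=> erefl)).
    by rewrite exprVn -natrX; near: n.
  have ge0 : (fun e : nat => k%:R * 2 * (2^-1 : R) ^+ e) @ \oo --> (0 : R).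
    by apply: cvg0Ml; apply: cvg_expr; rewrite ger0_norm //; lra.
  apply/cvgr0Pnorm_le => e e0.
  have [N _ /(_ _ (leqnn N)) Ne] := cvg_near_le ge0 e0.
  have := S_le N; apply: filterS => n Sn.
  by rewrite ger0_norm ?prob_ge0 //; apply: le_trans Sn Ne.
apply: cvg_EFin; first by near=> n; apply: fin_num_measure; apply: mE.
rewrite [X in X @ _](_ : _ = (fun n => prob (Pr n) (A n) + (prob (Pr n) (E n) - prob (Pr n) (A n)))); last first.
  by apply/funext => n; rewrite addrC subrK.
rewrite -[X in _ --> X]addr0; apply: cvgD => //.
apply/cvgr0Pnorm_le => e e0; near=> n; apply: le_trans (EA n) _.
near: n; have := cvg_near_le limS e0; by [].
Unshelve. all: by end_near.
Qed.
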